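(* Let $N\ge2$. In the three-dimensional parameter space of $(p,q,c)$, for each nonzero integer $M$ let $\Sigma_{N,M}$ be the two-dimensional surface of triplets $(p,q,c)$ satisfying $(-p^{1/2})^{NM}=q^{-c-N}$. On the surface $\Sigma_{N,M}$, the generators $t(z)=\mathrm{Tr}\big(L^+(q^{c/2}z)L^-(z)^{-1}\big)$ realize an exchange algebra with the generators $L(w)$ of $\mathcal A_{q,p}(\widehat{sl}(N)_c)$: $$t(z)\,L(w)=F\Big(M,\frac wz\Big)\,L(w)\,t(z),$$ where $$F(M,x)=q^{2M(N-1)}\prod_{k=0}^{NM-1}\frac{\Theta_{q^{2N}}(x^{-2}p^{-k})\,\Theta_{q^{2N}}(x^2p^k)}{\Theta_{q^{2N}}(x^{-2}q^2p^{-k})\,\Theta_{q^{2N}}(x^2q^2p^k)}\quad\text{for }M>0,$$ $$F(M,x)=q^{-2|M|(N-1)}\prod_{k=1}^{N|M|}\frac{\Theta_{q^{2N}}(x^{-2}q^2p^k)\,\Theta_{q^{2N}}(x^2q^2p^{-k})}{\Theta_{q^{2N}}(x^{-2}p^k)\,\Theta_{q^{2N}}(x^2p^{-k})}\quad\text{for }M<0.$$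
   Context: Parameters: $z=e^{i\pi\xi}$, $q=e^{i\pi\zeta}$, $p=e^{2i\pi\tau}$ with $|q|<1$, $|p|<1$; $z^a=e^{i\pi a\xi}$, $q^a=e^{i\pi a\zeta}$, $p^a=e^{2i\pi a\tau}$. $\omega=e^{2i\pi/N}$. Matrix indices lie in $\mathbb Z_N=\mathbb Z/N\mathbb Z$. Theta functions: $\vartheta\left[{\gamma_1\atop\gamma_2}\right](\xi,\tau)=\sum_{m\in\mathbb Z}\exp\big(i\pi(m+\gamma_1)^2\tau+2i\pi(m+\gamma_1)(\xi+\gamma_2)\big)$; $(z;p_1,\dots,p_m)_\infty=\prod_{n_i\ge0}(1-zp_1^{n_1}\cdots p_m^{n_m})$; $\Theta_a(z)=(z;a)_\infty(az^{-1};a)_\infty(a;a)_\infty$. $R$-matrix: $g_{ij}=\omega^i\delta_{ij}$, $h_{ij}=\delta_{i+1,j}$, $g^{1/2}=\mathrm{diag}(\omega^{i/2})_{0\le i\le N-1}$, $I_{(\alpha_1,\alpha_2)}=g^{\alpha_2}h^{\alpha_1}$, $$W_{(\alpha_1,\alpha_2)}(\xi,\zeta,\tau)=\frac{\vartheta\left[{1/2+\alpha_1/N\atop 1/2+\alpha_2/N}\right](\xi+\zeta/N,\tau)}{N\,\vartheta\left[{1/2+\alpha_1/N\atop 1/2+\alpha_2/N}\right](\zeta/N,\tau)},$$ $$\frac1{\kappa(z^2)}=\frac{(q^{2N}z^{-2};p,q^{2N})_\infty(q^2z^2;p,q^{2N})_\infty(pz^{-2};p,q^{2N})_\infty(pq^{2N-2}z^2;p,q^{2N})_\infty}{(q^{2N}z^2;p,q^{2N})_\infty(q^2z^{-2};p,q^{2N})_\infty(pz^2;p,q^{2N})_\infty(pq^{2N-2}z^{-2};p,q^{2N})_\infty},$$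 $$\widetilde R(z,q,p)=z^{2/N-2}\frac1{\kappa(z^2)}\frac{\vartheta\left[{1/2\atop1/2}\right](\zeta,\tau)}{\vartheta\left[{1/2\atop1/2}\right](\xi+\zeta,\tau)}\sum_{(\alpha_1,\alpha_2)\in\mathbb Z_N^2}W_{(\alpha_1,\alpha_2)}(\xi,\zeta,\tau)\,I_{(\alpha_1,\alpha_2)}\otimes I_{(\alpha_1,\alpha_2)}^{-1},$$ $$R(z,q,p)=(g^{1/2}\otimes g^{1/2})\widetilde R(z,q,p)(g^{-1/2}\otimes g^{-1/2}),\quad \tau_N(z)=z^{2/N-2}\frac{\Theta_{q^{2N}}(qz^2)}{\Theta_{q^{2N}}(qz^{-2})},\quad \widehat R_{12}(z,q,p)=\tau_N(q^{1/2}z^{-1})R_{12}(z,q,p).$$ Algebra: $\mathcal A_{q,p}(\widehat{gl}(N)_c)$ is the algebra of operators $L_{ij}(z)=\sum_{n\in\mathbb Z}L_{ij}(n)z^n$, gathered in the matrix $L(z)=(L_{ij}(z))$, subject to $\widehat R_{12}(z/w)L_1(z)L_2(w)=L_2(w)L_1(z)\widehat R^*_{12}(z/w)$, with $L_1(z)=L(z)\otimes1$, $L_2(z)=1\otimes L(z)$, $\widehat R^*_{12}(z,q,p)=\widehat R_{12}(z,q,pq^{-2c})$. The $q$-determinant $q\text{-}\det L(z)=\sum_{\sigma\in\mathfrak S_N}\varepsilon(\sigma)\prod_{i=1}^NL_{i,\sigma(i)}(zq^{i-N-1})$ is central and $\mathcal A_{q,p}(\widehat{sl}(N)_c)=\mathcal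 A_{q,p}(\widehat{gl}(N)_c)/\langle q\text{-}\det L-q^{c/2}\rangle$. Further $L^+(z)=L(q^{c/2}z)$ and $L^-(z)=(g^{1/2}hg^{1/2})L(-p^{1/2}z)(g^{1/2}hg^{1/2})^{-1}$.
   Formalization: Besides (-p^{1/2})^{NM}=q^{-c-N}, the surface is also required to satisfy p^M=q^{-2(c+N)/N} (automatic for N=2); for N>2 the claim fails on the other branches, e.g. N=3, M=-1, c=0, L=1, p=q^2 e^{4iπ/3}. *)

(* Defs.v *)
From HB Require Import structures.
From mathcomp Require Import all_boot all_order all_algebra perm complex mxtens.
From mathcomp Require Import all_classical all_reals all_analysis.

Set Implicit Arguments.
Unset Strict Implicit.
Unset Printing Implicit Defensive.

Import Order.TTheory GRing.Theory Num.Theory numFieldNormedType.Exports.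
Local Open Scope classical_set_scope.
Local Open Scope ring_scope.
Local Open Scope complex_scope.

(* Spectral parameters are additive: xi, zeta, tau stand for                  *)
(*   z = e^{i pi xi},  q = e^{i pi zeta},  p = e^{2 i pi tau},                *)
(* and fractional or complex powers are z^a = e^{i pi a xi}, etc.  This is    *)
(* needed because the R-matrix contains z^{2/N} and is not single-valued in z *)
(* when N > 2.  Accordingly z/w is xi - eta, q^a z is xi + a zeta, and        *)
(* -p^{1/2} z is xi + tau + 1, with -1 = e^{i pi}; it is with this            *)
(* determination of -1 that R(-p^{1/2} z) is conjugate to R(z) by             *)
(* g^{1/2} h g^{1/2} up to a scalar.                                          *)

Section SpecialFunctions.
Variable R : realType.
Local Notation C := R[i].

Definition cexp (x : C) : C :=
  (expR (complex.Re x))%:C * (cos (complex.Im x) +i* sin (complex.Im x)).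

(* e^{i pi a} *)
Definition epi (a : C) : C := cexp ((0 +i* pi) * a).

(* R[i]^o is R[i] with its topology; [Negz n] is the integer - (n + 1). *)
Definition sumZ (u : int -> C) : C :=
  limn (series (fun n => u (Posz n) : C^o))
  + limn (series (fun n => u (Negz n) : C^o)).

Definition sumZ_to (u : int -> C) (s : C) : Prop :=
  exists a b : C,
    [/\ series (fun n => u (Posz n) : C^o) @ \oo --> (a : C^o),
        series (fun n => u (Negz n) : C^o) @ \oo --> (b : C^o) & s = a + b].

Definition theta (g1 g2 xi tau : C) : C :=
  sumZ (fun m => epi ((m%:~R + g1) ^+ 2 * tau
                      + 2 * (m%:~R + g1) * (xi + g2))).

(* (z; a)_oo and (z; a, b)_oo *)
Definition qpoch (z a : C) : C :=
  limn (fun K : nat => \prod_(n < K) (1 - z * a ^+ n) : C^o).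

Definition qpoch2 (z a b : C) : C :=
  limn (fun K : nat =>
    \prod_(n < K) \prod_(m < K) (1 - z * a ^+ n * b ^+ m) : C^o).

Definition Theta (a z : C) : C := qpoch z a * qpoch (a / z) a * qpoch a a.

(* Equalities between meromorphic expressions in z/w are understood away from *)
(* their poles: outside a closed discrete set of values of xi - eta.          *)
Definition locally_finite (S : set C) : Prop :=
  forall r : R, finite_set (S `&` [set x | `|x| <= r%:C]).

Definition off_poles (P : C -> C -> Prop) : Prop :=
  exists2 S : set C, locally_finite S &
    forall xi eta : C, ~ S (xi - eta) -> P xi eta.

End SpecialFunctions.

Section RMatrix.
Variables (R : realType) (N : nat).
Local Notation C := R[i].

Definition theta_char (a : 'I_N) : C := 2^-1 + a%:R / N%:R.

Definition gmx : 'M[C]_N :=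
  \matrix_(i, j) (epi (2 * i%:R / N%:R) *+ (i == j)).
Definition hmx : 'M[C]_N := \matrix_(i, j) ((i.+1 %% N)%N == j)%:R.
Definition ghalf : 'M[C]_N := \matrix_(i, j) (epi (i%:R / N%:R) *+ (i == j)).
Definition Imx (a1 a2 : 'I_N) : 'M[C]_N := gmx ^+ a2 *m hmx ^+ a1.

Definition W (a1 a2 : 'I_N) (xi zeta tau : C) : C :=
  theta (theta_char a1) (theta_char a2) (xi + zeta / N%:R) tau
  / (N%:R * theta (theta_char a1) (theta_char a2) (zeta / N%:R) tau).

(* 1 / kappa(z^2), as a function of zz = z^2 *)
Definition kappaV (zz q p : C) : C :=
  let P x := qpoch2 x p (q ^+ (2 * N)) in
  (P (q ^+ (2 * N) / zz) * P (q ^+ 2 * zz)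
   * P (p / zz) * P (p * q ^+ (2 * N - 2) * zz))
  / (P (q ^+ (2 * N) * zz) * P (q ^+ 2 / zz)
     * P (p * zz) * P (p * q ^+ (2 * N - 2) / zz)).

Definition Rtilde (xi zeta tau : C) : 'M[C]_(N * N) :=
  (epi ((2 / N%:R - 2) * xi)
   * kappaV (epi (2 * xi)) (epi zeta) (epi (2 * tau))
   * (theta 2^-1 2^-1 zeta tau / theta 2^-1 2^-1 (xi + zeta) tau))
  *: \sum_(a1 < N) \sum_(a2 < N)
       W a1 a2 xi zeta tau *: tensmx (Imx a1 a2) (invmx (Imx a1 a2)).

Definition Rmx (xi zeta tau : C) : 'M[C]_(N * N) :=
  tensmx ghalf ghalf *m Rtilde xi zeta tau
  *m tensmx (invmx ghalf) (invmx ghalf).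

Definition tauN (xi zeta : C) : C :=
  let q := epi zeta in let zz := epi (2 * xi) in
  epi ((2 / N%:R - 2) * xi)
  * (Theta (q ^+ (2 * N)) (q * zz) / Theta (q ^+ (2 * N)) (q / zz)).

Definition Rhat (xi zeta tau : C) : 'M[C]_(N * N) :=
  tauN (zeta / 2 - xi) zeta *: Rmx xi zeta tau.

(* The theta functions dividing in W do not vanish (equivalently q^2 is not an *)
(* integral power of p), so that the R-matrix is defined.                      *)
Definition R_defined (zeta tau : C) : Prop :=
  forall a1 a2 : 'I_N, theta (theta_char a1) (theta_char a2) (zeta / N%:R) tau != 0.

End RMatrix.

Section Algebra.
Variables (R : realType) (N : nat).
Local Notation C := R[i].

Section Generators.
Variables (zeta tau c : C) (A : algType C).

Definition toA n (B : 'M[C]_n) : 'M[A]_n := map_mx (in_alg A) B.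

Definition tens1 (B : 'M[A]_N) : 'M[A]_(N * N) := tensmx B 1%:M.
Definition tens2 (B : 'M[A]_N) : 'M[A]_(N * N) := tensmx 1%:M B.

(* A realization of A_{q,p}(gl(N)_c) in an algebra of operators A.            *)
(* - p^* = p q^{-2c} is tau - c zeta.                                         *)
(* - The series defining L(z) converges weakly, i.e. for every matrix         *)
(*   coefficient in a family of linear forms separating the points of A.      *)
(* - The expansion is in integral powers of z^{1/ell}.  ell = 1 gives series  *)
(*   in z; for N > 2 the R-matrix is a function of z^{2/N} and not of z, so   *)
(*   that single-valuedness of L in z is not imposed.                         *)
Record gl_realization := GlRealization {
  genL : C -> 'M[A]_N;
  ell : nat;
  ell_gt0 : (0 < ell)%N;
  modes : int -> 'M[A]_N;
  mcoef : set {scalar A};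
  mcoef_sep : forall a : A, (forall phi, mcoef phi -> phi a = 0) -> a = 0;
  genL_modes : forall xi (i j : 'I_N) (phi : {scalar A}), mcoef phi ->
    sumZ_to (fun n : int => phi (modes n i j) * epi (n%:~R * xi / ell%:R))
            (phi (genL xi i j));
  genL_exchange : off_poles (fun xi eta : C =>
    toA (Rhat N (xi - eta) zeta tau) *m tens1 (genL xi) *m tens2 (genL eta)
    = tens2 (genL eta) *m tens1 (genL xi)
      *m toA (Rhat N (xi - eta) zeta (tau - c * zeta)))
}.

Variable L : C -> 'M[A]_N.

(* The rows are i = 1, ..., N in the formula                                  *)
(*   sum_sigma eps(sigma) prod_i L_{i, sigma(i)}(z q^{i-N-1})                 *)
(* and 0, ..., N-1 here; the product is taken in increasing order of i.       *)
Definition qdet (xi : C) : A :=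
  \sum_(s : 'S_N) (-1) ^+ s *
    \prod_(i < N) L (xi + (i%:R - N%:R) * zeta) i (s i).

Definition Gmx : 'M[C]_N := ghalf R N *m hmx R N *m ghalf R N.

Definition Lplus (xi : C) : 'M[A]_N := L (xi + c / 2 * zeta).
Definition Lminus (xi : C) : 'M[A]_N :=
  toA Gmx *m L (xi + tau + 1) *m toA (invmx Gmx).

(* invmx is only available over commutative rings *)
Definition is_invmx (B B' : 'M[A]_N) : Prop :=
  B *m B' = 1%:M /\ B' *m B = 1%:M.

(* t(z) when Lminv is the inverse of L^-(z) *)
Definition tgen (xi : C) (Lminv : 'M[A]_N) : A :=
  \tr (Lplus (xi + c / 2 * zeta) *m Lminv).

End Generators.

Record sl_realization (zeta tau c : C) (A : algType C) := SlRealization {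
  sl_gl :> gl_realization zeta tau c A;
  sl_qdet : forall xi, qdet zeta (genL sl_gl) xi = (epi (c / 2 * zeta))%:A
}.

(* The surface (-p^{1/2})^{NM} = q^{-c-N}.  The spectral parameter lives on    *)
(* the covering where z^{2/N} is defined, hence the second condition, which is *)
(* the (2/N)-th power of the first one: it selects the determination and       *)
(* follows from the first one when N = 2.                                      *)
Definition on_surface (M : int) (zeta tau c : C) : Prop :=
  (- epi tau) ^ (N%:Z * M) = epi (- (c + N%:R) * zeta) /\
  epi (2 * tau) ^ M = epi (- 2 / N%:R * (c + N%:R) * zeta).

Definition Fexch (M : int) (q p x : C) : C :=
  let Th := Theta (q ^+ (2 * N)) in
  if 0 < M then
    q ^+ (2 * `|M| * (N - 1)) *
    \prod_(0 <= k < N * `|M|)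
      ((Th (x ^- 2 * p ^- k) * Th (x ^+ 2 * p ^+ k))
       / (Th (x ^- 2 * q ^+ 2 * p ^- k) * Th (x ^+ 2 * q ^+ 2 * p ^+ k)))
  else
    q ^- (2 * `|M| * (N - 1)) *
    \prod_(1 <= k < (N * `|M|).+1)
      ((Th (x ^- 2 * q ^+ 2 * p ^+ k) * Th (x ^+ 2 * q ^+ 2 * p ^- k))
       / (Th (x ^- 2 * p ^+ k) * Th (x ^+ 2 * p ^- k))).

End Algebra.

(* Main.v *)
Require Import Defs.
From HB Require Import structures.
From mathcomp Require Import all_boot all_order all_algebra perm complex mxtens finmap.
From mathcomp Require Import all_classical all_reals all_analysis.
From mathcomp Require Import ring lra zify.
Import Order.TTheory GRing.Theory Num.Theory numFieldNormedType.Exports.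
Set Implicit Arguments.
Unset Strict Implicit.
Unset Printing Implicit Defensive.
Local Open Scope classical_set_scope.
Local Open Scope ring_scope.
Local Open Scope complex_scope.

(** The exchange relation follows from three properties of the R-matrix.
    Write x = xi - eta for the difference of the spectral parameters,
    y = x + c zeta, f for the theta function with both characteristics 1/2, and
      U(x) = q^(2/N-2) Th(q^2/v) Th(q^2 v) / (Th(v) Th(1/v)),
    with v = e^(2 i pi x) and Th the function Theta of base q^(2N).
    - Unitarity: R(x) has an explicit two-sided inverse R'(x), which is, up to
      a scalar, the same sum with q replaced by 1/q ([Rhat_inv]).
    - Crossing: sandwiching T (x) 1 between R(x - N zeta) and R'(x) and tracing
      over the first factor yields the scalar matrix tr T ([crossing]).
    - Quasi-periodicity: R(x + tau + 1) is U(x)^-1 R(x) conjugated by the matrix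
      g^(1/2) h g^(1/2) acting on the first factor ([Rhat_shift]).

    By quasi-periodicity the defining relation for L(- p^(1/2) z) becomes a
    relation for L^-(z) with the factors U(x) and U(y) on its two sides; the
    second is also U(y) because U does not involve p, hence is the same for
    the starred R-matrix. Eliminating the starred R-matrix between the relations
    of L^+ and of L^- gives, with T = L^+ (L^-)^-1,
      L_2(eta) T_1 = (U(x) / U(y)) R(y) T_1 R'(x) L_2(eta),
    where unitarity makes R and the starred R invertible ([trace_exchange]).
    On the surface, y = x - N zeta - N M (tau + 1) modulo N, so that N |M| steps of
    quasi-periodicity identify R(y) with a product of values of U times
    R(x - N zeta) (the conjugation disappears because it has order N). Crossing
    then evaluates the partial trace over the first factor, the exchange relation
    for t(z) drops out, and the product of the values of U is F(M, w/z)
    ([Rhat_surface]).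

    Unitarity and crossing. The matrices I_al (x) I_al^-1 span a twisted group
    algebra of Z_N^2, so both properties are statements about the coefficients
      sum over al of (phase) W_al(x) W'_(ga-al)(y),  for each ga in Z_N^2,
    which must vanish for ga <> 0. As W_al is a ratio of translates of f by the
    N-torsion points w of C/(Z + tau Z), these are sums
      G(x, y; h, h') = sum over w of
        e^(2 i pi a (x-y)/N) f(x+h+w) f(y-h'-w) / (f(h+w) f(-h'-w)).
    The three-term identity splits each term of f(x-y) f(h-h') G into two terms
    with one theta quotient each ([pair_sum_fay]); those are summed by the partial fraction
    expansion of a product of theta quotients, applied to all N-torsion points
    ([torsion_sum]). The closed form of G ([pair_sum_closed_form]) vanishes for
    ga <> 0 in the two cases at hand, and its value at ga = 0 is obtained by
    letting h' tend to h.

    Theta functions. Everything above rests on the Weierstrass three-term relation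
    and on Jacobi's triple product. The first one comes from the factorization
    f(u+v) f(u-v) = A(u) B(v) - B(u) A(v), a rearrangement of a double series
    ([th_addsub]). The second one is the limit of Gauss' binomial formula
    ([theta_product]); it gives the zeros and the quasi-periods of f and connects f
    with the infinite products of the scalar factor.

    Exceptional values of xi - eta are zeros of finitely many functions, each of
    which has a locally finite set of zeros ([generic]). *)

(** * Complex modulus, limits and the exponential *)

Section ComplexBasics.
Variable R : realType.
Local Notation C := R[i].

(** The norm of R[i] takes its values in R[i]; estimates are made with this real
    number instead. *)
Definition modulus (z : C) : R := complex.Re `|z|.
Local Notation md := modulus.

Lemma modulusE (z : C) : `|z| = (md z)%:C.
Proof. by rewrite /md normc_def. Qed.

Lemma modulus_ge0 z : 0 <= md z.
Proof. by rewrite /md normc_def /= sqrtr_ge0. Qed.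

Lemma modulusD x y : md (x + y) <= md x + md y.
Proof. by rewrite -lecR rmorphD /= -!modulusE ler_normD. Qed.

Lemma modulusM x y : md (x * y) = md x * md y.
Proof. by apply: complexI; rewrite rmorphM /= -!modulusE normrM. Qed.

Lemma modulusN x : md (- x) = md x.
Proof. by rewrite /md normrN. Qed.

Lemma modulusB x y : md (x - y) = md (y - x).
Proof. by rewrite -modulusN opprB. Qed.

Lemma modulus1 : md 1 = 1.
Proof. by apply: complexI; rewrite -modulusE normr1. Qed.

Lemma modulus0 : md 0 = 0.
Proof. by apply: complexI; rewrite -modulusE normr0. Qed.

Lemma modulus_eq0 z : (md z == 0) = (z == 0).
Proof.
by rewrite -(normr_eq0 z) modulusE -(inj_eq (@complexI R)).
Qed.

Lemma modulus_gt0 z : (0 < md z) = (z != 0).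
Proof. by rewrite lt_neqAle modulus_ge0 andbT eq_sym modulus_eq0. Qed.

Lemma modulusX x n : md (x ^+ n) = md x ^+ n.
Proof. by elim: n => [|n IH]; rewrite ?expr0 ?modulus1 // !exprS modulusM IH. Qed.

Lemma modulusV x : md x^-1 = (md x)^-1.
Proof. by apply: complexI; rewrite fmorphV /= -!modulusE normfV. Qed.

Lemma modulus_real (x : R) : md x%:C = `|x|.
Proof. by apply: complexI; rewrite -modulusE normc_def /= expr0n /= addr0 sqrtr_sqr. Qed.

Lemma modulus_sum (I : Type) (s : seq I) (P : pred I) (F : I -> C) :
  md (\sum_(i <- s | P i) F i) <= \sum_(i <- s | P i) md (F i).
Proof.
elim/big_ind2: _ => //; first by rewrite modulus0.
by move=> x1 x2 y1 y2 h1 h2; apply: le_trans (modulusD _ _) (lerD h1 h2).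
Qed.

Lemma modulus_le_ReIm (z : C) :
  md z <= `|complex.Re z| + `|complex.Im z|.
Proof.
case: z => a b; have -> : a +i* b = a%:C + ('i * b%:C) by simpc.
apply: le_trans (modulusD _ _) _; rewrite /= modulusM !modulus_real.
have -> : md 'i = 1 by rewrite /md normc_def /= expr0n expr1n /= add0r sqrtr1.
by rewrite mul1r; simpc.
Qed.

Lemma Re_le_modulus (z : C) : `|complex.Re z| <= md z.
Proof. by rewrite -lecR -modulusE normc_ge_Re. Qed.

Lemma Im_le_modulus (z : C) : `|complex.Im z| <= md z.
Proof.
case: z => a b /=; rewrite /md normc_def /= -sqrtr_sqr ler_sqrt ?addr_ge0 ?sqr_ge0 //.
by rewrite lerDr sqr_ge0.
Qed.

Section Convergence.
Context {T : Type} {F : set_system T} {FF : Filter F}.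

Lemma cvg_modulusP (f : T -> C^o) (a : C^o) :
  f @ F --> a <-> (forall e : R, 0 < e -> \forall x \near F, md (a - f x) < e).
Proof.
split=> [/cvgrPdist_lt h e e0|h].
  have := h (e%:C : C); rewrite -[0]/((0:R)%:C) ltcR => /(_ e0).
  by apply: filterS => x; rewrite modulusE ltcR.
apply/cvgrPdist_lt => -[e1 e2] /=; rewrite ltcE /= => /andP[/eqP -> e0].
by apply: filterS (h _ e0) => x; rewrite modulusE ltcR.
Qed.

Lemma cvg_modulus_le (f : T -> C^o) (a : C^o) (b : T -> R) :
  (\forall x \near F, md (a - f x) <= b x) -> b @ F --> (0 : R) -> f @ F --> a.
Proof.
move=> h /cvgrPdist_lt hb; apply/cvg_modulusP => e e0.
apply: filterS2 h (hb _ e0) => x h1; rewrite sub0r normrN => h2.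
by apply: le_lt_trans h1 (le_lt_trans (ler_norm _) h2).
Qed.

Lemma cvg_ReIm (f : T -> C^o) (a : C^o) :
  (fun x => complex.Re (f x)) @ F --> (complex.Re a : R) ->
  (fun x => complex.Im (f x)) @ F --> (complex.Im a : R) -> f @ F --> a.
Proof.
move=> hr hi.
apply: (@cvg_modulus_le _ _ (fun x => `|complex.Re a - complex.Re (f x)| + `|complex.Im a - complex.Im (f x)|)).
  by near=> x; apply: le_trans (modulus_le_ReIm _) _; rewrite !raddfB.
rewrite -[X in _ --> X](addr0 (0 : R)); apply: cvgD.
  by rewrite -(normr0 R); apply: cvg_norm; rewrite -(subrr (complex.Re a)); apply: cvgB => //; exact: cvg_cst.
by rewrite -(normr0 R); apply: cvg_norm; rewrite -(subrr (complex.Im a)); apply: cvgB => //; exact: cvg_cst.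
Unshelve. all: by end_near. Qed.

Lemma cvg_Re (f : T -> C^o) (a : C^o) :
  f @ F --> a -> (fun x => complex.Re (f x)) @ F --> (complex.Re a : R).
Proof.
move=> /cvg_modulusP h; apply/cvgrPdist_lt => e e0; apply: filterS (h e e0) => x.
by rewrite -raddfB; apply: le_lt_trans; exact: Re_le_modulus.
Qed.

Lemma cvg_Im (f : T -> C^o) (a : C^o) :
  f @ F --> a -> (fun x => complex.Im (f x)) @ F --> (complex.Im a : R).
Proof.
move=> /cvg_modulusP h; apply/cvgrPdist_lt => e e0; apply: filterS (h e e0) => x.
by rewrite -raddfB; apply: le_lt_trans; exact: Im_le_modulus.
Qed.

Lemma cvg_modulus (f : T -> C^o) (a : C^o) :
  f @ F --> a -> (fun x => md (f x)) @ F --> (md a : R).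
Proof.
move=> /cvg_modulusP h; apply/cvgrPdist_lt => e e0; apply: filterS (h e e0) => x.
apply: le_lt_trans.
rewrite ler_norml; apply/andP; split.
  rewrite lerNl opprB lerBlDr modulusB.
  by apply: le_trans (modulusD _ _); rewrite subrK.
by rewrite lerBlDr; apply: le_trans (modulusD _ _); rewrite subrK.
Qed.

End Convergence.

Lemma cvg_uniq {T : Type} {F : set_system T} {FF : ProperFilter F}
  (f : T -> C^o) (a b : C^o) : f @ F --> a -> f @ F --> b -> a = b.
Proof. by move=> ha hb; exact: (cvg_unique (@norm_hausdorff _ C^o) ha hb). Qed.

Lemma limnE (f : nat -> C^o) (a : C^o) : f @ \oo --> a -> limn f = a.
Proof. by move=> h; apply: cvg_lim h; exact: norm_hausdorff. Qed.

Lemma cexpD (x y : C) : cexp (x + y) = cexp x * cexp y.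
Proof.
case: x y => [a b] [c d]; rewrite /cexp /= expRD cosD sinD; simpc.
by congr (_ +i* _); ring.
Qed.

Lemma cexp0 : cexp (0 : C) = 1.
Proof. by rewrite /cexp /= expR0 cos0 sin0; simpc. Qed.

Lemma modulus_cexp (x : C) : md (cexp x) = expR (complex.Re x).
Proof.
rewrite /cexp modulusM modulus_real ger0_norm ?expR_ge0 //.
by rewrite /md normc_def /= cos2Dsin2 sqrtr1 mulr1.
Qed.

Lemma epiD (x y : C) : epi (x + y) = epi x * epi y.
Proof. by rewrite /epi mulrDr cexpD. Qed.

Lemma epi0 : epi (0 : C) = 1.
Proof. by rewrite /epi mulr0 cexp0. Qed.

Lemma modulus_epi (x : C) : md (epi x) = expR (- (pi * complex.Im x)).
Proof.
rewrite /epi modulus_cexp; case: x => a b /=.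
by rewrite mul0r add0r.
Qed.

Lemma epi_neq0 (x : C) : epi x != 0.
Proof. by rewrite -modulus_gt0 modulus_epi expR_gt0. Qed.
Hint Resolve epi_neq0 : core.

Lemma epiN (x : C) : epi (- x) = (epi x)^-1.
Proof.
apply: (mulIf (epi_neq0 x)); rewrite -epiD addNr epi0 mulVf //.
Qed.

Lemma epiB (x y : C) : epi (x - y) = epi x / epi y.
Proof. by rewrite epiD epiN. Qed.

Lemma epiMn (x : C) n : epi (n%:R * x) = epi x ^+ n.
Proof.
elim: n => [|n IH]; first by rewrite mul0r epi0 expr0.
by rewrite -natr1 mulrDl mul1r epiD IH exprSr.
Qed.

Lemma epiMz (x : C) (n : int) : epi (n%:~R * x) = epi x ^ n.
Proof.
case: n => n; first exact: epiMn.
by rewrite NegzE mulrNz mulNr epiN -exprnN -epiMn.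
Qed.

Lemma epi1 : epi (1 : C) = -1.
Proof. by rewrite /epi mulr1 /cexp /= expR0 cospi sinpi mul1r complexr0 rmorphN1. Qed.

Lemma epi2 : epi (2 : C) = 1.
Proof. by rewrite -[2]mulr1 epiMn epi1 sqrrN expr1n. Qed.

Lemma epi_even (n : int) : epi (2 * n%:~R : C) = 1.
Proof. by rewrite mulrC epiMz epi2 exp1rz. Qed.

Lemma epi_ReIm (x : C) :
  epi x = (expR (- (pi * complex.Im x)) * cos (pi * complex.Re x))
    +i* (expR (- (pi * complex.Im x)) * sin (pi * complex.Re x)).
Proof. by case: x => u v; rewrite /epi /cexp /=; simpc. Qed.

Lemma cvg_epi (a : C) : (@epi R : C^o -> C^o) x @[x --> (a : C^o)] --> (epi a : C^o).
Proof.
have hRe : (fun x : C^o => complex.Re x) x @[x --> (a : C^o)] --> (complex.Re a : R).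
  by apply: (@cvg_Re (C^o) (nbhs (a : C^o)) _ (fun x : C^o => x) a); exact: cvg_id.
have hIm : (fun x : C^o => complex.Im x) x @[x --> (a : C^o)] --> (complex.Im a : R).
  by apply: (@cvg_Im (C^o) (nbhs (a : C^o)) _ (fun x : C^o => x) a); exact: cvg_id.
have comp (g : R -> R) (f : C^o -> R) (b : R) : {for b, continuous g} ->
    f x @[x --> (a : C^o)] --> b -> g (f x) @[x --> (a : C^o)] --> g b.
  by move=> hg hf; exact: (continuous_cvg _ hg hf).
have cstM (f : C^o -> R) (b k : R) :
    f x @[x --> (a : C^o)] --> b -> k * (f x) @[x --> (a : C^o)] --> k * b.
  by move=> hf; exact: (@cvgMl_tmp R _ _ _ f k b hf).
have h1 : expR (- (pi * complex.Im x)) @[x --> (a : C^o)] --> (expR (- (pi * complex.Im a)) : R).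
  apply: (comp (fun t => expR (- t)) (fun x => pi * complex.Im x)); last exact: cstM.
  move=> t; apply: (@continuous_comp _ _ _ (fun u : R => - u) expR); first exact: opp_continuous.
  exact: continuous_expR.
rewrite epi_ReIm (_ : @epi R = fun x => (expR (- (pi * complex.Im x)) * cos (pi * complex.Re x))
    +i* (expR (- (pi * complex.Im x)) * sin (pi * complex.Re x))); last first.
  by apply/funext => x; rewrite epi_ReIm.
apply: (@cvg_ReIm (C^o) (nbhs (a : C^o))) => /=.
  apply: (@cvgM R) => //; apply: (comp cos (fun x => pi * complex.Re x)); last exact: cstM.
  exact: continuous_cos.
apply: (@cvgM R) => //; apply: (comp sin (fun x => pi * complex.Re x)); last exact: cstM.
exact: continuous_sin.
Qed.

Lemma cvg_seqD (f g : nat -> C) (a b : C) : (f : nat -> C^o) @ \oo --> (a : C^o) ->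
  (g : nat -> C^o) @ \oo --> (b : C^o) -> (fun n => f n + g n : C^o) @ \oo --> (a + b : C^o).
Proof. exact: cvgD. Qed.

Lemma cvg_seqM (f g : nat -> C) (a b : C) : (f : nat -> C^o) @ \oo --> (a : C^o) ->
  (g : nat -> C^o) @ \oo --> (b : C^o) -> (fun n => f n * g n : C^o) @ \oo --> (a * b : C^o).
Proof. exact: cvgM. Qed.

Lemma cvg_seqV (f : nat -> C) (a : C) : a != 0 -> (f : nat -> C^o) @ \oo --> (a : C^o) ->
  (fun n => (f n)^-1 : C^o) @ \oo --> (a^-1 : C^o).
Proof. exact: cvgV. Qed.

Lemma cvg_seq_cst (a : C) : (fun _ : nat => a : C^o) @ \oo --> (a : C^o).
Proof. exact: cvg_cst. Qed.

Definition ccont (f : C -> C) (w : C) : Prop :=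
  (f : C^o -> C^o) x @[x --> (w : C^o)] --> (f w : C^o).

Lemma ccontP (f : C -> C) (w : C) :
  ccont f w <-> forall e : R, 0 < e -> \forall x \near (w : C^o), md (f w - f x) < e.
Proof. exact: (@cvg_modulusP C^o (nbhs (w : C^o)) _). Qed.

Lemma ccont_id w : ccont id w. Proof. exact: cvg_id. Qed.

Lemma ccont_cst a w : ccont (fun=> a) w.
Proof. exact: (@cvg_cst C^o a C^o (nbhs (w : C^o)) _). Qed.

Lemma ccontD f g w : ccont f w -> ccont g w -> ccont (fun x => f x + g x) w.
Proof. by move=> hf hg; exact: (@cvgD _ _ _ (nbhs (w : C^o)) _ _ _ _ _ hf hg). Qed.

Lemma ccontN f w : ccont f w -> ccont (fun x => - f x) w.
Proof. by move=> hf; exact: (@cvgN _ _ _ (nbhs (w : C^o)) _ _ _ hf). Qed.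

Lemma ccontM f g w : ccont f w -> ccont g w -> ccont (fun x => f x * g x) w.
Proof. by move=> hf hg; exact: (@cvgM C C^o (nbhs (w : C^o)) _ _ _ _ _ hf hg). Qed.

Lemma ccontV f w : f w != 0 -> ccont f w -> ccont (fun x => (f x)^-1) w.
Proof. by move=> h hf; exact: (@cvgV C C^o (nbhs (w : C^o)) _ _ _ h hf). Qed.

Lemma ccont_comp f g w : ccont f w -> ccont g (f w) -> ccont (fun x => g (f x)) w.
Proof.
move=> hf hg; exact: (@continuous_cvg C^o C^o C^o (nbhs (w : C^o)) _ f g (f w) hg hf).
Qed.

Lemma ccont_epi w : ccont (@epi R) w. Proof. exact: cvg_epi. Qed.

(** Identities proved by dividing by a quantity with isolated zeros extend to
    these zeros through this principle. *)
Lemma ccont_eq_punctured f g w : ccont f w -> ccont g w ->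
  (exists2 e : R, 0 < e & forall x, x != w -> md (w - x) < e -> f x = g x) -> f w = g w.
Proof.
move=> /ccontP hf /ccontP hg [e e0 h]; apply/eqP; rewrite -subr_eq0 -modulus_eq0; apply/eqP.
apply/le_anti; rewrite modulus_ge0 andbT; apply/ler_addgt0Pl => d d0; rewrite addr0.
have d2 : 0 < d / 2 by rewrite divr_gt0.
have hw : \forall x \near (w : C^o), md (w - x) < e by exact: ((ccontP id w).1 (@ccont_id w) e e0).
have hall : \forall x \near (w : C^o), [/\ md (w - x) < e, md (f w - f x) < d / 2 & md (g w - g x) < d / 2].
  by near=> x; split; near: x; [exact: hw | exact: hf | exact: hg].
have /= [x0 [[h1 h2 h3] xw]] : exists x : C^o, [/\ md (w - x) < e, md (f w - f x) < d / 2 & md (g w - g x) < d / 2] /\ x != w.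
  move: hall => /nbhs_ballP [r r0 hr]; exists (w + r / 2); split.
    apply: hr; rewrite -ball_normE /= opprD addrA subrr sub0r normrN normrM normfV.
    by rewrite !ger0_norm // ?(ltW r0) // ltr_pdivrMr // ltr_pMr // ltr1n.
  by rewrite addrC -subr_eq0 addrK mulf_neq0 ?invr_neq0 ?gt_eqF.
have -> : f w - g w = (f w - f x0) - (g w - g x0) by rewrite (h _ xw h1); ring.
apply: le_trans (modulusD _ _) _; rewrite modulusN; apply: ltW; rewrite (splitr d); exact: ltrD.
Unshelve. all: by end_near. Qed.

End ComplexBasics.

#[global] Hint Resolve epi_neq0 : core.
#[global] Hint Extern 0 (is_true (0 <= modulus _)) => exact: modulus_ge0 : core.

(** * Series and products with geometric bounds *)

Section SeriesProducts.
Variable R : realType.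
Local Notation C := R[i].
Local Notation md := (@modulus R).

(** Reduces to cos (pi t) = 1 for 0 <= t < 2; on each half of this interval the
    cosine is injective. *)
Lemma epi_eq1 (a : C) : epi a = 1 -> exists n : int, a = 2 * n%:~R.
Proof.
move=> h; have : md (epi a) = 1 by rewrite h modulus1.
rewrite modulus_epi -expR0 => /expR_inj /eqP; rewrite oppr_eq0 mulf_eq0 gt_eqF ?pi_gt0 //= => /eqP a0.
case: a a0 h => r s /= -> h; exists (Num.floor (r / 2)).
set n := Num.floor _.
pose t := r - 2 * n%:~R.
have [t0 t2] : 0 <= t /\ t < 2.
  have := floor_le_tmp (r / 2); have := floorD1_gt (r / 2).
  by rewrite -/n intrD /t; lra.
have ht : cos (pi * t) = 1.
  have : epi (t%:C) = 1.
    rewrite /t rmorphB /= epiB rmorphM /= rmorph_int rmorph_nat epi_even divr1; exact: h.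
  by rewrite epi_ReIm /= mulr0 oppr0 expR0 !mul1r => -[].
have pi0 := @pi_gt0 R.
suff t00 : t = 0.
  apply/eqP; rewrite eq_complex /= ; simpc.
  move: t00; rewrite /t => /eqP; rewrite subr_eq0 => /eqP ->.
  by rewrite [X in (_ == complex.Re X) && (_ == complex.Im X)](_ : _ = (2 * n%:~R)%:C) /= ?eqxx // rmorphM /= rmorph_int rmorph_nat.
have [t1|t1] := leP t 1.
  have : pi * t = 0 :> R.
    apply: cos_inj; last by rewrite ht cos0.
      by rewrite in_itv /= mulr_ge0 ?(ltW pi0) //= ler_piMr ?(ltW pi0).
    by rewrite in_itv /= lexx ltW.
  by move/eqP; rewrite mulf_eq0 gt_eqF //= => /eqP.
have : pi * (2 - t) = 0 :> R.
  apply: cos_inj; last first.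
  - rewrite cos0 (_ : pi * (2 - t) = (pi - pi * t) + pi); last by ring.
    by rewrite -[RHS]ht cosDpi cosB cospi sinpi mul0r addr0 mulN1r opprK.
  - by rewrite in_itv /= lexx ltW.
  by rewrite in_itv /= mulr_ge0 ?(ltW pi0) ?subr_ge0 ?(ltW t2) //= ler_piMr ?(ltW pi0) //; lra.
by move/eqP; rewrite mulf_eq0 gt_eqF //= subr_eq0 => /eqP h2; move: t2; rewrite -h2 ltxx.
Qed.

Lemma geometric_sum_le (r : R) K : 0 <= r -> r < 1 ->
  \sum_(n < K) r ^+ n <= (1 - r)^-1.
Proof.
move=> r0 r1; have h : 0 < 1 - r by rewrite subr_gt0.
rewrite -(ler_pM2l h) mulfV ?gt_eqF // -opprB mulNr -subrX1 opprB.
by rewrite lerBlDr lerDl exprn_ge0.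
Qed.

Lemma geometric_tail_le (r : R) m K : 0 <= r -> r < 1 ->
  \sum_(m <= n < K) r ^+ n <= r ^+ m * (1 - r)^-1.
Proof.
move=> r0 r1; rewrite -{1}[m]add0n big_addn big_mkord.
under eq_bigr do rewrite exprD mulrC.
by rewrite -mulr_sumr ler_wpM2l ?exprn_ge0 ?geometric_sum_le.
Qed.

Lemma series_geometric_cvg (u : nat -> C) (c r : R) :
  0 <= r -> r < 1 -> (forall n, md (u n) <= c * r ^+ n) ->
  exists s : C, series (u : nat -> C^o) @ \oo --> (s : C^o).
Proof.
move=> r0 r1 h.
have c0 : 0 <= c by have := h 0%N; rewrite expr0 mulr1; exact: (le_trans (modulus_ge0 _)).
have real_cvg (v : nat -> R) : (forall n, `|v n| <= c * r ^+ n) -> cvgn (series v).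
  move=> hv; apply: (@normed_cvg R R^o) => //.
  apply: (@series_le_cvg _ _ (geometric c r)) => [n|n|n|]; rewrite ?normr_ge0 ?hv //.
    by rewrite /geometric /= mulr_ge0 ?exprn_ge0.
  by apply: is_cvg_geometric_series; rewrite ger0_norm.
have h1 : cvgn (series (fun n => complex.Re (u n))).
  by apply: real_cvg => n; apply: le_trans (Re_le_modulus _) (h n).
have h2 : cvgn (series (fun n => complex.Im (u n))).
  by apply: real_cvg => n; apply: le_trans (Im_le_modulus _) (h n).
exists (limn (series (fun n => complex.Re (u n))) +i* limn (series (fun n => complex.Im (u n)))).
apply: (@cvg_ReIm R nat \oo) => /=.
  rewrite (_ : (fun x => _) = series (fun n => complex.Re (u n))) //.
  by apply/funext => n; rewrite /series /= raddf_sum.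
rewrite (_ : (fun x => _) = series (fun n => complex.Im (u n))) //.
by apply/funext => n; rewrite /series /= raddf_sum.
Qed.

Lemma modulus_prod (I : Type) (s : seq I) (F : I -> C) :
  md (\prod_(i <- s) F i) = \prod_(i <- s) md (F i).
Proof. by elim/big_ind2: _ => // [|x1 x2 y1 y2 <- <-]; rewrite ?modulus1 ?modulusM. Qed.

Lemma prod_le_expR (I : Type) (s : seq I) (F : I -> R) : (forall i, 0 <= F i) ->
  \prod_(i <- s) (1 + F i) <= expR (\sum_(i <- s) F i).
Proof.
move=> F0; elim: s => [|i s IH]; first by rewrite !big_nil expR0.
rewrite !big_cons expRD ler_pM ?addr_ge0 ?expR_ge1Dx //.
by apply: prodr_ge0 => j _; rewrite addr_ge0.
Qed.

Lemma modulus_prod_le (I : Type) (s : seq I) (F : I -> C) :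
  md (\prod_(i <- s) (1 + F i)) <= expR (\sum_(i <- s) md (F i)).
Proof.
apply: le_trans (prod_le_expR _ _) => //; rewrite modulus_prod.
by apply: ler_prod => i _; rewrite modulus_ge0 /= (le_trans (modulusD _ _)) ?modulus1.
Qed.

(** The partial products are the partial sums of a series whose terms are
    bounded by d_K times a bounded partial product. *)
Lemma prod_geometric_cvg (d : nat -> C) (c r : R) :
  0 <= r -> r < 1 -> (forall n, md (d n) <= c * r ^+ n) ->
  exists s : C, (fun K => \prod_(n < K) (1 + d n) : C^o) @ \oo --> (s : C^o).
Proof.
move=> r0 r1 h; pose P K : C := \prod_(n < K) (1 + d n).
have c0 : 0 <= c by have := h 0%N; rewrite expr0 mulr1; exact: (le_trans (modulus_ge0 _)).
have hP K : md (P K) <= expR (c * (1 - r)^-1).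
  rewrite /P -(big_mkord xpredT (fun n => 1 + d n)); apply: le_trans (modulus_prod_le _ _) _.
  rewrite ler_expR big_mkord; apply: (@le_trans _ _ (\sum_(n < K) c * r ^+ n)).
    by apply: ler_sum.
  by rewrite -mulr_sumr ler_wpM2l ?geometric_sum_le.
have [|s hs] := @series_geometric_cvg (fun n => P n * d n) (expR (c * (1 - r)^-1) * c) r r0 r1.
  by move=> n; rewrite modulusM -mulrA ler_pM ?modulus_ge0.
exists (1 + s); rewrite (_ : (fun K => _) = (fun K => 1 + series (fun n => P n * d n : C^o) K)).
  by apply: cvgD; [exact: cvg_cst | exact: hs].
apply/funext => K; elim: K => [|K IH]; first by rewrite big_ord0 /series /= big_nil addr0.
by rewrite big_ord_recr /= IH seriesSr addrA -IH /P; ring.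
Qed.

(** The inverse factors 1 / (1 + d_n) = 1 - d_n / (1 + d_n) satisfy a bound of the
    same kind as soon as |d_n| <= 1/2; so the product of the inverses of all but the first m
    factors also converges, and the limit s times its limit is the nonzero
    product of these m factors. *)
Lemma prod_geometric_neq0 (d : nat -> C) (c r : R) (s : C) :
  0 <= r -> r < 1 -> (forall n, md (d n) <= c * r ^+ n) ->
  (forall n, 1 + d n != 0) ->
  (fun K => \prod_(n < K) (1 + d n) : C^o) @ \oo --> (s : C^o) -> s != 0.
Proof.
move=> r0 r1 h dn0 hs.
have c0 : 0 <= c by have := h 0%N; rewrite expr0 mulr1; exact: (le_trans (modulus_ge0 _)).
have hcvg : (fun n => c * r ^+ n) @ \oo --> (0 : R).
  by apply: cvg_geometric; rewrite ger0_norm.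
have [m _ hm] : \forall n \near \oo, c * r ^+ n <= 2^-1.
  have /cvgrPdist_lt /(_ 2^-1) := hcvg; rewrite invr_gt0 ltr0n => /(_ isT).
  apply: filterS => n; rewrite sub0r normrN ger0_norm ?mulr_ge0 ?exprn_ge0 //; exact: ltW.
pose d' n := d (n + m)%N.
have hd' n : md (d' n) <= 2^-1.
  apply: le_trans (h _) _; apply: hm => /=; exact: leq_addl.
have hd1 n : 2^-1 <= md (1 + d' n).
  rewrite -(lerD2r (md (d' n))); apply: (@le_trans _ _ 1).
    by have := hd' n; lra.
  by rewrite -[X in X <= _](@modulus1 R) -{1}[1](addrK (d' n)) -(modulusN (d' n)) modulusD.
have [t ht] : exists t : C, (fun K => \prod_(n < K) (1 + (- d' n / (1 + d' n))) : C^o) @ \oo --> (t : C^o).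
  apply: (@prod_geometric_cvg (fun n => - d' n / (1 + d' n)) (2 * (c * r ^+ m)) r) => // n.
  rewrite modulusM modulusN modulusV.
  have hd2 : 0 < md (1 + d' n) by apply: lt_le_trans (hd1 n); rewrite invr_gt0.
  rewrite ler_pdivrMr //; apply: le_trans (h _) _.
  rewrite exprD (_ : 2 * _ * _ * _ = c * (r ^+ n * r ^+ m) * (2 * md (1 + d' n))); last by ring.
  by rewrite ler_peMr ?mulr_ge0 ?exprn_ge0 //; have := hd1 n; lra.
have hs' : (fun K => \prod_(n < K + m) (1 + d n) : C^o) @ \oo --> (s : C^o).
  by have := hs; rewrite -(cvg_shiftn m).
have : (fun K => (\prod_(n < K + m) (1 + d n)) * (\prod_(n < K) (1 + (- d' n / (1 + d' n)))) : C^o)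
   @ \oo --> ((s * t) : C^o) by apply: cvg_seqM; [exact: hs' | exact: ht].
rewrite (_ : (fun K => _) = fun=> \prod_(n < m) (1 + d n)); last first.
  apply/funext => K; rewrite addnC big_split_ord /= -mulrA -[RHS]mulr1; congr (_ * _).
  rewrite -big_split /= big1 // => i _; rewrite [(m + i)%N]addnC -/(d' i).
  by field; exact: dn0.
move=> /(cvg_uniq (@cvg_cst C^o _ _ _ _)) e; apply/eqP => s0.
have : \prod_(n < m) (1 + d n) != 0 by apply/prodf_neq0 => i _.
by rewrite e s0 mul0r eqxx.
Qed.

End SeriesProducts.

(** * q-Pochhammer products and the function Theta *)

Section Pochhammer.
Variable R : realType.
Local Notation C := R[i].
Local Notation md := (@modulus R).

Lemma qpoch_cvg (z a : C) : md a < 1 ->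
  (fun K => \prod_(n < K) (1 - z * a ^+ n) : C^o) @ \oo --> (qpoch z a : C^o).
Proof.
move=> a1; have [|s hs] := @prod_geometric_cvg R (fun n => - (z * a ^+ n)) (md z) (md a) (modulus_ge0 _) a1.
  by move=> n; rewrite modulusN modulusM modulusX.
by rewrite /qpoch (limnE hs).
Qed.

Lemma qpoch_neq0 (z a : C) : md a < 1 -> (forall n, z * a ^+ n != 1) -> qpoch z a != 0.
Proof.
move=> a1 h; apply: (@prod_geometric_neq0 R (fun n => - (z * a ^+ n)) (md z) (md a)) => //.
- by move=> n; rewrite modulusN modulusM modulusX.
- by move=> n; rewrite subr_eq0 eq_sym.
- exact: qpoch_cvg.
Qed.

Lemma qpochS (z a : C) : md a < 1 -> qpoch z a = (1 - z) * qpoch (a * z) a.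
Proof.
move=> a1; apply: (@cvg_uniq R nat \oo _ (fun K => \prod_(n < K.+1) (1 - z * a ^+ n))).
  by have := @qpoch_cvg z _ a1; rewrite -cvg_shiftS.
rewrite (_ : (fun K => _) = fun K => (1 - z) * \prod_(n < K) (1 - (a * z) * a ^+ n)); last first.
  apply/funext => K; rewrite big_ord_recl expr0 mulr1; congr (_ * _).
  by apply: eq_bigr => i _; rewrite lift0 exprS mulrCA mulrA [a * z]mulrC.
by apply: cvgM; [exact: cvg_cst | exact: qpoch_cvg].
Qed.

(** Expanding the products, every monomial on the left is bounded by its
    counterpart on the right. *)
Lemma prod_sub1_le (I : Type) (s : seq I) (F : I -> C) :
  md (\prod_(i <- s) (1 + F i) - 1) <= \prod_(i <- s) (1 + md (F i)) - 1.
Proof.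
elim: s => [|i s IH]; first by rewrite !big_nil subrr modulus0 subrr.
rewrite !big_cons; set p := \prod_(j <- s) _; set p' := \prod_(j <- s) _.
have -> : (1 + F i) * p - 1 = (p - 1) + F i * (p - 1) + F i by ring.
have -> : (1 + md (F i)) * p' - 1 = (p' - 1) + md (F i) * (p' - 1) + md (F i) by ring.
apply: le_trans (modulusD _ _) _; rewrite lerD2r.
apply: le_trans (modulusD _ _) _; apply: lerD => //.
by rewrite modulusM ler_wpM2l ?modulus_ge0.
Qed.

Lemma expR_sub1_le (s : R) : expR s - 1 <= s * expR s.
Proof.
have := expR_ge1Dx (- s); rewrite -(ler_pM2l (expR_gt0 s)) expRxMexpNx_1.
by lra.
Qed.

Lemma prod_sub1_le_expR (I : Type) (s : seq I) (F : I -> C) b :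
  \sum_(i <- s) md (F i) <= b ->
  md (\prod_(i <- s) (1 + F i) - 1) <= b * expR b.
Proof.
move=> h; apply: le_trans (prod_sub1_le _ _) _.
have b0 : 0 <= b by apply: le_trans h; apply: sumr_ge0.
apply: le_trans (expR_sub1_le _); rewrite lerD2r.
by apply: le_trans (prod_le_expR _ _) _ => //; rewrite ler_expR.
Qed.

(** The double product is defined by square truncations. Passing from K to K + 1
    multiplies the truncation by a border of 2 K + 1 factors, whose product
    differs from 1 by O(r^K); this reduces the double product to a simple one. *)
Section Double.
Variables a b : C.
Hypotheses (a1 : md a < 1) (b1 : md b < 1).

Let T z K : C := \prod_(n < K) \prod_(m < K) (1 - z * a ^+ n * b ^+ m).
Let border z K : C := (\prod_(m < K) (1 - z * a ^+ K * b ^+ m)) *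
  \prod_(n < K.+1) (1 - z * a ^+ n * b ^+ K).
Let r := Num.max (md a) (md b).

Let r0 : 0 <= r. Proof. by rewrite le_max modulus_ge0. Qed.
Let r1 : r < 1. Proof. by rewrite gt_max a1. Qed.
Let ra : md a <= r. Proof. by rewrite le_max lexx. Qed.
Let rb : md b <= r. Proof. by rewrite le_max lexx orbT. Qed.

Let TS z K : T z K.+1 = T z K * border z K.
Proof.
rewrite /T /border big_ord_recr /=.
under eq_bigr do rewrite big_ord_recr /=.
by rewrite big_split /= [in RHS]big_ord_recr /= [in LHS]big_ord_recr /=; ring.
Qed.

Let row_le z K L : \sum_(n < L) md (- (z * a ^+ n * b ^+ K)) <= md z * (1 - r)^-1 * r ^+ K.
Proof.
apply: (@le_trans _ _ (\sum_(n < L) md z * r ^+ K * r ^+ n)).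
  apply: ler_sum => n _; rewrite modulusN !modulusM !modulusX -!mulrA ler_wpM2l ?modulus_ge0 //.
  by rewrite mulrC ler_pM ?exprn_ge0 // ?lerXn2r // nnegrE.
by rewrite -mulr_sumr mulrAC ler_wpM2r ?exprn_ge0 // ler_wpM2l ?geometric_sum_le.
Qed.

Let border_le z K : md (border z K - 1) <=
  (2 * (md z * (1 - r)^-1)) * expR (2 * (md z * (1 - r)^-1)) * r ^+ K.
Proof.
have rK : r ^+ K <= 1 by rewrite exprn_ile1 // ltW.
have B0 : 0 <= md z * (1 - r)^-1 by rewrite mulr_ge0 ?invr_ge0 ?subr_ge0 // ltW.
set B := md z * _ in B0 *.
have -> : border z K = \prod_(x <- [seq - (z * a ^+ K * b ^+ i) | i <- iota 0 K] ++
   [seq - (z * a ^+ i * b ^+ K) | i <- iota 0 K.+1]) (1 + x).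
  by rewrite big_cat !big_map /border -(big_mkord xpredT (fun m => 1 - z * a ^+ K * b ^+ m))
    -(big_mkord xpredT (fun n => 1 - z * a ^+ n * b ^+ K)) /index_iota !subn0.
apply: (@le_trans _ _ ((2 * B * r ^+ K) * expR (2 * B * r ^+ K))).
  apply: prod_sub1_le_expR; rewrite big_cat !big_map.
  rewrite (_ : 2 * B * r ^+ K = B * r ^+ K + B * r ^+ K); last by ring.
  apply: lerD.
    rewrite -{1}[K]subn0 -/(index_iota 0 K) big_mkord.
    apply: (@le_trans _ _ (\sum_(n < K) md z * r ^+ K * r ^+ n)).
      apply: ler_sum => n _; rewrite modulusN !modulusM !modulusX -!mulrA ler_wpM2l ?modulus_ge0 //.
      by rewrite ler_pM ?exprn_ge0 // ?lerXn2r // nnegrE.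
    by rewrite -mulr_sumr /B mulrAC ler_wpM2r ?exprn_ge0 // ler_wpM2l ?geometric_sum_le.
  by rewrite -{1}[K.+1]subn0 -/(index_iota 0 K.+1) big_mkord row_le.
rewrite [leLHS]mulrAC; apply: ler_wpM2r; first exact: exprn_ge0.
apply: ler_wpM2l; first by rewrite mulr_ge0.
by rewrite ler_expR ler_piMr // mulr_ge0.
Qed.

Let TE z K : T z K = \prod_(k < K) (1 + (border z k - 1)).
Proof.
elim: K => [|K IH]; first by rewrite /T !big_ord0.
by rewrite TS IH big_ord_recr /= [1 + (border z K - 1)]addrC subrK.
Qed.

Lemma qpoch2_cvg z :
  (fun K => \prod_(n < K) \prod_(m < K) (1 - z * a ^+ n * b ^+ m) : C^o) @ \oo --> (qpoch2 z a b : C^o).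
Proof.
have [s hs] := prod_geometric_cvg r0 r1 (border_le z).
move: hs; rewrite (_ : (fun K => _) = T z) => [hs|]; last by apply/funext => K; rewrite TE.
by rewrite /qpoch2 (limnE hs).
Qed.

Lemma qpoch2_neq0 z : (forall n m, z * a ^+ n * b ^+ m != 1) -> qpoch2 z a b != 0.
Proof.
move=> h; apply: (prod_geometric_neq0 r0 r1 (border_le z)) => [n|].
  rewrite addrC subrK /border mulf_neq0 //; apply/prodf_neq0 => i _; by rewrite subr_eq0 eq_sym.
rewrite (_ : (fun K => _) = T z); last by apply/funext => K; rewrite TE.
exact: qpoch2_cvg.
Qed.

(** The square truncation of size K + 1 splits into its first row, the square
    of size K for a z, and a border row that tends to 1. *)
Lemma qpoch2S z : qpoch2 z a b = qpoch z b * qpoch2 (a * z) a b.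
Proof.
apply: (@cvg_uniq R nat \oo _ (T z \o succn)).
  by have := @qpoch2_cvg z; rewrite -cvg_shiftS.
rewrite (_ : _ \o _ = fun K => ((fun K => \prod_(m < K) (1 - z * b ^+ m)) K.+1 *
   (T (a * z) K * \prod_(n < K) (1 - (a * z) * a ^+ n * b ^+ K)))); last first.
  apply/funext => K /=; rewrite /T big_ord_recl expr0 mulr1; congr (_ * _).
  rewrite -big_split; apply: eq_bigr => n _; rewrite lift0 big_ord_recr /=.
  by rewrite exprS !mulrA [z * a]mulrC.
apply: cvgM; first by have := @qpoch_cvg z _ b1; rewrite -cvg_shiftS.
rewrite -[X in _ --> X]mulr1; apply: cvgM; first exact: qpoch2_cvg.
have c0 : 0 <= md (a * z) * (1 - r)^-1 by rewrite mulr_ge0 ?invr_ge0 ?subr_ge0 // ltW.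
apply: (@cvg_modulus_le R nat \oo _ _ _ (fun K => md (a * z) * (1 - r)^-1 * expR (md (a * z) * (1 - r)^-1) * r ^+ K)).
  near=> K; rewrite modulusB; set B := md (a * z) * _ in c0 *.
  apply: le_trans (_ : (B * r ^+ K) * expR (B * r ^+ K) <= _).
    rewrite -(big_mkord xpredT (fun n => 1 - (a * z) * a ^+ n * b ^+ K)).
    by apply: prod_sub1_le_expR; rewrite big_mkord row_le.
  rewrite [leLHS]mulrAC; apply: ler_wpM2r; first exact: exprn_ge0.
  apply: ler_wpM2l; first exact: c0.
  rewrite ler_expR; apply: ler_piMr => //; apply: exprn_ile1 => //; exact: ltW.
by apply: cvg_geometric; rewrite ger0_norm.
Unshelve. all: by end_near. Qed.

End Double.

Lemma qpoch2C (z a b : C) : qpoch2 z a b = qpoch2 z b a.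
Proof.
rewrite /qpoch2 (_ : (fun K : nat => _) = fun K => \prod_(n < K) \prod_(m < K) (1 - z * b ^+ n * a ^+ m)) //.
apply/funext => K; rewrite exchange_big.
by apply: eq_bigr => i _; apply: eq_bigr => j _; rewrite mulrAC.
Qed.

Lemma qpoch2Sr (z a b : C) : md a < 1 -> md b < 1 ->
  qpoch2 z a b = qpoch z a * qpoch2 (b * z) a b.
Proof. by move=> a1 b1; rewrite (qpoch2C z) (qpoch2S b1 a1) (qpoch2C _ b). Qed.

Section ThetaFunction.
Variable a : C.
Hypotheses (a0 : a != 0) (a1 : md a < 1).

Lemma ThetaV z : z != 0 -> Theta a z^-1 = - (z^-1 * Theta a z).
Proof.
move=> z0; rewrite /Theta invrK [qpoch z a]qpochS // (qpochS z^-1) //.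
by field.
Qed.

Lemma Theta_shift z : z != 0 -> Theta a (a * z) = - (z^-1 * Theta a z).
Proof.
move=> z0; rewrite /Theta [qpoch z a]qpochS // invfM mulrA divff // mul1r (qpochS z^-1) //.
by field.
Qed.

Lemma Theta_neq0 z : z != 0 -> (forall n : int, z != a ^ n) -> Theta a z != 0.
Proof.
move=> z0 h; rewrite /Theta !mulf_neq0 // qpoch_neq0 //.
- move=> n; apply: contra (h (- n%:Z)) => /eqP e.
  by rewrite -exprnN -[z]mulr1 -(divff (expf_neq0 n a0)) mulrA e mul1r.
- move=> n; apply: contra (h n.+1) => /eqP e; apply/eqP.
  rewrite -[LHS]mulr1 -e -exprnP exprS; field; exact: z0.
- move=> n; rewrite -exprS; apply/eqP => e; have := exprn_ilt1 n.+1 (modulus_ge0 a) a1.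
  by rewrite /= -modulusX e modulus1 ltxx.
Qed.

End ThetaFunction.

(** Uniform on a ball, hence continuity in z: the truncated products satisfy the
    bound by induction, and it passes to the limit. *)
Lemma qpoch_lipschitz (a z w : C) (B : R) : md a < 1 -> md z <= B -> md w <= B ->
  md (qpoch z a - qpoch w a) <= md (z - w) * (expR (B * (1 - md a)^-1) * (1 - md a)^-1).
Proof.
move=> a1 zB wB; have B0 : 0 <= B by apply: le_trans zB.
pose M K := \prod_(n < K) (1 + B * md a ^+ n); pose S K := \sum_(n < K) md a ^+ n.
have M0 K : 0 <= M K by apply: prodr_ge0 => i _; rewrite addr_ge0 // mulr_ge0 // exprn_ge0.
have S0 K : 0 <= S K by apply: sumr_ge0 => i _; rewrite exprn_ge0.
have hw K : md (\prod_(n < K) (1 - w * a ^+ n)) <= M K.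
  rewrite modulus_prod; apply: ler_prod => i _; rewrite modulus_ge0 /=.
  apply: le_trans (modulusD _ _) _; rewrite modulus1 lerD2l modulusN modulusM modulusX.
  by rewrite ler_wpM2r // exprn_ge0.
have fin K : md (\prod_(n < K) (1 - z * a ^+ n) - \prod_(n < K) (1 - w * a ^+ n)) <=
    md (z - w) * (M K * S K).
  elim: K => [|K IH]; first by rewrite !big_ord0 subrr modulus0 /S big_ord0 !mulr0.
  rewrite /M /S !big_ord_recr /= -/(M K) -/(S K).
  set p := \prod_(n < K) (1 - z * a ^+ n) in IH *; have := hw K.
  set q := \prod_(n < K) (1 - w * a ^+ n) in IH * => hq.
  have -> : p * (1 - z * a ^+ K) - q * (1 - w * a ^+ K) =
     (p - q) * (1 - z * a ^+ K) - q * ((z - w) * a ^+ K) by ring.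
  apply: le_trans (modulusD _ _) _; rewrite modulusN !modulusM modulusX.
  have h1 : md (1 - z * a ^+ K) <= 1 + B * md a ^+ K.
    apply: le_trans (modulusD _ _) _; rewrite modulus1 lerD2l modulusN modulusM modulusX.
    by rewrite ler_wpM2r // exprn_ge0.
  have e0 : 0 <= md a ^+ K by rewrite exprn_ge0.
  have -> : md (z - w) * (M K * (1 + B * md a ^+ K) * (S K + md a ^+ K)) =
     (md (z - w) * (M K * S K)) * (1 + B * md a ^+ K) +
     (M K * (md (z - w) * md a ^+ K) + md (z - w) * M K * B * md a ^+ K * md a ^+ K) by ring.
  apply: lerD; first by apply: ler_pM.
  rewrite -[leLHS]addr0 lerD //; first by rewrite ler_wpM2r // mulr_ge0.
  by rewrite !mulr_ge0.
have MS K : M K * S K <= expR (B * (1 - md a)^-1) * (1 - md a)^-1.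
  apply: ler_pM => //; last exact: geometric_sum_le.
  rewrite /M -(big_mkord xpredT (fun n => 1 + B * md a ^+ n)).
  apply: le_trans (prod_le_expR _ _) _; first by move=> i; rewrite mulr_ge0 ?exprn_ge0.
  by rewrite ler_expR -mulr_sumr big_mkord ler_wpM2l // geometric_sum_le.
have lim : (fun K => md (\prod_(n < K) (1 - z * a ^+ n) - \prod_(n < K) (1 - w * a ^+ n)))
   @ \oo --> (md (qpoch z a - qpoch w a) : R).
  by apply: (@cvg_modulus R nat \oo); apply: cvgB; exact: qpoch_cvg.
rewrite -(cvg_lim (@norm_hausdorff _ _) lim); apply: limr_le; first by apply/cvg_ex; eexists; exact: lim.
near=> K; apply: le_trans (fin K) _; rewrite ler_wpM2l //.
Unshelve. all: by end_near. Qed.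

Lemma ccont_qpoch (a w : C) : md a < 1 -> ccont (fun z => qpoch z a) w.
Proof.
move=> a1; set L := expR ((md w + 1) * (1 - md a)^-1) * (1 - md a)^-1.
have L0 : 0 < L by rewrite mulr_gt0 ?expR_gt0 // invr_gt0 subr_gt0.
apply/ccontP => e e0; have hid := (ccontP id w).1 (@ccont_id R w).
near=> z; apply: le_lt_trans (_ : md (w - z) * L < e).
  apply: qpoch_lipschitz => //; first by rewrite lerDl.
  rewrite -[z](subrK w) addrC (le_trans (modulusD _ _)) // lerD2l modulusB ltW //.
  by near: z; exact: hid.
rewrite -ltr_pdivlMr //; near: z; apply: hid; exact: divr_gt0.
Unshelve. all: by end_near. Qed.

Lemma ccont_Theta (a w : C) : md a < 1 -> w != 0 -> ccont (Theta a) w.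
Proof.
move=> a1 w0; rewrite /Theta; apply: ccontM; last exact: ccont_cst.
apply: ccontM; first exact: ccont_qpoch.
apply: (@ccont_comp R (fun z => a / z) (fun z => qpoch z a)); last exact: ccont_qpoch.
by apply: ccontM; [exact: ccont_cst | apply: ccontV => //; exact: ccont_id].
Qed.

End Pochhammer.

(** * Unconditional summation *)

Section UnconditionalSums.
Variable R : realType.
Local Notation C := R[i].
Local Notation md := (@modulus R).
Local Open Scope fset_scope.
Local Open Scope ring_scope.

(** Sum of a family as the limit of its sums over finite sets. It is
    insensitive to reindexing, which makes the rearrangement of the
    product of two theta series a matter of bijections. *)
Definition hsum (I : choiceType) (f : I -> C) (s : C) : Prop :=
  forall e : R, 0 < e -> exists J0 : {fset I}, forall J : {fset I},
    J0 `<=` J -> md (s - \sum_(i <- J) f i) < e.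

Lemma hsum_uniq (I : choiceType) (f : I -> C) s t : hsum f s -> hsum f t -> s = t.
Proof.
move=> hs ht; apply/eqP; rewrite -subr_eq0 -modulus_eq0; apply/eqP.
apply/le_anti; rewrite modulus_ge0 andbT; apply/ler_addgt0Pl => d d0; rewrite addr0.
have d2 : 0 < d / 2 by rewrite divr_gt0.
have [J1 h1] := hs _ d2; have [J2 h2] := ht _ d2.
have := h1 _ (fsubsetUl J1 J2); have := h2 _ (fsubsetUr J1 J2).
set S := \sum_(i <- _) _ => k2 k1; rewrite (_ : s - t = (s - S) - (t - S)); last by ring.
apply: le_trans (modulusD _ _) _; rewrite modulusN (splitr d); apply: ltW; exact: ltrD.
Qed.

Lemma hsumZ (I : choiceType) (f : I -> C) s a : hsum f s -> hsum (fun i => a * f i) (a * s).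
Proof.
move=> hs d d0; have a0 : 0 < md a + 1 by rewrite ltr_wpDl.
have [J1 h1] := hs _ (divr_gt0 d0 a0); exists J1 => J /h1 {}h1.
rewrite -mulr_sumr -mulrBr modulusM; apply: le_lt_trans (_ : (md a + 1) * md (s - \sum_(i <- J) f i) < d).
  by rewrite ler_wpM2r // lerDl.
by rewrite mulrC -ltr_pdivlMr.
Qed.

Lemma hsum_bij (I J : choiceType) (h : I -> J) (f : J -> C) s : bijective h ->
  hsum f s -> hsum (fun i => f (h i)) s.
Proof.
case=> k hk kh hs e e0; have [J0 h0] := hs e e0; exists (k @` J0) => K hK.
have -> : \sum_(i <- K) f (h i) = \sum_(j <- h @` K) f j.
  by rewrite big_imfset //= => x y _ _; apply: can_inj hk _ _.
apply: h0; apply/fsubsetP => j jJ; rewrite -[j]kh; apply: in_imfset.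
by apply: (fsubsetP hK); apply: in_imfset.
Qed.

Lemma fsumU (I : choiceType) (V : zmodType) (A B : {fset I}) (F : I -> V) :
  [disjoint A & B] -> \sum_(i <- A `|` B) F i = \sum_(i <- A) F i + \sum_(i <- B) F i.
Proof.
move=> dAB; rewrite -big_cat; apply: perm_big; apply: uniq_perm.
- exact: fset_uniq.
- rewrite cat_uniq !fset_uniq /= andbT; apply/hasPn => x xB.
  by apply/negP => xA; move/fdisjointP: dAB => /(_ x xA); rewrite xB.
- by move=> x; rewrite mem_cat in_fsetU.
Qed.

Lemma hsum_sum (I J : choiceType) (f : I + J -> C) s t :
  hsum (fun i => f (inl i)) s -> hsum (fun j => f (inr j)) t -> hsum f (s + t).
Proof.
move=> hs ht d d0; have d2 : 0 < d / 2 by rewrite divr_gt0.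
have [J1 h1] := hs _ d2; have [J2 h2] := ht _ d2.
exists ([fset inl i | i in J1] `|` [fset inr i | i in J2]) => K; rewrite fsubUset => /andP[k1 k2].
have [K1 mK1] : exists K1 : {fset I}, forall i, (i \in K1) = (inl i \in K).
  exists [fset i | i in pmap (fun x : I + J => if x is inl i then Some i else None) K] => i.
  rewrite !inE /= mem_pmap; apply/mapP/idP => [[[x|x]] xK // [->] //|h]; by exists (inl i).
have [K2 mK2] : exists K2 : {fset J}, forall i, (i \in K2) = (inr i \in K).
  exists [fset i | i in pmap (fun x : I + J => if x is inr i then Some i else None) K] => i.
  rewrite !inE /= mem_pmap; apply/mapP/idP => [[[x|x]] xK // [->] //|h]; by exists (inr i).
have -> : \sum_(i <- K) f i = \sum_(i <- K1) f (inl i) + \sum_(i <- K2) f (inr i).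
  have -> : \sum_(i <- K1) f (inl i) = \sum_(i <- [fset inl i | i in K1]) f i.
    by rewrite big_imfset //= => x y _ _ [].
  have -> : \sum_(i <- K2) f (inr i) = \sum_(i <- [fset inr i | i in K2]) f i.
    by rewrite big_imfset //= => x y _ _ [].
  rewrite -fsumU; last first.
    apply/fdisjointP => x /imfsetP[i /= _ ->]; apply/negP => /imfsetP[j /= _]; done.
  congr (\sum_(i <- enum_fset _) _); apply/fsetP => x; rewrite in_fsetU.
  apply/idP/orP => [|[]/imfsetP[i /=]].
  - case: x => i hi; [left | right]; apply/imfsetP; exists i => //=; [by rewrite mK1 | by rewrite mK2].
  - by rewrite mK1 => ? ->.
  - by rewrite mK2 => ? ->.
rewrite (_ : _ - _ = (s - \sum_(i <- K1) f (inl i)) + (t - \sum_(i <- K2) f (inr i))); last by ring.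
apply: le_lt_trans (modulusD _ _) _; rewrite (splitr d) ltrD ?h1 ?h2 //.
  by apply/fsubsetP => i hi; rewrite mK1; apply: (fsubsetP k1); apply: in_imfset.
by apply/fsubsetP => i hi; rewrite mK2; apply: (fsubsetP k2); apply: in_imfset.
Qed.

Lemma fsum_split (I : choiceType) (V : zmodType) (A B : {fset I}) (F : I -> V) : A `<=` B ->
  \sum_(i <- B) F i = \sum_(i <- A) F i + \sum_(i <- B `\` A) F i.
Proof.
move=> h; rewrite -fsumU; last by apply/fdisjointP => x xA; rewrite in_fsetD xA.
by congr (\sum_(i <- enum_fset _) _); apply/fsetP => x; rewrite in_fsetU in_fsetD; case: (boolP (x \in A)) => //= /(fsubsetP h).
Qed.

Lemma fsum_le (I : choiceType) (A B : {fset I}) (F : I -> R) : (forall i, 0 <= F i) -> A `<=` B ->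
  \sum_(i <- A) F i <= \sum_(i <- B) F i.
Proof. by move=> F0 h; rewrite (fsum_split _ h) lerDl sumr_ge0. Qed.

Definition abs_hsum (I : choiceType) (f : I -> C) := exists s, hsum (fun i => (md (f i))%:C) s.

(** Choose A, B such that the sums over A and B, for f, g and for their absolute
    values, are close to the limits. A finite set K containing A x B sits in a
    rectangle K1 x K2; the terms of the rectangle outside of K are bounded by
    the difference of two rectangle sums of absolute values. *)
Lemma hsum_prod (I J : choiceType) (f : I -> C) (g : J -> C) s t :
  abs_hsum f -> abs_hsum g -> hsum f s -> hsum g t ->
  hsum (fun x : I * J => f x.1 * g x.2) (s * t).
Proof.
move=> [s' hs'] [t' ht'] hs ht e e0.
have lim2 (u v d : R) : 0 < d -> exists2 r : R, 0 < r & (r * (u + v + r) <= d).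
  move=> d0; exists (Num.min 1 (d / (`|u| + `|v| + 1))).
    by rewrite lt_min ltr01 divr_gt0 // !addr_ge0 // ltr_wpDl // addr_ge0.
  set m := Num.min _ _.
  have p0 : 0 < `|u| + `|v| + 1 by rewrite ltr_wpDl // addr_ge0.
  have m1 : m <= 1 by rewrite ge_min lexx.
  have m2 : m <= d / (`|u| + `|v| + 1) by rewrite ge_min lexx orbT.
  have m0 : 0 <= m by rewrite le_min ler01 ltW ?divr_gt0.
  apply: (@le_trans _ _ (m * (`|u| + `|v| + 1))); last by rewrite -ler_pdivlMr.
  by rewrite ler_wpM2l // lerD // lerD // ler_norm.
have prodclose (a b x y : C) (r : R) : md (a - x) < r -> md (b - y) < r -> 0 < r ->
    md (a * b - x * y) <= r * (md a + md b + r).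
  move=> ha hb r0; rewrite (_ : a * b - x * y = a * (b - y) + b * (a - x) - (a - x) * (b - y)); last by ring.
  apply: le_trans (modulusD _ _) _; rewrite modulusN (modulusM (a - x)).
  apply: le_trans (lerD (modulusD _ _) (lexx _)) _; rewrite !modulusM.
  have -> : r * (md a + md b + r) = (md a * r + md b * r) + r * r by ring.
  by rewrite !lerD // ?ler_wpM2l ?ler_pM // ltW.
have e4 : 0 < e / 4 by rewrite divr_gt0.
have [r r0 hr] := lim2 (md s) (md t) (e / 4) e4.
have [r' r'0 hr'] := lim2 (md s') (md t') (e / 4) e4.
have [A1 a1] := hs _ r0; have [A2 a2] := hs' _ r'0.
have [B1 b1] := ht _ r0; have [B2 b2] := ht' _ r'0.
pose A := A1 `|` A2; pose B := B1 `|` B2.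
have sumX (V : pzRingType) (K1 : {fset I}) (K2 : {fset J}) (F : I -> V) (G : J -> V) :
    \sum_(x <- K1 `*` K2) F x.1 * G x.2 = (\sum_(i <- K1) F i) * \sum_(j <- K2) G j.
  rewrite big_distrl /= /fsetM big_imfset2 /=; last first.
    by move=> [x1 x2] [y1 y2] _ _ [-> ->].
  by apply: eq_bigr => i _; rewrite big_distrr.
exists (A `*` B) => K hK.
pose K1 := A `|` [fset x.1 | x in K]; pose K2 := B `|` [fset x.2 | x in K].
have KK : K `<=` K1 `*` K2.
  apply/fsubsetP => x xK; rewrite in_fsetM !in_fsetU.
  by rewrite !in_imfset ?orbT //.
(* K1 x K2 is the rectangle spanned by K *)
have sub (U : choiceType) (X Y Z : {fset U}) : X `<=` Z -> X `<=` Z `|` Y.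
  by move=> h; apply: fsubset_trans h (fsubsetUl _ _).
have hst : md (s * t - (\sum_(i <- K1) f i) * \sum_(j <- K2) g j) <= e / 4.
  by apply: le_trans hr; apply: prodclose => //; [apply: a1 | apply: b1]; apply: sub; exact: fsubsetUl.
have habs (X : {fset I}) (Y : {fset J}) : A2 `<=` X -> B2 `<=` Y ->
    md (s' * t' - ((\sum_(i <- X) md (f i)) * \sum_(j <- Y) md (g j))%:C) <= e / 4.
  move=> hX hY; apply: le_trans hr'; rewrite rmorphM /= !rmorph_sum /=.
  by apply: prodclose => //; [exact: a2 | exact: b2].
have hA2 : A2 `<=` A by exact: fsubsetUr.
have hB2 : B2 `<=` B by exact: fsubsetUr.
have d1 := habs _ _ hA2 hB2; have d2 := habs _ _ (sub _ _ [fset x.1 | x in K] _ hA2) (sub _ _ [fset x.2 | x in K] _ hB2).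
rewrite -sumX in hst; rewrite -!sumX -/K1 -/K2 in d1 d2.
rewrite (fsum_split _ KK) in hst.
set S := \sum_(i <- K) _ in hst *; set D := \sum_(i <- _ `\` _) _ in hst *.
have hD : md D <= e / 2.
  apply: le_trans (modulus_sum _ _ _) _; under eq_bigr do rewrite modulusM.
  pose F (x : I * J) := md (f x.1) * md (g x.2).
  have -> : \sum_(i <- (K1 `*` K2) `\` K) md (f i.1) * md (g i.2) = \sum_(i <- K1 `*` K2) F i - \sum_(i <- K) F i.
    by rewrite (fsum_split _ KK) addrC addKr.
  have FK : \sum_(i <- A `*` B) F i <= \sum_(i <- K) F i.
    by apply: fsum_le => // x; rewrite mulr_ge0.
  apply: le_trans (_ : \sum_(i <- K1 `*` K2) F i - \sum_(i <- A `*` B) F i <= _); first by rewrite lerB.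
  apply: le_trans (ler_norm _) _; rewrite -modulus_real rmorphB /=.
  set x := (\sum_(i <- K1 `*` K2) _)%:C in d2 *; set y := (\sum_(i <- A `*` B) _)%:C in d1 *.
  rewrite (_ : x - y = (s' * t' - y) - (s' * t' - x)); last by ring.
  apply: le_trans (modulusD _ _) _; rewrite modulusN.
  by apply: le_trans (lerD d1 d2) _; lra.
rewrite (_ : s * t - S = (s * t - (S + D)) + D); last by ring.
apply: le_lt_trans (modulusD _ _) _; apply: le_lt_trans (lerD hst hD) _; lra.
Qed.

Lemma hsum_nat (f : nat -> C) (c r : R) (s : C) : 0 <= r -> r < 1 ->
  (forall n, md (f n) <= c * r ^+ n) -> series (f : nat -> C^o) @ \oo --> (s : C^o) -> hsum f s.
Proof.
move=> r0 r1 h hs e e0.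
have c0 : 0 <= c by have := h 0%N; rewrite expr0 mulr1; exact: (le_trans (modulus_ge0 _)).
have e2 : 0 < e / 2 by rewrite divr_gt0.
have h1 : \forall n \near \oo, md (s - series (f : nat -> C^o) n) < e / 2.
  by apply: ((@cvg_modulusP R nat \oo _ _ _).1 hs _ e2).
have h2 : \forall n \near \oo, c * (1 - r)^-1 * r ^+ n < e / 2.
  have : (fun n => c * (1 - r)^-1 * r ^+ n) @ \oo --> (0 : R).
    by apply: cvg_geometric; rewrite ger0_norm.
  move=> /cvgrPdist_lt /(_ _ e2); apply: filterS => n; rewrite sub0r normrN.
  exact: le_lt_trans (ler_norm _).
have [n [hn1 hn2]] : exists n, md (s - series (f : nat -> C^o) n) < e / 2 /\ c * (1 - r)^-1 * r ^+ n < e / 2.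
  have [n hn] := @filter_ex nat \oo _ _ (@filterI nat \oo _ _ _ h1 h2); by exists n.
exists [fset i | i in iota 0 n] => J hJ.
have memJ0 i : (i \in [fset i | i in iota 0 n]) = (i < n)%N.
  by rewrite !inE mem_iota.
rewrite (fsum_split _ hJ).
have -> : \sum_(i <- [fset i | i in iota 0 n]) f i = series (f : nat -> C^o) n.
  rewrite /series /=; apply: perm_big; apply: uniq_perm; rewrite ?fset_uniq ?iota_uniq //.
  by move=> i; rewrite memJ0 mem_index_iota.
rewrite opprD addrA; apply: le_lt_trans (modulusD _ _) _; rewrite modulusN (splitr e).
apply: ltrD => //; apply: le_lt_trans (modulus_sum _ _ _) _.
set X := J `\` _.
have [K hK] : exists K, forall i, i \in X -> (i < K)%N.
  exists (\max_(i <- X) i).+1 => i iX; rewrite ltnS.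
  by rewrite (big_fsetD1 i) //= leq_maxl.
apply: le_lt_trans hn2; apply: (@le_trans _ _ (\sum_(i <- X) c * r ^+ i)); first by apply: ler_sum.
have sub : X `<=` [fset i | i in index_iota n K].
  apply/fsubsetP => i iX; rewrite !inE mem_index_iota hK // andbT.
  by move: iX; rewrite in_fsetD memJ0 -leqNgt => /andP[].
apply: (@le_trans _ _ (\sum_(i <- [fset i | i in index_iota n K]) c * r ^+ i)).
  by apply: fsum_le => // i; rewrite mulr_ge0 ?exprn_ge0.
rewrite (@perm_big _ _ _ _ _ (index_iota n K)); last first.
  by apply: uniq_perm; rewrite ?fset_uniq ?iota_uniq // => i; rewrite !inE.
by rewrite -mulr_sumr -mulrA ler_wpM2l // mulrC geometric_tail_le.
Qed.

Lemma abs_hsum_nat (f : nat -> C) (c r : R) : 0 <= r -> r < 1 ->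
  (forall n, md (f n) <= c * r ^+ n) -> abs_hsum f.
Proof.
move=> r0 r1 h.
have h' n : md (md (f n))%:C <= c * r ^+ n by rewrite modulus_real ger0_norm.
have [s hs] := series_geometric_cvg r0 r1 h'.
by exists s; exact: (hsum_nat r0 r1 h' hs).
Qed.

Definition nat_of_int_sum (x : nat + nat) : int := match x with inl n => Posz n | inr n => Negz n end.

Lemma nat_of_int_sum_bij : bijective (fun x : int => match x with Posz n => inl n : (nat + nat)%type | Negz n => inr n end).
Proof. by exists nat_of_int_sum => [[]|[]]. Qed.

Lemma hsum_int (f : int -> C) (s t : C) :
  hsum (fun n => f (Posz n)) s -> hsum (fun n => f (Negz n)) t -> hsum f (s + t).
Proof.
move=> hs ht.
have := @hsum_sum _ _ (fun x : nat + nat => f (nat_of_int_sum x)) s t hs ht.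
move=> /(hsum_bij nat_of_int_sum_bij); congr (hsum _ _).
by apply/funext => -[].
Qed.

Lemma hsum_sumZ (u : int -> C) (c r : R) : 0 <= r -> r < 1 ->
  (forall n : int, md (u n) <= c * r ^+ `|n|%N) -> hsum u (sumZ u) /\ abs_hsum u.
Proof.
move=> r0 r1 h.
have c0 : 0 <= c by have := h 0; rewrite expr0 mulr1; exact: (le_trans (modulus_ge0 _)).
have hp n : md (u (Posz n)) <= c * r ^+ n by exact: h.
have hn n : md (u (Negz n)) <= c * r ^+ n.
  apply: le_trans (h _) _; rewrite ler_wpM2l // NegzE abszN /= exprS ler_piMl ?exprn_ge0 // ltW //.
split.
  have [s hs] := series_geometric_cvg r0 r1 hp; have [t ht] := series_geometric_cvg r0 r1 hn.
  rewrite /sumZ (limnE hs) (limnE ht); apply: hsum_int; [exact: (hsum_nat r0 r1 hp hs)|exact: (hsum_nat r0 r1 hn ht)].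
have [s hs] := abs_hsum_nat r0 r1 hp; have [t ht] := abs_hsum_nat r0 r1 hn.
by exists (s + t); apply: hsum_int.
Qed.

End UnconditionalSums.

(** * Theta series and the three-term relation *)

Fact th_key : unit. Proof. exact: tt. Qed.

Section ThetaSeries.
Variable R : realType.
Local Notation C := R[i].
Local Notation md := (@modulus R).

(** General term of the theta series with real first characteristic a, the second
    characteristic being absorbed in y. *)
Definition gterm (a : R) (tau y : C) (m : int) : C :=
  epi ((m%:~R + a%:C) ^+ 2 * tau + 2 * (m%:~R + a%:C) * y).

(** Gaussian decay: al w^2 - be |w| >= - be^2 / (4 al) for w = m + a, with al = pi Im tau; be exceeds
    the linear coefficient of the exponent by 1, which leaves the factor e^(-|m|). *)
Lemma gterm_le a tau y : 0 < complex.Im tau ->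
  exists c : R, forall m, md (gterm a tau y m) <= c * expR (-1) ^+ `|m|%N.
Proof.
move=> t0; have p0 := @pi_gt0 R.
set t := complex.Im tau in t0; pose al := pi * t; pose be := 2 * pi * `|complex.Im y| + 1.
exists (expR (be ^+ 2 / (4 * al) + `|a|)) => m.
rewrite -expRM_natl -expRD modulus_epi ler_expR.
have -> : complex.Im ((m%:~R + a%:C) ^+ 2 * tau + 2 * (m%:~R + a%:C) * y) =
   (m%:~R + a) ^+ 2 * t + 2 * (m%:~R + a) * complex.Im y.
  have -> : m%:~R + a%:C = (m%:~R + a)%:C :> C by rewrite rmorphD /= rmorph_int.
  rewrite -rmorphXn /= -(rmorph_nat (real_complex R) 2) -rmorphM /=.
  by case: tau y @t t0 @al @be => [t1 t2] [y1 y2] /=; simpc.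
set w := m%:~R + a; have al0 : 0 < al by rewrite mulr_gt0.
have hm : (`|m|%N)%:R <= `|w| + `|a|.
  rewrite natr_absz -[X in `|X|%:~R](addrK 0) addr0 subr0 intr_norm.
  by rewrite -{1}[m%:~R](addrK a) (le_trans (ler_normB _ _)).
have hy : - (2 * pi * w * complex.Im y) <= 2 * pi * `|complex.Im y| * `|w|.
  apply: le_trans (ler_norm _) _; rewrite normrN !normrM (ger0_norm (ltW p0)) ger0_norm //.
  by rewrite -!mulrA ler_pM2l // ler_pM2l // mulrC.
have hq : be * `|w| - al * w ^+ 2 <= be ^+ 2 / (4 * al).
  rewrite ler_pdivlMr ?mulr_gt0 // -(real_normK (num_real w)).
  have := sqr_ge0 (be - 2 * al * `|w|); lra.
rewrite /al /be in hq *; lra.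
Qed.

Lemma gterm_hsum a tau y : 0 < complex.Im tau ->
  hsum (gterm a tau y) (sumZ (gterm a tau y)) /\ abs_hsum (gterm a tau y).
Proof.
move=> /(gterm_le a y) [c hc]; apply: hsum_sumZ hc; first exact: expR_ge0.
by rewrite expR_lt1 ltrN10.
Qed.

Section FixTau.
Variable tau : C.
Hypothesis tau_gt0 : 0 < complex.Im tau.

(** The odd theta function, with both characteristics 1/2. *)
Definition th (x : C) : C := locked_with th_key (theta 2^-1 2^-1 x tau).

Lemma th_theta x : th x = theta 2^-1 2^-1 x tau.
Proof. by rewrite /th locked_withE. Qed.

Lemma half_real : (2^-1 : C) = (2^-1 : R)%:C.
Proof. by rewrite fmorphV /= rmorph_nat. Qed.

Lemma thE x : th x = sumZ (gterm 2^-1 tau (x + 2^-1)).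
Proof. by rewrite th_theta /theta; congr sumZ; apply/funext => m; rewrite /gterm half_real. Qed.

(** The theta functions of nome tau' = 2 tau that occur in the addition formula. *)
Definition thA (u : C) := sumZ (gterm 0 (2 * tau) (2 * u)).
Definition thB (u : C) := sumZ (gterm 2^-1 (2 * tau) (2 * u)).

Lemma epi_addn (x : C) (n : int) : epi (x + 2 * n%:~R) = epi x.
Proof. by rewrite epiD epi_even mulr1. Qed.

(** The summation indices (m, n) of the product of the two series are replaced by
    m + n and m - n, up to a shift: pairs with m + n odd or even are parametrized by
    (k + l, k - l - 1) or (k + l, k - l), and the general term then factors
    into a function of k and a function of l. *)
Lemma th_addsub u v : th (u + v) * th (u - v) = thA u * thB v - thB u * thA v.
Proof.
have tau2 : 0 < complex.Im (2 * tau).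
  rewrite -(rmorph_nat (real_complex R) 2); case: tau tau_gt0 => a b /= b0.
  by rewrite mul0r addr0 mulr_gt0.
have [h1 a1] := gterm_hsum 2^-1 (u + v + 2^-1) tau_gt0.
have [h2 a2] := gterm_hsum 2^-1 (u - v + 2^-1) tau_gt0.
have [hA aA] := gterm_hsum 0 (2 * u) tau2; have [hA' aA'] := gterm_hsum 0 (2 * v) tau2.
have [hB aB] := gterm_hsum 2^-1 (2 * u) tau2; have [hB' aB'] := gterm_hsum 2^-1 (2 * v) tau2.
have hl := hsum_prod a1 a2 h1 h2.
pose h (x : (int * int) + (int * int)) : int * int :=
  match x with inl (k, l) => (k + l, k - l - 1) | inr (k, l) => (k + l, k - l) end.
have hbij : bijective h.
  pose g (x : int * int) : (int * int) + (int * int) :=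
    if (2 %| x.1 + x.2)%Z then inr ((x.1 + x.2) %/ 2, (x.1 - x.2) %/ 2)%Z
    else inl ((x.1 + x.2 + 1) %/ 2, (x.1 - x.2 - 1) %/ 2)%Z.
  exists g => [[[k l]|[k l]]|[m n]]; rewrite /h /g /=.
  - have -> : (2 %| k + l + (k - l - 1))%Z = false by lia.
    by congr (inl (_, _)); lia.
  - have -> : (2 %| k + l + (k - l))%Z by lia.
    by congr (inr (_, _)); lia.
  - by case: ifP => hd; congr (_, _); lia.
have := hsum_bij hbij hl; rewrite -!thE => /hsum_uniq; apply.
have hr2 : hsum (fun x : int * int => - (gterm 2^-1 (2 * tau) (2 * u) x.1 * gterm 0 (2 * tau) (2 * v) x.2)) (- (thB u * thA v)).
  have := hsumZ (-1) (hsum_prod aB aA' hB hA'); rewrite mulN1r.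
  by rewrite (_ : (fun i => _) = (fun x : int * int => - (gterm 2^-1 (2 * tau) (2 * u) x.1 * gterm 0 (2 * tau) (2 * v) x.2))) //; apply/funext => x; rewrite mulN1r.
have hr1 := hsum_prod aA aB' hA hB'.
rewrite -/(thA u) -/(thB v) in hr1.
pose f (x : (int * int) + (int * int)) : C := match x with
  | inl x => gterm 0 (2 * tau) (2 * u) x.1 * gterm 2^-1 (2 * tau) (2 * v) x.2
  | inr x => - (gterm 2^-1 (2 * tau) (2 * u) x.1 * gterm 0 (2 * tau) (2 * v) x.2) end.
have := @hsum_sum R _ _ f _ _ hr1 hr2; congr (hsum _ _); apply/funext => -[[k l]|[k l]] /=.
  rewrite /gterm -!epiD -half_real -[RHS](epi_addn _ (-k)); congr epi.
  by rewrite !rmorphB /= !rmorphD /= rmorph0 rmorph1 rmorphN /=; field.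
rewrite /gterm -!epiD -half_real -mulN1r -epi1 -epiD -[RHS](epi_addn _ (- k)); congr epi.
by rewrite !rmorphB /= !rmorphD /= rmorph0 rmorphN /=; field.
Qed.

(** By the addition formula every product f(a+b) f(a-b) is a 2 x 2 minor of the
    matrix with rows A and B; this is the Pluecker relation between minors. *)
Lemma th_weierstrass (a b c d : C) :
  th (a + b) * th (a - b) * (th (c + d) * th (c - d)) -
  th (a + c) * th (a - c) * (th (b + d) * th (b - d)) +
  th (a + d) * th (a - d) * (th (b + c) * th (b - c)) = 0.
Proof.
rewrite (th_addsub a b) (th_addsub c d) (th_addsub a c) (th_addsub b d) (th_addsub a d) (th_addsub b c).
ring.
Qed.

End FixTau.
End ThetaSeries.

(** * Jacobi's triple product *)

Section Jacobi.
Variable R : realType.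
Local Notation C := R[i].
Local Notation md := (@modulus R).

(** Dominated convergence for series with a geometric bound and a number of
    terms that grows with n. *)
Lemma tannery (u : nat -> nat -> C) (w : nat -> C) (W : C) (s : nat -> nat) (c r : R) :
  0 <= r -> r < 1 -> (forall n m, md (u n m) <= c * r ^+ m) ->
  (forall m, (fun n => u n m : C^o) @ \oo --> (w m : C^o)) -> (forall n, (n <= s n)%N) ->
  series (w : nat -> C^o) @ \oo --> (W : C^o) ->
  (fun n => \sum_(m < s n) u n m : C^o) @ \oo --> (W : C^o).
Proof.
move=> r0 r1 hu hw hs hW.
have c0 : 0 <= c by have := hu 0%N 0%N; rewrite expr0 mulr1; exact: (le_trans (modulus_ge0 _)).
apply/(@cvg_modulusP R nat \oo) => e e0.
have e3 : 0 < e / 3 by rewrite divr_gt0.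
have h1 : \forall n \near \oo, md (W - series (w : nat -> C^o) n) < e / 3.
  by apply: ((@cvg_modulusP R nat \oo _ _ _).1 hW _ e3).
have h2 : \forall n \near \oo, c * (1 - r)^-1 * r ^+ n < e / 3.
  have : (fun n => c * (1 - r)^-1 * r ^+ n) @ \oo --> (0 : R).
    by apply: cvg_geometric; rewrite ger0_norm.
  move=> /cvgrPdist_lt /(_ _ e3); apply: filterS => n; rewrite sub0r normrN.
  exact: le_lt_trans (ler_norm _).
have [m0 [hm1 hm2]] : exists n, md (W - series (w : nat -> C^o) n) < e / 3 /\ c * (1 - r)^-1 * r ^+ n < e / 3.
  have [n hn] := @filter_ex nat \oo _ _ (@filterI nat \oo _ _ _ h1 h2); by exists n.
have h3 : (fun n => \sum_(m < m0) u n m : C^o) @ \oo --> (series (w : nat -> C^o) m0 : C^o).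
  rewrite /series /= big_mkord; elim: (m0) => [|k IH].
    by rewrite big_ord0; under eq_fun do rewrite big_ord0; exact: cvg_cst.
  rewrite big_ord_recr /=; under eq_fun do rewrite big_ord_recr /=.
  by apply: cvg_seqD; [exact: IH | exact: hw].
have h4 : \forall n \near \oo, md (series (w : nat -> C^o) m0 - \sum_(m < m0) u n m) < e / 3.
  by apply: ((@cvg_modulusP R nat \oo _ _ _).1 h3 _ e3).
near=> n.
have mn : (m0 <= s n)%N by apply: leq_trans (hs n); near: n; exact: nbhs_infty_ge.
rewrite -(big_mkord xpredT (u n)) (@big_cat_nat _ _ _ m0) //= big_mkord.
have hU : md (series (w : nat -> C^o) m0 - \sum_(m < m0) u n m) < e / 3 by near: n; exact: h4.
set S := series _ _ in hm1 hU *; set U := \sum_(m < m0) _ in hU *; set V := \sum_(m0 <= m < _) _.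
rewrite (_ : _ - _ = (W - S) + (S - U) - V); last by ring.
have hV : md V < e / 3.
  apply: le_lt_trans hm2; apply: le_trans (modulus_sum _ _ _) _.
  apply: (@le_trans _ _ (\sum_(m0 <= m < s n) c * r ^+ m)); first by apply: ler_sum.
  by rewrite -mulr_sumr -mulrA ler_wpM2l // mulrC geometric_tail_le.
apply: le_lt_trans (modulusD _ _) _; rewrite modulusN.
have -> : e = e / 3 + e / 3 + e / 3 by field.
by apply: ltrD => //; apply: le_lt_trans (modulusD _ _) _; apply: ltrD.
Unshelve. all: by end_near. Qed.

Lemma cvg_bounded (u : nat -> C) (l : C) : (u : nat -> C^o) @ \oo --> (l : C^o) ->
  exists2 M : R, 0 <= M & forall n, md (u n) <= M.
Proof.
move=> hu; have [n0 _ h0] : \forall n \near \oo, md (l - u n) < 1.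
  by apply: ((@cvg_modulusP R nat \oo _ _ _).1 hu _ ltr01).
exists (md l + 1 + \sum_(n < n0) md (u n)).
  by rewrite addr_ge0 ?sumr_ge0 // addr_ge0.
move=> n; have [hn|hn] := leqP n0 n.
  rewrite -[leLHS]addr0 lerD ?sumr_ge0 // -[u n](subrK l) addrC (le_trans (modulusD _ _)) // lerD2l.
  by rewrite modulusB ltW //; apply: h0.
by rewrite (bigD1 (Ordinal hn)) //= addrCA lerDl addr_ge0 ?sumr_ge0 // addr_ge0.
Qed.

Section Gauss.
Variable p : C.
Hypotheses (p0 : p != 0) (p1 : md p < 1).

Definition qfact n : C := \prod_(k < n) (1 - p ^+ k.+1).

Lemma expr_neq1 n : p ^+ n.+1 != 1.
Proof.
apply/eqP => e; have := exprn_ilt1 n.+1 (modulus_ge0 p) p1.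
by rewrite /= -modulusX e modulus1 ltxx.
Qed.

Lemma qfact_neq0 n : qfact n != 0.
Proof. by apply/prodf_neq0 => i _; rewrite subr_eq0 eq_sym expr_neq1. Qed.

Lemma qfactS n : qfact n.+1 = qfact n * (1 - p ^+ n.+1).
Proof. by rewrite /qfact big_ord_recr. Qed.

Lemma qfact_cvg : (qfact : nat -> C^o) @ \oo --> (qpoch p p : C^o).
Proof.
rewrite (_ : qfact = fun K => \prod_(n < K) (1 - p * p ^+ n)); last first.
  by apply/funext => K; apply: eq_bigr => i _; rewrite -exprS.
exact: qpoch_cvg.
Qed.

Lemma qpoch_pp_neq0 : qpoch p p != 0.
Proof. by apply: qpoch_neq0 => // n; rewrite -exprS expr_neq1. Qed.

(** Gaussian binomial coefficients. *)
Definition qbin K j : C := if (j <= K)%N then qfact K / (qfact j * qfact (K - j)) else 0.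

Lemma qbin0 K : qbin K 0 = 1.
Proof. by rewrite /qbin subn0 /qfact big_ord0 mul1r divff // qfact_neq0. Qed.

Lemma qbinS K j : (j <= K)%N -> qbin K.+1 j.+1 = qbin K j.+1 + p ^+ (K - j) * qbin K j.
Proof.
move=> jK; rewrite /qbin ltnS jK subSS.
have h1 := qfact_neq0 j; have h2 := qfact_neq0 (K - j).
have h3 : 1 - p ^+ j.+1 != 0 by rewrite subr_eq0 eq_sym expr_neq1.
have [jK'|jK'] := ltnP j K; last first.
  have -> : K = j by apply/eqP; rewrite eqn_leq jK jK'.
  have q0 : qfact 0 = 1 by rewrite /qfact big_ord0.
  by rewrite subnn expr0 mul1r add0r q0 !mulr1 !divff ?qfact_neq0.
have -> : (K - j = (K - j.+1).+1)%N by lia.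
rewrite !qfactS; have h4 := qfact_neq0 (K - j.+1).
have h5 : 1 - p ^+ (K - j.+1).+1 != 0 by rewrite subr_eq0 eq_sym expr_neq1.
have -> : p ^+ K.+1 = p ^+ (K - j.+1).+1 * p ^+ j.+1 by rewrite -exprD; congr (_ ^+ _); lia.
field; by rewrite h1 h3 h4 h5.
Qed.

Lemma gauss_binomial K x :
  \prod_(k < K) (1 + x * p ^+ k) = \sum_(j < K.+1) p ^+ 'C(j, 2) * x ^+ j * qbin K j.
Proof.
elim: K => [|K IH]; first by rewrite big_ord0 big_ord1 /= qbin0 !expr0 !mulr1.
rewrite big_ord_recr /= IH mulrDr mulr1 [in RHS]big_ord_recl !expr0 qbin0.
under [X in _ = _ + X]eq_bigr => i _.
  rewrite lift0 qbinS ?mulrDr; last by rewrite -ltnS.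
  over.
rewrite big_split /= addrA; congr (_ + _).
  rewrite [in LHS]big_ord_recl !expr0 qbin0; congr (_ + _).
  have qb : qbin K K.+1 = 0 by rewrite /qbin ltnn.
  rewrite [in RHS]big_ord_recr /= qb mulr0 addr0.
  by apply: eq_bigr => i _; rewrite /bump add1n.
rewrite mulr_suml; apply: eq_bigr => i _.
rewrite binS bin1 exprD exprS.
have -> : p ^+ K = p ^+ i * p ^+ (K - i) by rewrite -exprD subnKC // -ltnS.
ring.
Qed.

Lemma double_bin2 k : (2 * 'C(k, 2) = k * k.-1)%N.
Proof. by elim: k => // k IH; rewrite binS bin1 mulnDr IH; case: k {IH} => //= k; rewrite [(2 * _)%N]mulnC -mulnDr addn2 mulnC. Qed.

Lemma bin2D a b : ('C(a + b, 2) = 'C(a, 2) + 'C(b, 2) + a * b)%N.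
Proof.
elim: b => [|b IH]; first by rewrite addn0 muln0 bin0n !addn0.
by rewrite addnS !binS !bin1 IH mulnS; lia.
Qed.

Lemma bin2_square n : ('C(n, 2) + 'C(n, 2) + n = n * n)%N.
Proof.
rewrite addnn -mul2n double_bin2; case: n => //= n.
by rewrite -{2}[n.+1]muln1 -mulnDr addn1.
Qed.

(** Exponents of p in the term of index n + m of the Gauss formula for 2 n
    factors, after the shift by p^-n. *)
Lemma tri_pos n m : ('C(n + m, 2) + (n + m) + 'C(n, 2) = n * (n + m) + 'C(m.+1, 2))%N.
Proof. by rewrite bin2D binS bin1 mulnDr -bin2_square; lia. Qed.

Lemma tri_neg n m : (m < n)%N ->
  ('C(n - m.+1, 2) + (n - m.+1) + 'C(n, 2) = n * (n - m.+1) + 'C(m.+1, 2))%N.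
Proof.
move=> mn; have [k ->] : exists k, n = (k + m.+1)%N by exists (n - m.+1)%N; rewrite subnK.
by rewrite addnK bin2D mulnDl -bin2_square [(m.+1 * k)%N]mulnC; lia.
Qed.

(** Gauss' formula with 2 n factors at - v p^(1-n): half of the factors carry
    positive powers of p, the other half negative ones, which are turned into
    factors in 1/v at the cost of a monomial. *)
Lemma jacobi_finite n v : v != 0 ->
  \prod_(k < n) (1 - p * v * p ^+ k) * \prod_(k < n) (1 - v^-1 * p ^+ k) =
  \sum_(m < n.+1) p ^+ 'C(m.+1, 2) * (- v) ^+ m * qbin (n + n) (n + m) +
  \sum_(m < n) p ^+ 'C(m.+1, 2) * (- v) ^- m.+1 * qbin (n + n) (n - m.+1).
Proof.
move=> v0; have nv0 : - v != 0 by rewrite oppr_eq0.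
have pX k : p ^+ k != 0 by rewrite expf_neq0.
have := gauss_binomial (n + n) (- v * p / p ^+ n).
rewrite big_split_ord /=.
have -> : \prod_(k < n) (1 + - v * p / p ^+ n * p ^+ (n + k)) = \prod_(k < n) (1 - p * v * p ^+ k).
  by apply: eq_bigr => k _; rewrite exprD; field; exact: pX.
have -> : \prod_(k < n) (1 + - v * p / p ^+ n * p ^+ k) =
    (- v) ^+ n / p ^+ 'C(n, 2) * \prod_(k < n) (1 - v^-1 * p ^+ k).
  rewrite -bin2_sum big_mkord -prodrXr -[X in (- v) ^+ X]card_ord -prodr_const -prodf_div -big_split /=.
  rewrite (reindex_inj rev_ord_inj) /=; apply: eq_bigr => k _.
  have -> : p ^+ n = p ^+ (n - k.+1) * p * p ^+ k.
    by rewrite -exprSr -exprD; congr (_ ^+ _); have := ltn_ord k; lia.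
  field; by rewrite v0 !pX p0.
have -> : (n + n).+1 = (n + n.+1)%N by rewrite addnS.
rewrite big_split_ord /= => e.
have D0 : (- v) ^+ n / p ^+ 'C(n, 2) != 0 by rewrite mulf_neq0 ?expf_neq0 // invr_eq0.
apply: (mulfI D0); rewrite [X in _ * X]mulrC mulrA e mulrDr addrC; congr (_ + _).
  rewrite mulr_sumr; apply: eq_bigr => m _.
  rewrite !expr_div_n exprMn -exprM; have /(congr1 (fun k => p ^+ k)) := tri_pos n m.
  rewrite !exprD => t; have := pX (n * (n + m))%N; have := pX 'C(n, 2) => h1 h2.
  rewrite !mulrA; congr (_ * _); apply: (mulIf h1); apply: (mulIf h2).
  transitivity ((- v) ^+ n * (- v) ^+ m * (p ^+ 'C(n + m, 2) * (p ^+ n * p ^+ m) * p ^+ 'C(n, 2))).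
    by field; exact: h2.
  by rewrite t; field; exact: h1.
rewrite mulr_sumr (reindex_inj rev_ord_inj) /=; apply: eq_bigr => m _.
rewrite !expr_div_n exprMn -exprM; have /(congr1 (fun k => p ^+ k)) := tri_neg (ltn_ord m).
rewrite !exprD => t; have := pX (n * (n - m.+1))%N; have := pX 'C(n, 2) => h1 h2.
rewrite !mulrA; congr (_ * _); apply: (mulIf h1); apply: (mulIf h2).
have hv : (- v) ^+ n = (- v) ^+ (n - m.+1) * (- v) ^+ m.+1 by rewrite -exprD subnK.
have hv0 : (- v) ^+ m.+1 != 0 by rewrite expf_neq0.
transitivity ((- v) ^+ (n - m.+1) * (p ^+ 'C(n - m.+1, 2) * p ^+ (n - m.+1) * p ^+ 'C(n, 2))).
  by field; exact: h2.
by rewrite t hv; field; rewrite h1 hv0.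
Qed.

Lemma qbin_bounded : exists2 M : R, 0 <= M & forall K j, md (qbin K j) <= M.
Proof.
have [M1 M10 h1] := cvg_bounded qfact_cvg.
have hV : (fun n => (qfact n)^-1 : C^o) @ \oo --> ((qpoch p p)^-1 : C^o).
  by apply: cvg_seqV; [exact: qpoch_pp_neq0 | exact: qfact_cvg].
have [M2 M20 h2] := cvg_bounded hV.
exists (M1 * (M2 * M2)); first by rewrite !mulr_ge0.
move=> K j; rewrite /qbin; case: ifP => _; last by rewrite modulus0 !mulr_ge0.
by rewrite invfM !modulusM ler_pM ?mulr_ge0 // ler_pM.
Qed.

Lemma qbin_cvg (a s : nat -> nat) : (forall n, a n <= s n)%N -> (forall n, n <= s n)%N ->
  (forall m, \forall n \near \oo, m <= a n)%N -> (forall m, \forall n \near \oo, m <= s n - a n)%N ->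
  (fun n => qbin (s n) (a n) : C^o) @ \oo --> ((qpoch p p)^-1 : C^o).
Proof.
move=> h1 h2 h3 h4.
have sub (f : nat -> nat) : (forall m, \forall n \near \oo, (m <= f n)%N) ->
    (fun n => qfact (f n) : C^o) @ \oo --> (qpoch p p : C^o).
  move=> hf; apply/(@cvg_modulusP R nat \oo) => e e0.
  have [n0 _ hn0] : \forall n \near \oo, md (qpoch p p - qfact n) < e.
    by apply: ((@cvg_modulusP R nat \oo _ _ _).1 qfact_cvg).
  by apply: filterS (hf n0) => n; apply: hn0.
have -> : (qpoch p p)^-1 = qpoch p p * (qpoch p p * qpoch p p)^-1.
  by field; exact: qpoch_pp_neq0.
rewrite (_ : (fun n => _) = (fun n => qfact (s n) * (qfact (a n) * qfact (s n - a n)%N)^-1)); last first.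
  by apply/funext => n; rewrite /qbin h1.
apply: cvg_seqM; first by apply: sub => m; near=> n; apply: leq_trans (h2 n); near: n; exact: nbhs_infty_ge.
apply: cvg_seqV; first by rewrite mulf_neq0 ?qpoch_pp_neq0.
by apply: cvg_seqM; apply: sub.
Unshelve. all: by end_near. Qed.

End Gauss.

(** Limit of the finite identity: the products tend to Pochhammer symbols, and on the
    other side every Gaussian binomial tends to 1 / (p; p), so the sum tends to
    the theta series by dominated convergence, separately for the indices m >= 0
    and m < 0. *)
Lemma theta_product (tau x : C) : 0 < complex.Im tau ->
  th tau x = epi (tau / 4 + x + 2^-1) * Theta (epi (2 * tau)) (epi (- (2 * x))).
Proof.
move=> t0; set p := epi (2 * tau); set E := epi (tau / 4 + x + 2^-1).
have p0 : p != 0 by exact: epi_neq0.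
have p1 : md p < 1.
  rewrite /p modulus_epi expR_lt1 oppr_lt0 mulr_gt0 ?pi_gt0 //.
  rewrite -(rmorph_nat (real_complex R) 2); case: (tau) t0 => a b /= b0.
  by rewrite mul0r addr0 mulr_gt0.
pose v := epi (2 * x); have v0 : v != 0 by exact: epi_neq0.
have vE : - v = epi (2 * x + 1) by rewrite epiD epi1 mulrN1.
pose g := gterm 2^-1 tau (x + 2^-1).
have tri m : ('C(m.+1, 2)%:R : C) = m%:R * (m%:R + 1) / 2.
  have : ('C(m.+1, 2) * 2)%N = (m * m.+1)%N by rewrite mulnC double_bin2 mulnC.
  move=> /(congr1 (fun k => k%:R : C)); by rewrite !natrM natr1 => <-; rewrite mulfK ?pnatr_eq0.
have gP m : g (Posz m) = E * (p ^+ 'C(m.+1, 2) * (- v) ^+ m).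
  rewrite /g /gterm vE -!epiMn -!epiD -half_real tri; congr epi.
  by rewrite [(Posz m)%:~R](_ : _ = m%:R) //; field.
have gN m : g (Negz m) = E * (p ^+ 'C(m.+1, 2) * (- v) ^- m.+1).
  rewrite /g /gterm vE -!epiMn -epiN -!epiD -half_real tri; congr epi.
  by rewrite NegzE rmorphN /= [(Posz m.+1)%:~R](_ : _ = m.+1%:R) // -natr1; field.
have [c hc] := gterm_le 2^-1 (x + 2^-1) t0; rewrite -/g in hc.
have e0 := @expR_ge0 R (-1); have e1 : expR (-1) < 1 :> R by rewrite expR_lt1 ltrN10.
have c0 : 0 <= c by have := hc 0; rewrite expr0 mulr1; exact: (le_trans (modulus_ge0 _)).
have hcP m : md (g (Posz m)) <= c * expR (-1) ^+ m by exact: hc.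
have hcN m : md (g (Negz m)) <= c * expR (-1) ^+ m.
  apply: le_trans (hc _) _; rewrite ler_wpM2l // NegzE abszN /= exprS ler_piMl ?exprn_ge0 // ltW //.
have [S1 hS1] := series_geometric_cvg e0 e1 hcP; have [S2 hS2] := series_geometric_cvg e0 e1 hcN.
have thS : th tau x = S1 + S2 by rewrite thE /sumZ (limnE hS1) (limnE hS2).
have [M M0 hM] := qbin_bounded p1.
set P := (qpoch p p)^-1.
have qcP m : (fun n => qbin p (n + n) (n + m) : C^o) @ \oo --> (P : C^o).
  rewrite -(cvg_shiftn m); apply: (@qbin_cvg p p1 (fun n => n + m + m)%N (fun n => n + m + (n + m))%N).
  - by move=> n; rewrite leq_add2l leq_addl.
  - by move=> n; rewrite -addnA leq_addr.
  - by move=> k; near=> n; rewrite -addnA (leq_trans _ (leq_addr _ _)) //; near: n; exact: nbhs_infty_ge.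
  - by move=> k; near=> n; rewrite subnDl addnK; near: n; exact: nbhs_infty_ge.
have qcN m : (fun n => qbin p (n + n) (n - m.+1) : C^o) @ \oo --> (P : C^o).
  rewrite -(cvg_shiftn m.+1) /=.
  apply: (@qbin_cvg p p1 (fun n => n + m.+1 - m.+1)%N (fun n => n + m.+1 + (n + m.+1))%N).
  - by move=> n; lia.
  - by move=> n; lia.
  - by move=> k; near=> n; rewrite addnK; near: n; exact: nbhs_infty_ge.
  - move=> k; near=> n; rewrite addnK; apply: (@leq_trans n); last by lia.
    by near: n; exact: nbhs_infty_ge.
have serP (f : nat -> C) (S : C) : series (f : nat -> C^o) @ \oo --> (S : C^o) ->
    series (fun m => P * f m : C^o) @ \oo --> (P * S : C^o).
  move=> hf; rewrite (_ : series _ = fun n => P * series (f : nat -> C^o) n).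
    by apply: cvg_seqM; [exact: cvg_seq_cst | exact: hf].
  by apply/funext => n; rewrite /series /= mulr_sumr.
have lim1 : (fun n => \sum_(m < n.+1) qbin p (n + n) (n + m) * g (Posz m) : C^o) @ \oo --> (P * S1 : C^o).
  apply: (@tannery (fun n m => qbin p (n + n) (n + m) * g (Posz m)) (fun m => P * g (Posz m)) _ succn (M * c) (expR (-1)) e0 e1).
  - by move=> n m; rewrite modulusM -mulrA; apply: (ler_pM _ _ (hM _ _)); [exact: modulus_ge0|exact: modulus_ge0|exact: hcP].
  - by move=> m; apply: cvg_seqM; [exact: qcP | exact: cvg_seq_cst].
  - by [].
  - exact: serP.
have lim2 : (fun n => \sum_(m < n) qbin p (n + n) (n - m.+1) * g (Negz m) : C^o) @ \oo --> (P * S2 : C^o).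
  apply: (@tannery (fun n m => qbin p (n + n) (n - m.+1) * g (Negz m)) (fun m => P * g (Negz m)) _ id (M * c) (expR (-1)) e0 e1).
  - by move=> n m; rewrite modulusM -mulrA; apply: (ler_pM _ _ (hM _ _)); [exact: modulus_ge0|exact: modulus_ge0|exact: hcN].
  - by move=> m; apply: cvg_seqM; [exact: qcN | exact: cvg_seq_cst].
  - by [].
  - exact: serP.
have lim3 : (fun n => E * (\prod_(k < n) (1 - p * v * p ^+ k) * \prod_(k < n) (1 - v^-1 * p ^+ k)) : C^o)
    @ \oo --> (E * (qpoch (p * v) p * qpoch v^-1 p) : C^o).
  apply: cvg_seqM; first exact: cvg_seq_cst.
  by apply: cvg_seqM; exact: qpoch_cvg.
have e : P * S1 + P * S2 = E * (qpoch (p * v) p * qpoch v^-1 p).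
  apply: (@cvg_uniq R nat \oo _ _ _ _ (cvg_seqD lim1 lim2)).
  rewrite (_ : (fun n => _) = (fun n => E * (\prod_(k < n) (1 - p * v * p ^+ k) * \prod_(k < n) (1 - v^-1 * p ^+ k)))) //.
  apply/funext => n; rewrite jacobi_finite // mulrDr !mulr_sumr.
  by congr (_ + _); apply: eq_bigr => m _; rewrite ?gP ?gN; ring.
rewrite thS /Theta epiN -/v invrK.
have -> : S1 + S2 = qpoch p p * (P * S1 + P * S2).
  by rewrite -mulrDr mulrA divff ?mul1r // qpoch_pp_neq0.
by rewrite e; ring.
Unshelve. all: by end_near. Qed.

End Jacobi.

(** * Zeros and quasi-periods of theta *)

Section ThetaToolkit.
Variable R : realType.
Local Notation C := R[i].
Local Notation md := (@modulus R).

Section Roots.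
Variable N : nat.
Hypothesis N_gt0 : (0 < N)%N.

Let NC0 : (N%:R : C) != 0. Proof. by rewrite pnatr_eq0 -lt0n. Qed.

Lemma epi_root_eq1 (k : nat) : epi (k%:R * (2 / N%:R) : C) = 1 <-> (N %| k)%N.
Proof.
split=> [/epi_eq1 [n e]|/dvdnP[m ->]]; last first.
  by rewrite natrM (_ : _ * _ = 2 * m%:~R) ?epi_even //; field.
have {}e : (k%:R : C) = (n * N%:Z)%:~R.
  have h2 : 2 / N%:R != 0 :> C by rewrite mulf_neq0 ?invr_eq0 ?pnatr_eq0 // -lt0n.
  by apply: (mulIf h2); rewrite e rmorphM /=; field.
have : k%:Z = n * N%:Z by apply/eqP; rewrite -(eqr_int C) -e.
case: n {e} => n; last by lia.
by move=> [->]; exact: dvdn_mull.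
Qed.

Lemma prim_root_epi : N.-primitive_root (epi (2 / N%:R : C)).
Proof.
apply/andP; split => //; apply/forallP => i; apply/eqP.
rewrite unity_rootE -epiMn; apply/eqP/eqP => [/epi_root_eq1 h|->]; last by apply/epi_root_eq1.
by apply/eqP; rewrite eqn_leq ltn_ord dvdn_leq.
Qed.

Lemma prim_rootV (w : C) : N.-primitive_root w -> N.-primitive_root (w^-1).
Proof.
move=> /andP[_ /forallP h]; apply/andP; split => //; apply/forallP => i.
by rewrite unity_rootE exprVn invr_eq1 -unity_rootE h.
Qed.

Lemma prod_root (w X : C) : N.-primitive_root w -> \prod_(b < N) (1 - X * w ^+ b) = 1 - X ^+ N.
Proof.
move=> hw; have [->|X0] := eqVneq X 0.
  by rewrite expr0n gtn_eqF // subr0 big1 // => i _; rewrite mul0r subr0.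
have := congr1 (fun P => P.[X^-1]) (factor_Xn_sub_1 hw).
rewrite horner_prod big_mkord -polyC1 hornerD hornerN hornerXn hornerC => e.
apply: (mulfI (expf_neq0 N (invr_neq0 X0))).
rewrite mulrBr mulr1 -exprMn mulVf // expr1n -e -{1}[N in _ ^+ N]card_ord -prodr_const -big_split /=.
by apply: eq_bigr => b _; rewrite hornerXsubC; field.
Qed.

(** The N^2 products regroup by (1 - X) (1 - w X) ... (1 - w^(N-1) X) = 1 - X^N and by writing
    every exponent uniquely as n N + a with a < N. *)
Lemma qpoch_prod (s w z : C) : md s < 1 -> N.-primitive_root w ->
  \prod_(a < N) \prod_(b < N) qpoch (z * s ^+ a * w ^+ b) (s ^+ N) = qpoch (z ^+ N) (s ^+ N).
Proof.
move=> s1 hw; have sN1 : md (s ^+ N) < 1 by rewrite modulusX exprn_ilt1 // -lt0n.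
pose T y K : C := \prod_(n < K) (1 - y * (s ^+ N) ^+ n).
have lim : (fun K => \prod_(a < N) \prod_(b < N) T (z * s ^+ a * w ^+ b) K : C^o) @ \oo -->
   (\prod_(a < N) \prod_(b < N) qpoch (z * s ^+ a * w ^+ b) (s ^+ N) : C^o).
  have gen (I : Type) (l : seq I) (f : I -> nat -> C) (g : I -> C) :
      (forall i, (f i : nat -> C^o) @ \oo --> (g i : C^o)) ->
      (fun K => \prod_(i <- l) f i K : C^o) @ \oo --> (\prod_(i <- l) g i : C^o).
    move=> h; elim: l => [|i l IH].
      by rewrite big_nil; under eq_fun do rewrite big_nil; exact: cvg_seq_cst.
    rewrite big_cons; under eq_fun do rewrite big_cons.
    by apply: cvg_seqM; [exact: h | exact: IH].
  apply: (gen _ (index_enum 'I_N) (fun (a : 'I_N) K => \prod_(b < N) T (z * s ^+ a * w ^+ b) K)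
    (fun a => \prod_(b < N) qpoch (z * s ^+ a * w ^+ b) (s ^+ N))) => a.
  apply: (gen _ (index_enum 'I_N) (fun (b : 'I_N) K => T (z * s ^+ a * w ^+ b) K)
    (fun b => qpoch (z * s ^+ a * w ^+ b) (s ^+ N))) => b; exact: qpoch_cvg.
apply: (@cvg_uniq R nat \oo _ _ _ _ lim).
have nest (F : nat -> C) K : \prod_(n < K) \prod_(a < N) F (n * N + a)%N = \prod_(m < K * N) F m.
  elim: K => [|K IH]; first by rewrite !big_ord0.
  by rewrite big_ord_recr /= IH mulSn addnC big_split_ord.
rewrite (_ : (fun K => _) = (fun K => \prod_(n < K * N) (1 - z ^+ N * (s ^+ N) ^+ n))); last first.
  apply/funext => K; under eq_bigr => a _ do rewrite /T exchange_big.
  rewrite exchange_big /= -(nest (fun m => 1 - z ^+ N * (s ^+ N) ^+ m)); apply: eq_bigr => n _; apply: eq_bigr => a _.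
  rewrite (_ : z ^+ N * _ = (z * s ^+ a * (s ^+ N) ^+ n) ^+ N).
    by rewrite -(prod_root _ hw); apply: eq_bigr => b _; congr (1 - _); ring.
  by rewrite !exprMn -!exprM -mulrA -exprD; congr (_ * _ ^+ _); nia.
apply/(@cvg_modulusP R nat \oo) => e e0.
have [n0 _ hn0] := (@cvg_modulusP R nat \oo _ _ _).1 (@qpoch_cvg _ (z ^+ N) _ sN1) e e0.
near=> K; apply: (hn0 (K * N)%N) => /=.
by apply: leq_trans (_ : (K <= K * N)%N); [near: K; exact: nbhs_infty_ge | exact: leq_pmulr].
Unshelve. all: by end_near. Qed.
End Roots.

Section QuasiPeriods.
Variable tau : C.
Hypothesis tau_gt0 : 0 < complex.Im tau.
Local Notation f := (th tau).
Local Notation p := (epi (2 * tau)).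

Lemma nome_lt1 : md p < 1.
Proof.
rewrite modulus_epi expR_lt1 oppr_lt0 mulr_gt0 ?pi_gt0 //.
rewrite -(rmorph_nat (real_complex R) 2); case: (tau) tau_gt0 => a b /= b0.
by rewrite mul0r addr0 mulr_gt0.
Qed.

(** The triple product at - x: the expression in e^(2 i pi x) is the one that
    matches the products of the prefactor. *)
Lemma th_Theta x : f x = - epi (tau / 4 + 2^-1 - x) * Theta p (epi (2 * x)).
Proof.
rewrite theta_product // (epiN (2 * x)) (ThetaV nome_lt1 (epi_neq0 _)) mulrN mulrA -epiN -epiD mulNr.
by congr (- (epi _ * _)); ring.
Qed.

Lemma thN x : f (- x) = - f x.
Proof.
rewrite theta_product // th_Theta mulNr opprK.
by congr (epi _ * Theta _ (epi _)); ring.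
Qed.

Lemma th0 : f 0 = 0.
Proof. by have := thN 0; rewrite oppr0 => /eqP; rewrite -addr_eq0 -mulr2n mulrn_eq0 => /eqP. Qed.

Lemma th_add1 x : f (x + 1) = - f x.
Proof.
rewrite !th_Theta opprD addrA epiB epi1 mulrDr mulr1 (epiD (2 * x)) epi2 mulr1.
by rewrite invrN1 mulrN1 opprK mulNr opprK.
Qed.

Lemma th_addtau x : f (x + tau) = - epi (- tau - 2 * x) * f x.
Proof.
rewrite !th_Theta mulrDr (epiD (2 * x)) [epi (2 * x) * _]mulrC (Theta_shift (epi_neq0 _) nome_lt1 (epi_neq0 _)) -epiN.
have e : epi (tau / 4 + 2^-1 - (x + tau)) * epi (- (2 * x)) =
    epi (- tau - 2 * x) * epi (tau / 4 + 2^-1 - x) by rewrite -!epiD; congr epi; ring.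
transitivity (epi (tau / 4 + 2^-1 - (x + tau)) * epi (- (2 * x)) * Theta p (epi (2 * x))); first by ring.
by rewrite e; ring.
Qed.

Lemma th_add_lattice x (m n : int) :
  f (x + m%:~R + n%:~R * tau) = epi (m%:~R + n%:~R - n%:~R ^+ 2 * tau - 2 * n%:~R * x) * f x.
Proof.
have addm (k : nat) y : f (y + k%:R) = epi k%:R * f y.
  elim: k y => [|k IH] y; first by rewrite addr0 epi0 mul1r.
  by rewrite -natr1 addrA th_add1 IH epiD epi1; ring.
have addn (k : nat) y : f (y + k%:R * tau) = epi (k%:R - k%:R ^+ 2 * tau - 2 * k%:R * y) * f y.
  elim: k y => [|k IH] y; first by rewrite !(mul0r, mulr0, addr0, expr0n, subr0) epi0 mul1r.
  rewrite (_ : y + k.+1%:R * tau = (y + k%:R * tau) + tau); last by rewrite -natr1; ring.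
  rewrite th_addtau IH mulrA; congr (_ * _).
  by rewrite mulNr -epiD -[LHS]mulN1r -epi1 -epiD -natr1; congr epi; ring.
have addmz (k : int) y : f (y + k%:~R) = epi k%:~R * f y.
  case: k => k; first exact: addm.
  rewrite NegzE rmorphN /=; have := addm k.+1 (y - k.+1%:R); rewrite subrK => ->.
  by rewrite mulrA -epiD addNr epi0 mul1r.
have addnz (k : int) y : f (y + k%:~R * tau) = epi (k%:~R - k%:~R ^+ 2 * tau - 2 * k%:~R * y) * f y.
  case: k => k; first exact: addn.
  rewrite NegzE rmorphN /= mulNr; have := addn k.+1 (y - k.+1%:R * tau); rewrite subrK => ->.
  rewrite mulrA -epiD; set w := (X in epi X); have -> : w = 0 by rewrite /w; ring.
  by rewrite epi0 mul1r.
rewrite addnz addmz mulrA -epiD; congr (_ * _).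
rewrite -[LHS](epi_addn _ (m * n)); congr epi.
by rewrite rmorphM /=; ring.
Qed.

Definition lattice (x : C) := exists m n : int, x = m%:~R + n%:~R * tau.

Lemma th_eq0 x : f x = 0 <-> lattice x.
Proof.
split=> [|[m [n ->]]]; last first.
  by have := th_add_lattice 0 m n; rewrite add0r th0 mulr0.
move/eqP; rewrite th_Theta mulf_eq0 oppr_eq0 (negbTE (epi_neq0 _)) /= => /eqP h.
have [n e] : exists n : int, epi (2 * x) = p ^ n.
  apply: contrapT => hn; move/eqP: h; apply/negP.
  apply: (Theta_neq0 (epi_neq0 _) nome_lt1 (epi_neq0 _)) => n; apply/eqP => e; by apply: hn; exists n.
have /epi_eq1 [m hm] : epi (2 * x - n%:~R * (2 * tau)) = 1.
  by rewrite epiB epiMz -e divff // epi_neq0.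
exists m, n; apply: (mulfI (_ : 2 != 0 :> C)); first by rewrite pnatr_eq0.
by rewrite mulrDr -hm; ring.
Qed.

Lemma ccont_th x : ccont f x.
Proof.
rewrite (_ : th tau = fun x => - epi (tau / 4 + 2^-1 - x) * Theta p (epi (2 * x))); last first.
  by apply/funext => y; rewrite th_Theta.
apply: ccontM.
  apply: ccontN; apply: (@ccont_comp R (fun y => tau / 4 + 2^-1 - y)); last exact: ccont_epi.
  by apply: ccontD; [exact: ccont_cst | apply: ccontN; exact: ccont_id].
apply: (@ccont_comp R (fun y => epi (2 * y))); last by apply: ccont_Theta; [exact: nome_lt1 | exact: epi_neq0].
apply: (@ccont_comp R (fun y => 2 * y)); last exact: ccont_epi.
by apply: ccontM; [exact: ccont_cst | exact: ccont_id].
Qed.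

(** Completing the square in the exponent of the general term. *)
Lemma theta_shift (a b x : C) :
  theta (2^-1 + a) (2^-1 + b) x tau = epi (a ^+ 2 * tau + 2 * a * (x + 2^-1 + b)) * f (x + a * tau + b).
Proof.
have [h _] := gterm_hsum 2^-1 (x + a * tau + b + 2^-1) tau_gt0.
rewrite thE; apply: (hsum_uniq _ (hsumZ _ h)).
have hz := hsumZ (epi (a ^+ 2 * tau + 2 * a * (x + 2^-1 + b))) h.
rewrite /theta (_ : (fun m : int => _) = (fun i => epi (a ^+ 2 * tau + 2 * a * (x + 2^-1 + b)) * gterm 2^-1 tau (x + a * tau + b + 2^-1) i)); last first.
  by apply/funext => m; rewrite /gterm -epiD -half_real; congr epi; field.
have [c hc] := gterm_le 2^-1 (x + a * tau + b + 2^-1) tau_gt0.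
apply: (@hsum_sumZ R _ (md (epi (a ^+ 2 * tau + 2 * a * (x + 2^-1 + b))) * c) (expR (-1)) _ _ _).1.
- exact: expR_ge0.
- by rewrite expR_lt1 ltrN10.
- by move=> n; rewrite /= modulusM -[leRHS]mulrA; apply: ler_wpM2l (hc n).
Qed.

End QuasiPeriods.
End ThetaToolkit.

(** * Three-term identities and partial fractions *)

Section EllipticIdentities.
Variable R : realType.
Local Notation C := R[i].
Local Notation md := (@modulus R).
Variable tau : C.
Hypothesis tau_gt0 : 0 < complex.Im tau.
Local Notation f := (th tau).

(** The Weierstrass relation in the variables where it separates the poles in
    a and b of a product of two theta quotients. *)
Lemma fay (x y a b : C) :
  f (x + a) * f (y + b) * (f (x - y) * f (a + b)) =
  f (x + (a + b)) * f a * (f y * f (x - y - b)) + f (y + (a + b)) * f (x - y + a) * (f x * f b).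
Proof.
have := th_weierstrass tau_gt0 ((x + a + a + b) / 2) ((x - b) / 2) ((x + b) / 2) ((y + y + b - x) / 2).
rewrite (_ : (x + a + a + b) / 2 + (x - b) / 2 = x + a); last by field.
rewrite (_ : (x + a + a + b) / 2 - (x - b) / 2 = a + b); last by field.
rewrite (_ : (x + b) / 2 + (y + y + b - x) / 2 = y + b); last by field.
rewrite (_ : (x + b) / 2 - (y + y + b - x) / 2 = x - y); last by field.
rewrite (_ : (x + a + a + b) / 2 + (x + b) / 2 = x + (a + b)); last by field.
rewrite (_ : (x + a + a + b) / 2 - (x + b) / 2 = a); last by field.
rewrite (_ : (x - b) / 2 + (y + y + b - x) / 2 = y); last by field.
rewrite (_ : (x - b) / 2 - (y + y + b - x) / 2 = x - y - b); last by field.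
rewrite (_ : (x + a + a + b) / 2 + (y + y + b - x) / 2 = y + (a + b)); last by field.
rewrite (_ : (x + a + a + b) / 2 - (y + y + b - x) / 2 = x - y + a); last by field.
rewrite (_ : (x - b) / 2 + (x + b) / 2 = x); last by field.
rewrite (_ : (x - b) / 2 - (x + b) / 2 = - b); last by field.
rewrite (thN tau_gt0 b) => e; apply/eqP; rewrite -subr_eq0; apply/eqP; rewrite -[RHS]e; ring.
Qed.

(** The expansion into partial fractions of a product with two poles; this is
    the induction step for any number of poles. *)
Lemma partial_fractions2 (x y a' t s : C) :
  f (x - y + s) * f (x - a' + t) * (f (y - a') * f (s + t)) =
  f (y - a' + t) * f s * (f (x - a') * f (x - y + (s + t))) -
  f (a' - y + s) * f t * (f (x - y) * f (x - a' + (s + t))).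
Proof.
have := th_weierstrass tau_gt0 ((x - y + s + s + t) / 2) ((x - y - t) / 2) ((x + t - y) / 2) ((x - a' + t - a' + y) / 2).
rewrite (_ : (x - y + s + s + t) / 2 + (x - y - t) / 2 = x - y + s); last by field.
rewrite (_ : (x - y + s + s + t) / 2 - (x - y - t) / 2 = s + t); last by field.
rewrite (_ : (x + t - y) / 2 + (x - a' + t - a' + y) / 2 = x - a' + t); last by field.
rewrite (_ : (x + t - y) / 2 - (x - a' + t - a' + y) / 2 = - (y - a')); last by field.
rewrite (_ : (x - y + s + s + t) / 2 + (x + t - y) / 2 = x - y + (s + t)); last by field.
rewrite (_ : (x - y + s + s + t) / 2 - (x + t - y) / 2 = s); last by field.
rewrite (_ : (x - y - t) / 2 + (x - a' + t - a' + y) / 2 = x - a'); last by field.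
rewrite (_ : (x - y - t) / 2 - (x - a' + t - a' + y) / 2 = - (y - a' + t)); last by field.
rewrite (_ : (x - y + s + s + t) / 2 + (x - a' + t - a' + y) / 2 = x - a' + (s + t)); last by field.
rewrite (_ : (x - y + s + s + t) / 2 - (x - a' + t - a' + y) / 2 = a' - y + s); last by field.
rewrite (_ : (x - y - t) / 2 + (x + t - y) / 2 = x - y); last by field.
rewrite (_ : (x - y - t) / 2 - (x + t - y) / 2 = - t); last by field.
rewrite !(thN tau_gt0) => e; apply/eqP; rewrite -subr_eq0; apply/eqP; rewrite -[RHS]oppr0 -[in RHS]e; ring.
Qed.

Section Quotient.
Variable t : C.
Definition phi u := f (u + t) / f u.
(** Coefficient of 1 / f(x - y) in the product over the points z of l of phi(x - z). *)
Definition residue (l : seq C) y := f t * \prod_(z <- l | z != y) phi (y - z).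

(** Induction on the number of poles: the factor of the new pole a' is multiplied
    into every partial fraction of the others, where it produces a term at
    the old pole and a term at a'; the latter add up, by the induction
    hypothesis at x = a', to the residue at a'. *)
Lemma partial_fractions (l : seq C) x : l != [::] -> uniq l ->
  (forall k, (0 < k <= size l)%N -> f (k%:R * t) != 0) ->
  {in l &, forall y z, y != z -> f (y - z) != 0} -> {in l, forall y, f (x - y) != 0} ->
  \prod_(y <- l) phi (x - y) =
  \sum_(y <- l) residue l y * (f (x - y + (size l)%:R * t) / (f (x - y) * f ((size l)%:R * t))).
Proof.
case: l => // a0 l _; elim: l a0 x => [|a1 l IH] a' x.
  move=> _ ht _ hx; rewrite !big_seq1 /= mul1r /residue big_cons big_nil eqxx /= mulr1.
  have h1 := hx a'; have h2 := ht 1%N; rewrite mul1r in h2.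
  rewrite /phi; field; by rewrite h1 ?mem_head // h2.
set l' := a1 :: l in IH *; move=> /[dup] ul /andP[al ul'] ht hd hx.
have sz : size (a' :: l') = (size l').+1 by [].
have hn0 : f ((size l')%:R * t) != 0 by apply: ht; rewrite /= leqnSn.
have hn1 : f ((size l').+1%:R * t) != 0 by apply: ht; rewrite /= leqnn.
set n := size l' in sz hn0 hn1.
have IHx u : {in l', forall y, f (u - y) != 0} -> \prod_(y <- l') phi (u - y) =
    \sum_(y <- l') residue l' y * (f (u - y + n%:R * t) / (f (u - y) * f (n%:R * t))).
  move=> hu; apply: IH => //.
    by move=> k /andP[k0 k1]; apply: ht; rewrite k0 /= (leq_trans k1).
  by move=> y z yl zl; apply: hd; rewrite inE ?yl ?zl orbT.
have hx' : f (x - a') != 0 by apply: hx; rewrite mem_head.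
have hxl y : y \in l' -> f (x - y) != 0 by move=> yl; apply: hx; rewrite inE yl orbT.
have ha y : y \in l' -> f (a' - y) != 0.
  move=> yl; apply: hd; [exact: mem_head | by rewrite inE yl orbT |].
  by apply/eqP => e; move: al; rewrite e yl.
have ha' y : y \in l' -> f (y - a') != 0.
  by move=> yl; rewrite -opprB thN // oppr_eq0 ha.
rewrite big_cons IHx; last by move=> y /hxl.
rewrite [in RHS]big_cons sz.
have -> : residue (a' :: l') a' = f t * \prod_(y <- l') phi (a' - y).
  rewrite /residue big_cons eqxx /=; congr (_ * _); rewrite big_seq_cond [RHS]big_seq_cond.
  apply: eq_bigl => z; rewrite andbT; case: (boolP (z \in l')) => //= zl.
  by apply/eqP => e; move: al; rewrite -e zl.
rewrite IHx; last by move=> y /ha.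
rewrite !mulr_sumr mulr_suml -big_split /= !big_seq; apply: eq_bigr => y yl.
have -> : residue (a' :: l') y = residue l' y * phi (y - a').
  rewrite /residue big_cons ifT; last by apply/eqP => e; move: al; rewrite e yl.
  by rewrite mulrCA mulrC.
have := partial_fractions2 x y a' t (n%:R * t).
rewrite (_ : n%:R * t + t = n.+1%:R * t); last by rewrite -natr1; ring.
rewrite /phi; have := ha' _ yl; rewrite -(opprB a' y) thN // oppr_eq0.
move: (hxl _ yl) => {IHx IH ht hd hx ul al ul'}.
set u1 := f (x - y + n%:R * t); set u2 := f (x - a' + t); set u3 := f (a' - y); set u4 := f (n.+1%:R * t).
set u5 := f (- _ + t); set u6 := f (n%:R * t); set u7 := f (x - a'); set u8 := f (x - y + n.+1%:R * t).
set u9 := f (a' - y + _); set v1 := f t; set v2 := f (x - y); set v3 := f (x - a' + _).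
move=> h2 h3 e.
have -> : u2 / u7 * (residue l' y * (u1 / (v2 * u6))) = (u1 * u2 * (- u3 * u4)) * (residue l' y / (u7 * v2 * u6 * - u3 * u4)).
  field; by rewrite hn1 h3 hn0 h2 hx'.
by rewrite e; field; rewrite hn1 h3 hn0 h2 hx'.
Qed.

End Quotient.
End EllipticIdentities.

(** * Products over torsion points *)

Section PeriodicBig.
Variables (N : nat) (T : Type) (idx : T) (op : Monoid.com_law idx).

Lemma big_periodic_shift (g : int -> T) (k : int) : (forall x, g (x + N%:Z) = g x) ->
  \big[op/idx]_(a < N) g (a%:Z + k) = \big[op/idx]_(a < N) g a%:Z.
Proof.
case: N => [|n] hg; first by rewrite !big_ord0.
have step (j : int) : \big[op/idx]_(a < n.+1) g (a%:Z + (j + 1)) = \big[op/idx]_(a < n.+1) g (a%:Z + j).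
  rewrite big_ord_recr /= [in RHS]big_ord_recl Monoid.mulmC; congr (op _ _).
    by rewrite -[RHS]hg; congr g => /=; lia.
  by apply: eq_bigr => i _; rewrite lift0; congr g; lia.
elim/int_ind: k => [|k IH|k IH].
- by apply: eq_bigr => i _; rewrite addr0.
- by rewrite -IH -[RHS]step; apply: eq_bigr => i _; congr g; lia.
- by rewrite -IH -[LHS]step; apply: eq_bigr => i _; congr g; lia.
Qed.
End PeriodicBig.

Section Torsion.
Variable R : realType.
Local Notation C := R[i].
Local Notation md := (@modulus R).
Variable tau : C.
Hypothesis tau_gt0 : 0 < complex.Im tau.
Local Notation f := (th tau).
Local Notation p := (epi (2 * tau)).
Variable N : nat.
Hypothesis N_gt0 : (0 < N)%N.
Local Notation NC := (N%:R : C).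

Let NC0 : NC != 0. Proof. by rewrite pnatr_eq0 -lt0n. Qed.

(** For 0 <= x, y < N these represent the N-torsion points of the elliptic curve;
    arbitrary integers keep the indices closed under addition. *)
Definition torsion (x y : int) : C := (x%:~R * tau + y%:~R) / NC.
Local Notation I2 := ('I_N * 'I_N)%type.
Definition torsionI (al : I2) : C := torsion al.1 al.2.

Lemma torsB x y x' y' : torsion x y - torsion x' y' = torsion (x - x') (y - y').
Proof. by rewrite /torsion !rmorphB /=; field. Qed.

Lemma tors_add1 x y : torsion x (y + N%:Z) = torsion x y + 1.
Proof. by rewrite /torsion rmorphD /=; field. Qed.

Lemma tors_addtau x y : torsion (x + N%:Z) y = torsion x y + tau.
Proof. by rewrite /torsion rmorphD /=; field. Qed.

Lemma lattice_tors x y : lattice tau (torsion x y) <-> ((N%:Z %| x) && (N%:Z %| y))%Z.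
Proof.
split=> [[m [n e]]|/andP[/dvdzP[k ->] /dvdzP[l ->]]]; last first.
  by exists l, k; rewrite /torsion !rmorphM /=; field.
have {}e : (x - n * N%:Z)%:~R * tau = (m * N%:Z - y)%:~R.
  have {}e : x%:~R * tau + y%:~R = (m%:~R + n%:~R * tau) * NC by rewrite -e /torsion divfK.
  by rewrite !rmorphB !rmorphM /=; apply/eqP; rewrite -subr_eq0; apply/eqP; move/eqP: e; rewrite -subr_eq0 => /eqP e; rewrite -[RHS]e; ring.
have hx : x - n * N%:Z = 0.
  have : complex.Im ((x - n * N%:Z)%:~R * tau) = (x - n * N%:Z)%:~R * complex.Im tau.
    rewrite -(rmorph_int (real_complex R)); case: (tau) => a b /=; by rewrite mul0r addr0.
  rewrite e -(rmorph_int (real_complex R)) /= => /esym /eqP; rewrite mulf_eq0 (gt_eqF tau_gt0) orbF.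
  by rewrite intr_eq0 => /eqP.
move: e; rewrite hx mul0r => /esym /eqP; rewrite intr_eq0 => /eqP hy.
apply/andP; split; apply/dvdzP; [exists n | exists m]; lia.
Qed.

Lemma torsI_eq (al be : I2) : f (torsionI al - torsionI be) = 0 <-> al = be.
Proof.
rewrite th_eq0 // /torsionI torsB lattice_tors; case: al be => [a b] [c d] /=; split.
  move=> /andP[/dvdzP[k hk] /dvdzP[l hl]]; have := ltn_ord a; have := ltn_ord b; have := ltn_ord c; have := ltn_ord d => h1 h2 h3 h4.
  congr (_, _); apply: val_inj => /=.
    have : k = 0 by nia.
    by move=> k0; rewrite k0 in hk; lia.
  have : l = 0 by nia.
  by move=> l0; rewrite l0 in hl; lia.
by move=> [-> ->]; rewrite !subrr !dvdz0.
Qed.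

Definition zero_idx : I2 := (Ordinal N_gt0, Ordinal N_gt0).
Lemma tors_zero_idx : torsionI zero_idx = 0.
Proof. by rewrite /torsionI /torsion /= mul0r addr0 mul0r. Qed.

Lemma torsI_neq0 al : al != zero_idx -> f (torsionI al) != 0.
Proof. by move=> h; apply: contra h => /eqP e; apply/eqP/torsI_eq; rewrite tors_zero_idx subr0. Qed.

Lemma phi_lattice t u (m n : int) : phi tau t (u + m%:~R + n%:~R * tau) = epi (- (2 * n%:~R * t)) * phi tau t u.
Proof.
rewrite /phi (_ : u + m%:~R + n%:~R * tau + t = (u + t) + m%:~R + n%:~R * tau); last by ring.
rewrite !th_add_lattice // invfM mulrACA -epiN -epiD; congr (epi _ * _); ring.
Qed.

(** Both sides have the same zeros; the triple product turns this into an identity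
    of Pochhammer symbols, as e^(2 i pi w) runs over s^a om^b with s^N = p and
    om a primitive N-th root of unity. *)
Lemma prod_tors : exists2 ka : C, ka != 0 & forall u,
  \prod_(al : I2) f (u + torsionI al) = ka * epi (- ((NC ^+ 2 - NC) * u)) * f (NC * u).
Proof.
pose s : C := epi (2 * (tau / NC)); pose om : C := epi (2 / NC).
have sN : s ^+ N = p by rewrite -epiMn; congr epi; field.
have sN0 := sN; have p1 := nome_lt1 tau_gt0.
have s1 : md s < 1.
  rewrite ltNge; apply/negP => h; move: p1; rewrite -sN modulusX ltNge => /negP; apply.
  exact: exprn_ege1.
have homr := prim_root_epi R N_gt0; have homV := prim_rootV N_gt0 homr.
pose P := qpoch p p; have P0 : P != 0 by exact: qpoch_pp_neq0.
pose c (al : I2) : C := - epi (tau / 4 + 2^-1 - torsionI al).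
exists ((\prod_al c al) * P ^+ (N * N) / (- epi (tau / 4 + 2^-1) * P)).
  rewrite !mulf_neq0 ?invr_eq0 ?expf_neq0 ?mulf_neq0 ?oppr_eq0 ?epi_neq0 //.
  by apply/prodf_neq0 => al _; rewrite oppr_eq0 epi_neq0.
move=> u; pose z : C := epi (2 * u).
have zN : epi (2 * (NC * u)) = z ^+ N by rewrite -epiMn; congr epi; ring.
have eT (al : I2) : f (u + torsionI al) = c al * epi (- u) * P *
    qpoch (z * s ^+ al.1 * om ^+ al.2) p * qpoch (p / (z * s ^+ al.1 * om ^+ al.2)) p.
  rewrite th_Theta // /Theta /c (_ : epi (2 * (u + torsionI al)) = z * s ^+ al.1 * om ^+ al.2); last first.
    by rewrite -!epiMn -!epiD; congr epi; rewrite /torsionI /torsion /=; field.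
  rewrite (_ : tau / 4 + 2^-1 - (u + torsionI al) = (tau / 4 + 2^-1 - torsionI al) - u); last by ring.
  by rewrite epiD /P; ring.
rewrite (eq_bigr _ (fun al _ => eT al)).
rewrite 4!big_split /= !prodr_const card_prod !card_ord.
have -> : \prod_(al : I2) qpoch (z * s ^+ al.1 * om ^+ al.2) p = qpoch (z ^+ N) p.
  by rewrite -sN -(qpoch_prod N_gt0 z s1 homr) pair_big.
have -> : \prod_(al : I2) qpoch (p / (z * s ^+ al.1 * om ^+ al.2)) p = qpoch (p / z ^+ N) p.
  have -> : p / z ^+ N = (s / z) ^+ N by rewrite expr_div_n sN.
  rewrite -sN -(qpoch_prod N_gt0 (s / z) s1 homV) (reindex_inj rev_ord_inj) /= pair_big /=.
  apply: eq_bigr => -[a b] _ /=; move: (s ^+ N) sN => sN' sN.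
  suff -> : sN' / (z * s ^+ a * om ^+ b) = s / z * s ^+ (N - a.+1) * om^-1 ^+ b by [].
  rewrite sN -sN0 (_ : s ^+ N = s * s ^+ (N - a.+1) * s ^+ a); last first.
    by rewrite -exprS -exprD; congr (_ ^+ _); have := ltn_ord a; lia.
  rewrite exprVn; field; by rewrite !expf_neq0 ?epi_neq0.
rewrite th_Theta // /Theta zN -/P.
rewrite (_ : tau / 4 + 2^-1 - NC * u = (tau / 4 + 2^-1) - NC * u); last by ring.
rewrite (epiD _ (- (NC * u))).
have e : epi (- u) ^+ (N * N) = epi (- ((NC ^+ 2 - NC) * u)) * epi (- (NC * u)).
  by rewrite -epiMn -epiD natrM; congr epi; ring.
rewrite e; move: (epi_neq0 (tau / 4 + 2^-1)) => E0; field; by rewrite E0 P0.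
Qed.

End Torsion.

Section TorsionSum.
Variable R : realType.
Local Notation C := R[i].
Local Notation md := (@modulus R).
Variable tau : C.
Hypothesis tau_gt0 : 0 < complex.Im tau.
Local Notation f := (th tau).
Variable N : nat.
Hypothesis N_gt0 : (0 < N)%N.
Local Notation NC := (N%:R : C).
Local Notation I2 := ('I_N * 'I_N)%type.
Local Notation tors := (torsion tau N).
Local Notation torsI := (@torsionI R tau N).
Local Notation zero_idx := (zero_idx N_gt0).
Local Notation phi := (phi tau).

Let NC0 : NC != 0. Proof. by rewrite pnatr_eq0 -lt0n. Qed.

Lemma ccont_prod (I : Type) (l : seq I) (P : pred I) (F : I -> C -> C) w :
  (forall i, ccont (F i) w) -> ccont (fun u => \prod_(i <- l | P i) F i u) w.
Proof.
move=> h; elim: l => [|i l IH].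
  rewrite (_ : (fun u => _) = fun=> 1); first exact: ccont_cst.
  by apply/funext => u; rewrite big_nil.
case Pi: (P i).
  rewrite (_ : (fun u => _) = fun u => F i u * \prod_(i <- l | P i) F i u); first by apply: ccontM; [exact: h | exact: IH].
  by apply/funext => u; rewrite big_cons Pi.
rewrite (_ : (fun u => _) = fun u => \prod_(i <- l | P i) F i u) //.
by apply/funext => u; rewrite big_cons Pi.
Qed.

Lemma ccont_sum (I : Type) (l : seq I) (P : pred I) (F : I -> C -> C) w :
  (forall i, ccont (F i) w) -> ccont (fun u => \sum_(i <- l | P i) F i u) w.
Proof.
move=> h; elim: l => [|i l IH].
  rewrite (_ : (fun u => _) = fun=> 0); first exact: ccont_cst.
  by apply/funext => u; rewrite big_nil.
case Pi: (P i).
  rewrite (_ : (fun u => _) = fun u => F i u + \sum_(i <- l | P i) F i u); first by apply: ccontD; [exact: h | exact: IH].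
  by apply/funext => u; rewrite big_cons Pi.
rewrite (_ : (fun u => _) = fun u => \sum_(i <- l | P i) F i u) //.
by apply/funext => u; rewrite big_cons Pi.
Qed.

Lemma ccont_lin (a b : C) w : ccont (fun u => a * u + b) w.
Proof.
apply: ccontD; last exact: ccont_cst.
by apply: ccontM; [exact: ccont_cst | exact: ccont_id].
Qed.

Lemma ccont_th_lin (a b : C) w : ccont (fun u => f (a * u + b)) w.
Proof. apply: (@ccont_comp R (fun u => a * u + b)); [exact: ccont_lin | exact: ccont_th]. Qed.

Lemma ccont_epi_lin (a : C) w : ccont (fun u => epi (a * u)) w.
Proof.
apply: (@ccont_comp R (fun u => a * u)); last exact: ccont_epi.
by apply: ccontM; [exact: ccont_cst | exact: ccont_id].
Qed.

(** The quotient g(u) = f(N u) / f(u), given as a product so that it is defined and continuous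
    at the zeros of f as well. The last two clauses evaluate the products of theta
    quotients that appear in the partial fraction expansion over all
    torsion points: the product itself and its residue at 0. *)
Lemma th_mulN : exists g : C -> C, [/\ forall w, ccont g w, g 0 != 0,
  forall u, f (NC * u) = g u * f u,
  forall h t, (forall al, f (h + torsI al) != 0) -> f (NC * h) != 0 /\
   \prod_(al : I2) phi t (h + torsI al) = epi (- ((NC ^+ 2 - NC) * t)) * f (NC * (h + t)) / f (NC * h) &
  forall t, f t * \prod_(al | al != zero_idx) phi t (torsI al) = epi (- ((NC ^+ 2 - NC) * t)) * f (NC * t) / g 0].
Proof.
have [ka ka0 hka] := prod_tors tau_gt0 N_gt0.
(* the product of [prod_tors] without the factor f u of the zero torsion point *)
pose g u : C := (\prod_(al | al != zero_idx) f (1 * u + torsI al)) / ka * epi ((NC ^+ 2 - NC) * u).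
have fst u : f u * \prod_(al | al != zero_idx) f (torsI al + u) = ka * epi (- ((NC ^+ 2 - NC) * u)) * f (NC * u).
  rewrite -hka [RHS](bigD1 zero_idx) //= tors_zero_idx addr0; congr (_ * _); apply: eq_bigr => al _; by rewrite addrC.
have gE u : g u = (\prod_(al | al != zero_idx) f (torsI al + u)) / ka * epi ((NC ^+ 2 - NC) * u).
  by rewrite /g; congr (_ / _ * _); apply: eq_bigr => al _; rewrite mul1r addrC.
have gP u : f (NC * u) = g u * f u.
  apply: (mulfI ka0); apply: (mulfI (epi_neq0 (- ((NC ^+ 2 - NC) * u)))).
  rewrite mulrA [X in X * _]mulrC -fst gE epiN; field; by rewrite ka0 epi_neq0.
have g0 : g 0 = (\prod_(al | al != zero_idx) f (torsI al)) / ka.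
  by rewrite gE mulr0 epi0 mulr1; congr (_ / _); apply: eq_bigr => al _; rewrite addr0.
have p0 : \prod_(al | al != zero_idx) f (torsI al) != 0.
  by apply/prodf_neq0 => al h; exact: torsI_neq0 h.
exists g; split => //.
- move=> w; apply: ccontM; last exact: ccont_epi_lin.
  apply: ccontM; last exact: ccont_cst.
  by apply: ccont_prod => al; exact: ccont_th_lin.
- by rewrite g0 mulf_neq0 // invr_eq0.
- move=> h t hh; have h0 : \prod_(al : I2) f (h + torsI al) != 0 by apply/prodf_neq0.
  move: (h0); rewrite {1}hka mulf_eq0 negb_or => /andP[k1 k2]; split => //.
  rewrite prodf_div; under eq_bigr => al _ do rewrite -addrA [torsI al + t]addrC addrA.
  rewrite !hka (_ : - ((NC ^+ 2 - NC) * (h + t)) = - ((NC ^+ 2 - NC) * h) - (NC ^+ 2 - NC) * t); last by ring.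
  rewrite epiD; field; by rewrite k2 epi_neq0 ka0.
- move=> t; rewrite prodf_div mulrA fst g0; field; by rewrite p0 ka0.
Qed.

Variable t : C.

(** With the factor psi, the theta quotients depend on the torsion point modulo
    the lattice only, so the product over differences with a fixed torsion point is
    independent of that point. The exponentials that make psi periodic
    account for the prefactor. *)
Lemma residue_tors al :
  residue tau t [seq - torsI be | be <- enum {: I2}] (- torsI al) =
  epi (2 * t * NC * (al.1 : nat)%:R) * (f t * \prod_(be | be != zero_idx) phi t (torsI be)).
Proof.
pose psi (x y : int) : C := if ((N%:Z %| x) && (N%:Z %| y))%Z then 1 else epi (2 * (x%:~R / NC) * t) * phi t (tors x y).
have dN (x : int) : (N%:Z %| x + N%:Z)%Z = (N%:Z %| x)%Z by rewrite rpredDr ?dvdzz.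
have per1 x y : psi (x + N%:Z) y = psi x y.
  rewrite /psi dN; case: ifP => // _; rewrite (_ : tors (x + N%:Z) y = tors x y + 0%:~R + 1%:~R * tau); last first.
    by rewrite tors_addtau // addr0 mul1r.
  rewrite phi_lattice // mulrA -epiD rmorphD /=; congr (epi _ * _); by field.
have per2 x y : psi x (y + N%:Z) = psi x y.
  rewrite /psi dN; case: ifP => // _; rewrite (_ : tors x (y + N%:Z) = tors x y + 1%:~R + 0%:~R * tau); last first.
    by rewrite tors_add1 // mul0r addr0.
  by rewrite phi_lattice // mulr0 mul0r oppr0 epi0 mul1r.
have shift (x y : int) : \prod_(be : I2) psi (be.1%:Z + x) (be.2%:Z + y) = \prod_(be : I2) psi be.1%:Z be.2%:Z.
  rewrite -(pair_bigA _ (fun a b : 'I_N => psi (a%:Z + x) (b%:Z + y))) -(pair_bigA _ (fun a b : 'I_N => psi a%:Z b%:Z)) /=.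
  under eq_bigr => a _ do rewrite (@big_periodic_shift _ _ _ _ (fun b => psi (a%:Z + x) b)) //.
  by rewrite (@big_periodic_shift _ _ _ _ (fun a => \prod_(b < N) psi a b%:Z)) // => a; apply: eq_bigr => b _.
have eqm (be ga : I2) : ((N%:Z %| be.1%:Z - ga.1%:Z) && (N%:Z %| be.2%:Z - ga.2%:Z))%Z = (be == ga).
  apply/idP/eqP => [hm|->]; last by rewrite !subrr !dvdz0.
  apply/(torsI_eq tau_gt0 N_gt0); rewrite /torsionI torsB //; apply/(th_eq0 tau_gt0).
  exact/(lattice_tors tau_gt0 N_gt0).
have main (ga : I2) : \prod_(be | be != ga) phi t (torsI be - torsI ga) =
    epi (2 * t * NC * (ga.1 : nat)%:R) * ((\prod_(be : I2) epi (- (2 * (be.1 : nat)%:R / NC * t))) * \prod_(be : I2) psi be.1%:Z be.2%:Z).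
  rewrite -(shift (- ga.1%:Z) (- ga.2%:Z)) -big_split /=.
  have -> : epi (2 * t * NC * (ga.1 : nat)%:R) = \prod_(be : I2) epi (2 * (ga.1 : nat)%:R / NC * t).
    by rewrite prodr_const card_prod !card_ord -epiMn natrM; congr epi; field.
  rewrite -big_split /= [RHS](bigD1 ga) //= /psi eqm eqxx mulr1 -epiD.
  rewrite (_ : _ - _ = 0) ?epi0 ?mul1r; last by ring.
  apply: eq_bigr => be nbe; rewrite eqm (negbTE nbe) /torsionI torsB //.
  set e1 := epi _; set e2 := epi (- _); set e3 := epi (2 * (_ / _) * t); have h : e1 * (e2 * e3) = 1.
    by rewrite /e1 /e2 /e3 -!epiD -[RHS](@epi0 R); congr epi; rewrite rmorphB /=; field.
  by rewrite (mulrA e2) [RHS]mulrA h mul1r.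
rewrite /residue big_map big_enum_cond /= mulrCA; congr (_ * _).
have := main al; have := main zero_idx; rewrite tors_zero_idx /= mulr0 epi0 mul1r.
under eq_bigr do rewrite subr0.
move=> ->  <-; apply: eq_big => [be|be _]; last by rewrite opprK addrC.
rewrite eqr_opp; congr negb; apply/eqP/eqP => [e|-> //].
by apply/(torsI_eq tau_gt0 N_gt0); rewrite e subrr th0.
Qed.

End TorsionSum.

(** * Sums over torsion points *)

Section Master.
Variable R : realType.
Local Notation C := R[i].
Local Notation md := (@modulus R).
Variable tau : C.
Hypothesis tau_gt0 : 0 < complex.Im tau.
Local Notation f := (th tau).
Variable N : nat.
Hypothesis N_gt0 : (0 < N)%N.
Local Notation NC := (N%:R : C).
Local Notation I2 := ('I_N * 'I_N)%type.
Local Notation torsI := (@torsionI R tau N).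
Local Notation phi := (phi tau).

Let NC0 : NC != 0. Proof. by rewrite pnatr_eq0 -lt0n. Qed.

Lemma ccont_ext (F G : C -> C) w : ccont F w -> (forall x, F x = G x) -> ccont G w.
Proof. by move=> h /funext <-. Qed.

Lemma ccont_ball (F : C -> C) w e : ccont F w -> 0 < e ->
  exists2 d : R, 0 < d & forall x, md (w - x) < d -> md (F w - F x) < e.
Proof.
move=> /ccontP h e0; have /nbhs_ballP [[r r2] r0 hr] := h e e0.
move: r0; rewrite /= ltcE /= => /andP[/eqP r2E r0]; exists r => // x hx; apply: hr.
by rewrite -ball_normE /= modulusE r2E -[r +i* 0]/(r%:C) ltcR.
Qed.

(** Two zeros of f differ by a lattice point, and a nonzero m + n tau has modulus
    at least min (1, Im tau). *)
Lemma th_isolated (a b w : C) : a != 0 ->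
  exists2 e : R, 0 < e & forall x, x != w -> md (w - x) < e -> f (a * x + b) != 0.
Proof.
move=> a0; have [/(th_eq0 tau_gt0) [m [n e]]|nz] := eqVneq (f (a * w + b)) 0; last first.
  have nz0 : 0 < md (f (a * w + b)) by rewrite modulus_gt0.
  have [d d0 hd] := ccont_ball (@ccont_th_lin _ _ tau_gt0 a b w) nz0.
  exists d => // x _ /hd; apply: contraTneq => ->; by rewrite subr0 ltxx.
have a1 : 0 < md a by rewrite modulus_gt0.
exists (Num.min 1 (complex.Im tau) / md a); first by rewrite divr_gt0 // lt_min ltr01.
move=> x xw; rewrite ltr_pdivlMr // mulrC -modulusM lt_min => /andP[h1 h2].
apply/eqP => /(th_eq0 tau_gt0) [m' [n' e']].
have {e e'} e : a * (w - x) = (m - m')%:~R + (n - n')%:~R * tau.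
  by rewrite !rmorphB /= mulrBl addrACA -opprD -e -e'; ring.
have hI : complex.Im (a * (w - x)) = (n - n')%:~R * complex.Im tau.
  rewrite e -!(rmorph_int (real_complex R)); case: (tau) => u v /=; by rewrite mul0r addr0 add0r.
have int1 (k : int) : k != 0 -> 1 <= `|k%:~R| :> R.
  by move=> k0; rewrite -intr_norm -[1]/(1%:~R) ler_int -gtz0_ge1 normr_gt0.
have hn : n - n' = 0.
  apply/eqP; apply: contraT => nn; move: h2; rewrite ltNge => /negP; case.
  apply: le_trans (Im_le_modulus _); rewrite hI normrM (gtr0_norm tau_gt0).
  by apply: ler_peMl; [exact: ltW | exact: int1].
have hm : m - m' = 0.
  apply/eqP; apply: contraT => nn; move: h1; rewrite ltNge => /negP; case.
  rewrite e hn mul0r addr0 -(rmorph_int (real_complex R)) modulus_real.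
  by exact: int1.
move/eqP: e; rewrite hn hm mul0r addr0 mulf_eq0 (negbTE a0) /= subr_eq0 eq_sym.
by rewrite (negbTE xw).
Qed.

Definition single_sum h d : C := \sum_(al : I2) epi (2 * ((al.1 : nat)%:R / NC) * d) * phi d (h + torsI al).

Definition pair_sum x y h h' : C := \sum_(al : I2) epi (2 * ((al.1 : nat)%:R / NC) * (x - y)) *
  (f (x + h + torsI al) * f (y - h' - torsI al) / (f (h + torsI al) * f (- h' - torsI al))).

Definition offtors h := forall al, f (h + torsI al) != 0.

Lemma ccont_single_sum h w : ccont (single_sum h) w.
Proof.
apply: ccont_sum => al; apply: ccontM; first exact: ccont_epi_lin.
rewrite /phi; apply: ccontM; last exact: ccont_cst.
apply: (ccont_ext (@ccont_th_lin _ _ tau_gt0 1 (h + torsI al) w)) => u.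
by rewrite mul1r addrC.
Qed.

(** The partial fraction expansion with the negatives of the torsion points as
    poles, evaluated at h. The step t of the quotients is d / N^2, so that N^2 poles
    produce d. *)
Lemma single_sum_generic g h t :
  (forall h t, (forall al, f (h + torsI al) != 0) -> f (NC * h) != 0 /\
   \prod_(al : I2) phi t (h + torsI al) = epi (- ((NC ^+ 2 - NC) * t)) * f (NC * (h + t)) / f (NC * h)) ->
  (forall t, f t * \prod_(al | al != zero_idx N_gt0) phi t (torsI al) = epi (- ((NC ^+ 2 - NC) * t)) * f (NC * t) / g) ->
  g != 0 -> offtors h -> (forall k, (0 < k <= N * N)%N -> f (k%:R * t) != 0) ->
  single_sum h (NC * NC * t) * f (NC * t) * f (NC * h) = g * f (NC * NC * t) * f (NC * t + NC * h).
Proof.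
move=> hA hB g0 hh ht; pose l := [seq - torsI be | be <- enum {: I2}].
have sl : size l = (N * N)%N by rewrite size_map -cardE card_prod !card_ord.
have ht0 : f (NC * NC * t) != 0 by rewrite -natrM ht // leqnn muln_gt0 N_gt0.
have ht1 : f (NC * t) != 0 by rewrite ht // N_gt0 /= leq_pmulr.
have [hN hA1] := hA h t hh.
have := @partial_fractions R tau tau_gt0 t l h.
rewrite sl natrM => H.
have {}H : \prod_(y <- l) phi t (h - y) = \sum_(y <- l) residue tau t l y * (f (h - y + NC * NC * t) / (f (h - y) * f (NC * NC * t))).
  apply: H => //.
  - by rewrite -size_eq0 sl -lt0n muln_gt0 N_gt0.
  - rewrite map_inj_uniq ?enum_uniq // => al be e; apply/(torsI_eq tau_gt0 N_gt0).
    by move: e => /oppr_inj ->; rewrite subrr th0.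
  - move=> y z /mapP[al _ ->] /mapP[be _ ->] ne; apply/eqP; rewrite opprK addrC => /(torsI_eq tau_gt0 N_gt0) e.
    by move: ne; rewrite e eqxx.
  - by move=> y /mapP[al _ ->]; rewrite opprK.
move: H; rewrite /l big_map [in RHS]big_map !big_enum /=.
under eq_bigr do rewrite opprK.
rewrite hA1; under eq_bigr => al _ do rewrite opprK residue_tors // hB.
set E := epi (- _) => H.
have E0 : E != 0 by exact: epi_neq0.
have -> : single_sum h (NC * NC * t) = \sum_(al : I2) epi (2 * t * NC * (al.1 : nat)%:R) * (f (h + torsI al + NC * NC * t) / f (h + torsI al)).
  by apply: eq_bigr => al _; rewrite /phi; congr (epi _ * _); field.
have {}H : E * f (NC * (h + t)) / f (NC * h) = (E * f (NC * t) / g / f (NC * NC * t)) *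
    \sum_(al : I2) epi (2 * t * NC * (al.1 : nat)%:R) * (f (h + torsI al + NC * NC * t) / f (h + torsI al)).
  rewrite H mulr_sumr; apply: eq_bigr => al _; field; by rewrite (hh al) g0 ht0.
move: H; set S := \sum_al _; rewrite (mulrDr NC) addrC => H.
apply: (mulfI E0); apply: (mulIf (invr_neq0 hN)).
have -> : E * (g * f (NC * NC * t) * f (NC * t + NC * h)) / f (NC * h) =
   g * f (NC * NC * t) * (E * f (NC * t + NC * h) / f (NC * h)) by ring.
rewrite H; field; by rewrite hN g0 ht0.
Qed.

(** The expansion determines the sum for generic d; continuity extends it to all d. At
    d = 0 the sum is N^2, which yields g(0)^2 = N^2. *)
Lemma torsion_sum : exists g : C -> C, [/\ forall w, ccont g w, g 0 != 0,
  forall u, f (NC * u) = g u * f u &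
  forall h, offtors h -> [/\ f (NC * h) != 0, g 0 ^+ 2 = NC ^+ 2 &
    forall d, single_sum h d * f (d / NC) * f (NC * h) = g 0 * f d * f (d / NC + NC * h)]].
Proof.
have [g [gc g0 gN hA hB]] := th_mulN tau_gt0 N_gt0; exists g; split => // h hh.
have [hN _] := hA h 0 hh.
have formula d : single_sum h d * f (d / NC) * f (NC * h) = g 0 * f d * f (d / NC + NC * h).
  apply: (@ccont_eq_punctured R (fun d => single_sum h d * f (d / NC) * f (NC * h)) (fun d => g 0 * f d * f (d / NC + NC * h))).
  - apply: ccontM; last exact: ccont_cst; apply: ccontM; first exact: ccont_single_sum.
    apply: (ccont_ext (@ccont_th_lin _ _ tau_gt0 NC^-1 0 d)) => u.
    by rewrite addr0 mulrC.
  - apply: ccontM; first by apply: ccontM; [exact: ccont_cst | exact: ccont_th].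
    apply: (ccont_ext (@ccont_th_lin _ _ tau_gt0 NC^-1 (NC * h) d)) => u.
    by rewrite [_ * u]mulrC.
  have iso n : exists2 e : R, 0 < e & forall x, x != d -> md (d - x) < e ->
      forall k, (0 < k <= n)%N -> f (k%:R * (x / NC ^+ 2)) != 0.
    elim: n => [|n [e e0 he]]; first by exists 1 => // x _ _ k; lia.
    have c0 : n.+1%:R / NC ^+ 2 != 0 by rewrite mulf_neq0 ?invr_eq0 ?expf_neq0 // pnatr_eq0.
    have [e' e'0 he'] := th_isolated 0 d c0.
    exists (Num.min e e'); first by rewrite lt_min e0.
    move=> x xd; rewrite lt_min => /andP[h1 h2] k /andP[k0]; rewrite leq_eqVlt => /orP[/eqP ->|kn].
      by have := he' x xd h2; rewrite addr0 mulrAC -mulrA.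
    by apply: he => //; rewrite k0.
  have [e e0 he] := iso (N * N)%N; exists e => // x xd hx.
  have := single_sum_generic hA hB g0 hh (he x xd hx).
  have -> : NC * NC * (x / NC ^+ 2) = x by field.
  by have -> : NC * (x / NC ^+ 2) = x / NC by field.
split => //.
have [e e0 he] := th_isolated 0 0 (oner_neq0 C).
have : single_sum h (NC * 0) * f (NC * h) = g 0 * g 0 * f (1 * 0 + NC * h).
  apply: (@ccont_eq_punctured R (fun u => single_sum h (NC * u) * f (NC * h)) (fun u => g 0 * g u * f (1 * u + NC * h))).
  - apply: ccontM; last exact: ccont_cst; apply: (@ccont_comp R (fun u => NC * u)); last exact: ccont_single_sum.
    by apply: ccontM; [exact: ccont_cst | exact: ccont_id].
  - apply: ccontM; last exact: ccont_th_lin; apply: ccontM; [exact: ccont_cst | exact: gc].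
  exists e => // u u0 hu; have := he u u0 hu; rewrite mul1r addr0 => fu.
  apply: (mulIf fu); have e1 := formula (NC * u).
  have nu : NC * u / NC = u by field.
  by rewrite nu in e1; rewrite [LHS]mulrAC e1 gN; ring.
rewrite mul1r add0r mulr0 => /(mulIf hN).
rewrite -expr2 => <-; rewrite /single_sum (eq_bigr (fun=> 1)); last first.
  by move=> al _; rewrite mulr0 epi0 mul1r /phi addr0 divff.
by rewrite sumr_const card_prod !card_ord natrM.
Qed.

(** The three-term identity, applied to every term. *)
Lemma pair_sum_fay x y h h' : offtors h -> offtors h' ->
  f (x - y) * f (h - h') * pair_sum x y h h' =
  f x * f (y + (h - h')) * single_sum h (x - y) - f y * f (x + (h - h')) * single_sum h' (x - y).
Proof.
move=> hh hh'; rewrite /pair_sum /single_sum !mulr_sumr -sumrB; apply: eq_bigr => al _.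
have := fay tau_gt0 x y (h + torsI al) (- h' - torsI al).
rewrite (_ : h + torsI al + (- h' - torsI al) = h - h'); last by ring.
rewrite (_ : x + (h + torsI al) = x + h + torsI al); last by ring.
rewrite (_ : y + (- h' - torsI al) = y - h' - torsI al); last by ring.
rewrite (_ : x - y - (- h' - torsI al) = h' + torsI al + (x - y)); last by ring.
rewrite (_ : x - y + (h + torsI al) = h + torsI al + (x - y)); last by ring.
rewrite (_ : - h' - torsI al = - (h' + torsI al)) ?thN //; last by ring.
have := hh al; have := hh' al; rewrite /phi; set e1 := epi _.
set u1 := f (h + torsI al); set u2 := f (h' + torsI al).
set u3 := f (x + h + _); set u4 := f (y - h' - _); set u5 := f (x - y); set u6 := f (h - h').
set u7 := f (x + (h - h')); set u8 := f (y + (h - h')); set u9 := f (_ + (x - y)).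
set v1 := f (_ + (x - y)); move=> n2 n1 e.
have -> : u5 * u6 * (e1 * (u3 * u4 / (u1 * - u2))) = u3 * u4 * (u5 * u6) * (- (e1 / (u1 * u2))).
  by field; rewrite n1 n2.
by rewrite e; field; rewrite n1 n2.
Qed.

End Master.

Section Orthogonality.
Variable R : realType.
Local Notation C := R[i].
Local Notation md := (@modulus R).
Variable tau : C.
Hypothesis tau_gt0 : 0 < complex.Im tau.
Local Notation f := (th tau).
Variable N : nat.
Hypothesis N_gt0 : (0 < N)%N.
Local Notation NC := (N%:R : C).
Local Notation I2 := ('I_N * 'I_N)%type.
Local Notation torsI := (@torsionI R tau N).
Local Notation tors := (@torsion R tau N).
Local Notation offtors := (@offtors R tau N).
Local Notation Gs := (@pair_sum R tau N).

Let NC0 : NC != 0. Proof. by rewrite pnatr_eq0 -lt0n. Qed.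

Lemma ccont_th_affine (F : C -> C) (a b w : C) : (forall u, F u = a * u + b) -> ccont (fun u => f (F u)) w.
Proof. by move=> h; apply: (ccont_ext (@ccont_th_lin _ _ tau_gt0 a b w)) => u; rewrite h. Qed.

Lemma ccont_epi_affine (F : C -> C) (a b w : C) : (forall u, F u = a * u + b) -> ccont (fun u => epi (F u)) w.
Proof.
move=> h; apply: (@ccont_comp R F); last exact: ccont_epi.
by apply: (ccont_ext (@ccont_lin _ a b w)) => u; rewrite h.
Qed.

(** For x <> y modulo the lattice, combine the reduction to single sums with their
    values; the factor f(x - y) cancels, and continuity in x covers the other cases. *)
Lemma pair_sum_closed_form : exists g : C -> C, [/\ forall w, ccont g w, g 0 != 0,
  forall u, f (NC * u) = g u * f u &
  forall h h', offtors h -> offtors h' -> [/\ f (NC * h) != 0, f (NC * h') != 0, g 0 ^+ 2 = NC ^+ 2 &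
    forall x y, f (h - h') * f ((x - y) / NC) * f (NC * h) * f (NC * h') * Gs x y h h' =
      g 0 * (f x * f (y + (h - h')) * f ((x - y) / NC + NC * h) * f (NC * h')
           - f y * f (x + (h - h')) * f ((x - y) / NC + NC * h') * f (NC * h))]].
Proof.
have [g [gc g0 gN hg]] := torsion_sum tau_gt0 N_gt0; exists g; split => // h h' hh hh'.
have [n1 g2 H1] := hg h hh; have [n2 _ H2] := hg h' hh'; split => // x y.
apply: (@ccont_eq_punctured R (fun x => f (h - h') * f ((x - y) / NC) * f (NC * h) * f (NC * h') * Gs x y h h')
  (fun x => g 0 * (f x * f (y + (h - h')) * f ((x - y) / NC + NC * h) * f (NC * h')
           - f y * f (x + (h - h')) * f ((x - y) / NC + NC * h') * f (NC * h)))).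
- apply: ccontM.
    do 2![apply: ccontM; last exact: ccont_cst]; apply: ccontM; first exact: ccont_cst.
    by apply: (@ccont_th_affine _ NC^-1 (- y / NC)) => u; ring.
  apply: ccont_sum => al; apply: ccontM.
    by apply: (@ccont_epi_affine _ (2 * ((al.1 : nat)%:R / NC)) (- (2 * ((al.1 : nat)%:R / NC) * y))) => u; ring.
  apply: ccontM; last exact: ccont_cst; apply: ccontM; last exact: ccont_cst.
  by apply: (@ccont_th_affine _ 1 (h + torsI al)) => u; ring.
- apply: ccontM; first exact: ccont_cst; apply: ccontD; last apply: ccontN.
    apply: ccontM; last exact: ccont_cst; apply: ccontM; last first.
      by apply: (@ccont_th_affine _ NC^-1 (- y / NC + NC * h)) => u; ring.
    by apply: ccontM; [exact: ccont_th | exact: ccont_cst].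
  apply: ccontM; last exact: ccont_cst; apply: ccontM; last first.
    by apply: (@ccont_th_affine _ NC^-1 (- y / NC + NC * h')) => u; ring.
  apply: ccontM; first exact: ccont_cst.
  by apply: (@ccont_th_affine _ 1 (h - h')) => u; ring.
have [e e0 he] := @th_isolated R tau tau_gt0 1 (- y) x (oner_neq0 C).
exists e => // z zx hz; have := he z zx hz; rewrite mul1r => nz.
apply: (mulfI nz); have := pair_sum_fay tau_gt0 z y hh hh'; have := H1 (z - y); have := H2 (z - y).
set u1 := f (z - y); set u2 := f (h - h'); set u3 := f ((z - y) / NC); set u4 := f (NC * h); set u5 := f (NC * h').
set u6 := f (y + _); set u7 := f (z + _); set u8 := f (_ + NC * h'); set u9 := f (_ + NC * h); set G := Gs _ _ _ _.
set v1 := single_sum _ _ _ _; set v2 := single_sum _ _ _ _ => e1 e2 e3.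
have -> : u1 * (u2 * u3 * u4 * u5 * G) = (u1 * u2 * G) * (u3 * u4 * u5) by ring.
rewrite e3; have -> : (f z * u6 * v2 - f y * u7 * v1) * (u3 * u4 * u5) =
  f z * u6 * u5 * (v2 * u3 * u4) - f y * u7 * u4 * (v1 * u3 * u5) by ring.
by rewrite e1 e2; ring.
Qed.

Lemma offtors_tors h (x y : int) : offtors h -> f (h + tors x y) != 0.
Proof.
move=> hh; have Nz : N%:Z != 0 by rewrite eqz_nat -lt0n.
have a0 : (0 <= x %% N%:Z)%Z by rewrite modz_ge0. have aN : ((x %% N%:Z)%Z < N%:Z) by rewrite ltz_pmod // ltz_nat.
have b0 : (0 <= y %% N%:Z)%Z by rewrite modz_ge0. have bN : ((y %% N%:Z)%Z < N%:Z) by rewrite ltz_pmod // ltz_nat.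
move: (divz_eq x N%:Z) (divz_eq y N%:Z) a0 aN b0 bN.
case: (x %% N%:Z)%Z => // a; case: (y %% N%:Z)%Z => // b xE yE _; rewrite !ltz_nat => aN _ bN.
have := hh (Ordinal aN, Ordinal bN); rewrite /torsionI /=.
rewrite (_ : h + tors x y = h + tors a b + (y %/ N%:Z)%Z%:~R + (x %/ N%:Z)%Z%:~R * tau); last first.
  by rewrite {1}xE {1}yE /torsion !rmorphD !rmorphM /=; field.
by rewrite th_add_lattice // => n; rewrite mulf_neq0 ?epi_neq0.
Qed.

Lemma offtors_sub h (k l : int) : offtors h -> offtors (h - tors k l).
Proof.
move=> hh al; rewrite /torsionI addrAC -addrA torsB //.
by apply: offtors_tors.
Qed.

Lemma offtors_near h : offtors h -> exists2 e : R, 0 < e & forall u, md u < e -> offtors (h - u).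
Proof.
move=> hh; pose P u := \prod_(al : I2) f (h - u + torsI al).
have P0 : 0 < md (P 0) by rewrite modulus_gt0; apply/prodf_neq0 => al _; rewrite subr0.
have cP : ccont P 0.
  by apply: ccont_prod => al; apply: (@ccont_th_affine _ (-1) (h + torsI al)) => u; ring.
have [e e0 he] := ccont_ball cP P0; exists e => // u hu al; apply/eqP => e1.
have := he u; rewrite sub0r modulusN => /(_ hu).
by rewrite {2}/P (bigD1 al) //= e1 mul0r subr0 ltxx.
Qed.

(** The first product vanishes because f((x-y)/N + N h) = f(0); the second one because
    N times a torsion point is a lattice point. *)
Lemma pair_sum_crossing_off x y h (k l : int) : offtors h -> x - y = - (NC ^+ 2 * h) ->
  f (tors k l) != 0 -> Gs x y h (h - tors k l) = 0.
Proof.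
move=> hh hxy nz; have [g [_ g0 gN hg]] := pair_sum_closed_form.
have [n1 n2 _ /(_ x y)] := hg h (h - tors k l) hh (offtors_sub k l hh).
have -> : h - (h - tors k l) = tors k l by ring.
have dN : (x - y) / NC = - (NC * h) by rewrite hxy; field.
rewrite dN addNr th0 //.
have -> : - (NC * h) + NC * (h - tors k l) = (- l)%:~R + (- k)%:~R * tau.
  by rewrite /torsion !rmorphN /=; field.
have -> : f ((- l)%:~R + (- k)%:~R * tau) = 0 by apply/(th_eq0 tau_gt0); exists (- l), (- k).
rewrite !(mulr0, mul0r) subrr mulr0 thN // => /eqP; rewrite !mulf_eq0 oppr_eq0.
by rewrite (negbTE nz) (negbTE n1) (negbTE n2) /= => /eqP.
Qed.

(** Shifting by N times a torsion point multiplies f by an exponential, and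
    after these shifts the two products agree. *)
Lemma pair_sum_unitary_off y h (k l : int) : offtors h -> f (tors k l) != 0 ->
  Gs (y + NC * tors k l) y h (h - tors k l) = 0.
Proof.
move=> hh nz; have [g [_ g0 gN hg]] := pair_sum_closed_form.
have [n1 n2 _ /(_ (y + NC * tors k l) y)] := hg h (h - tors k l) hh (offtors_sub k l hh).
have -> : h - (h - tors k l) = tors k l by ring.
have -> : (y + NC * tors k l - y) / NC = tors k l by field.
have NE : NC * tors k l = l%:~R + k%:~R * tau by rewrite /torsion; field.
have -> : y + NC * tors k l = y + l%:~R + k%:~R * tau by rewrite NE addrA.
have -> : y + l%:~R + k%:~R * tau + tors k l = (y + tors k l) + l%:~R + k%:~R * tau by ring.
have -> : tors k l + NC * (h - tors k l) = (tors k l + NC * h) + (- l)%:~R + (- k)%:~R * tau.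
  by rewrite mulrBr NE !rmorphN /=; ring.
have e2 : NC * (h - tors k l) = NC * h + (- l)%:~R + (- k)%:~R * tau.
  by rewrite mulrBr NE !rmorphN /=; ring.
rewrite e2 in n2 *; rewrite !th_add_lattice // in n2 *.
set E1 := epi _ in n2 *; set E2 := epi _; set E3 := epi _; set E4 := epi _.
have hE : E2 * E1 = E3 * E4.
  rewrite /E1 /E2 /E3 /E4 -!epiD; congr epi; rewrite !rmorphN /=; ring.
have E10 : E1 != 0 by exact: epi_neq0.
clearbody E1 E2 E3 E4.
set G := pair_sum _ _ _ _ _ _; set u1 := f (tors k l) in nz *; set u2 := f (NC * h) in n1 n2 *.
set u3 := f (y + tors k l); set u4 := f (tors k l + NC * h).
have -> : E2 * f y * u3 * u4 * (E1 * u2) - f y * (E3 * u3) * (E4 * u4) * u2 =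
  (E2 * E1 - E3 * E4) * (f y * u3 * u4 * u2) by ring.
by rewrite hE subrr mul0r mulr0 => /eqP; rewrite !mulf_eq0 (negbTE nz) (negbTE n1) (negbTE E10) /= => /eqP.
Qed.

(** Both sides of the closed form vanish at h' = h. Take h' = h - u: f(N u) = g(u) f(u) lets
    one divide by f(u) and let u tend to 0. *)
Lemma pair_sum_crossing_diag x y h : offtors h -> x - y = - (NC ^+ 2 * h) ->
  f (NC * h) ^+ 2 * Gs x y h h = - (NC ^+ 2 * f x * f y).
Proof.
move=> hh hxy; have [g [gc g0 gN hg]] := pair_sum_closed_form.
have [e1 e10 he1] := offtors_near hh.
have [e2 e20 he2] := @th_isolated R tau tau_gt0 1 0 0 (oner_neq0 C).
have [n1 _ g2 _] := hg h h hh hh.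
have : f (NC * h) * f (NC * (h - 0)) * Gs x y h (h - 0) = - (g 0 * f y * f (x + 0) * g 0).
  apply: (@ccont_eq_punctured R (fun u => f (NC * h) * f (NC * (h - u)) * Gs x y h (h - u)) (fun u => - (g 0 * f y * f (x + u) * g u))).
  - apply: ccontM; first apply: ccontM; first exact: ccont_cst.
      by apply: (@ccont_th_affine _ (- NC) (NC * h)) => u; ring.
    apply: ccont_sum => al; apply: ccontM; first exact: ccont_cst.
    apply: ccontM; first apply: ccontM; first exact: ccont_cst.
      by apply: (@ccont_th_affine _ 1 (y - h - torsI al)) => u; ring.
    apply: ccontV; last apply: ccontM; last 1 [exact: ccont_cst|].
    + rewrite subr0 (_ : - h - torsI al = - (h + torsI al)); last by ring.
      by rewrite thN // mulf_neq0 ?oppr_eq0.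
    by apply: (@ccont_th_affine _ 1 (- h - torsI al)) => u; ring.
  - apply: ccontN; apply: ccontM; last exact: gc; apply: ccontM; first exact: ccont_cst.
    by apply: (@ccont_th_affine _ 1 x) => u; ring.
  exists (Num.min e1 e2); first by rewrite lt_min e10.
  move=> u u0; rewrite sub0r modulusN lt_min => /andP[h1 h2].
  have fu : f u != 0 by have := he2 u u0; rewrite sub0r modulusN mul1r addr0; apply.
  have [_ _ _ /(_ x y)] := hg h (h - u) hh (he1 u h1).
  have -> : h - (h - u) = u by ring.
  have dN : (x - y) / NC = - (NC * h) by rewrite hxy; field.
  rewrite dN addNr th0 //.
  have -> : - (NC * h) + NC * (h - u) = - (NC * u) by ring.
  rewrite !thN // (gN u) => e3; apply: (mulfI fu); apply: (mulfI n1).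
  set G := pair_sum _ _ _ _ _ _ in e3 *; set v := f (NC * (h - u)) in e3 *.
  transitivity (- (f u * - f (NC * h) * f (NC * h) * v * G)); first by ring.
  by rewrite e3; ring.
rewrite !(subr0, addr0) => e3; rewrite expr2 e3 -[NC ^+ 2]g2; ring.
Qed.

(** Here x = y + N u and h' = h - u, and the closed form vanishes to second
    order at u = 0. The Weierstrass relation rewrites its right hand side with the
    factor f(N u) f(u). *)
Lemma pair_sum_unitary_diag y h : offtors h ->
  f (NC * h) ^+ 2 * Gs y y h h = - (NC ^+ 2 * f (y + NC * h) * f (y - NC * h)).
Proof.
move=> hh; have [g [gc g0 gN hg]] := pair_sum_closed_form.
have [e1 e10 he1] := offtors_near hh.
have [e2 e20 he2] := @th_isolated R tau tau_gt0 1 0 0 (oner_neq0 C).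
have [n1 _ g2 _] := hg h h hh hh.
have : f (NC * h) * f (NC * (h - 0)) * Gs (y + NC * 0) y h (h - 0) = - (g 0 * g 0 * f (y + NC * h + 0) * f (y - NC * h + NC * 0)).
  apply: (@ccont_eq_punctured R (fun u => f (NC * h) * f (NC * (h - u)) * Gs (y + NC * u) y h (h - u)) (fun u => - (g 0 * g u * f (y + NC * h + u) * f (y - NC * h + NC * u)))).
  - apply: ccontM; first apply: ccontM; first exact: ccont_cst.
      by apply: (@ccont_th_affine _ (- NC) (NC * h)) => u; ring.
    apply: ccont_sum => al; apply: ccontM.
      by apply: (@ccont_epi_affine _ (2 * ((al.1 : nat)%:R / NC) * NC) 0) => u; ring.
    apply: ccontM; first apply: ccontM.
    + by apply: (@ccont_th_affine _ NC (y + h + torsI al)) => u; ring.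
    + by apply: (@ccont_th_affine _ 1 (y - h - torsI al)) => u; ring.
    apply: ccontV; last apply: ccontM; last 1 [exact: ccont_cst|].
    + rewrite subr0 (_ : - h - torsI al = - (h + torsI al)); last by ring.
      by rewrite thN // mulf_neq0 ?oppr_eq0.
    by apply: (@ccont_th_affine _ 1 (- h - torsI al)) => u; ring.
  - apply: ccontN; apply: ccontM; first apply: ccontM; first apply: ccontM; first exact: ccont_cst.
    + exact: gc.
    + by apply: (@ccont_th_affine _ 1 (y + NC * h)) => u; ring.
    by apply: (@ccont_th_affine _ NC (y - NC * h)) => u; ring.
  exists (Num.min e1 e2); first by rewrite lt_min e10.
  move=> u u0; rewrite sub0r modulusN lt_min => /andP[h1 h2].
  have fu : f u != 0 by have := he2 u u0; rewrite sub0r modulusN mul1r addr0; apply.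
  have [_ _ _ /(_ (y + NC * u) y)] := hg h (h - u) hh (he1 u h1).
  have -> : h - (h - u) = u by ring.
  have -> : (y + NC * u - y) / NC = u by field.
  have := th_weierstrass tau_gt0 (y + (NC + 1) * u / 2) ((NC - 1) * u / 2) (NC * h + (1 - NC) * u / 2) ((NC + 1) * u / 2).
  rewrite (_ : y + (NC + 1) * u / 2 + (NC - 1) * u / 2 = y + NC * u); last by field.
  rewrite (_ : y + (NC + 1) * u / 2 - (NC - 1) * u / 2 = y + u); last by field.
  rewrite (_ : NC * h + (1 - NC) * u / 2 + (NC + 1) * u / 2 = u + NC * h); last by field.
  rewrite (_ : NC * h + (1 - NC) * u / 2 - (NC + 1) * u / 2 = NC * (h - u)); last by field.
  rewrite (_ : y + (NC + 1) * u / 2 + (NC * h + (1 - NC) * u / 2) = y + NC * h + u); last by field.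
  rewrite (_ : y + (NC + 1) * u / 2 - (NC * h + (1 - NC) * u / 2) = y - NC * h + NC * u); last by field.
  rewrite (_ : (NC - 1) * u / 2 + (NC + 1) * u / 2 = NC * u); last by field.
  rewrite (_ : (NC - 1) * u / 2 - (NC + 1) * u / 2 = - u); last by field.
  rewrite (_ : y + (NC + 1) * u / 2 + (NC + 1) * u / 2 = y + NC * u + u); last by field.
  rewrite (_ : y + (NC + 1) * u / 2 - (NC + 1) * u / 2 = y); last by field.
  rewrite (_ : (NC - 1) * u / 2 + (NC * h + (1 - NC) * u / 2) = NC * h); last by field.
  rewrite (_ : (NC - 1) * u / 2 - (NC * h + (1 - NC) * u / 2) = - (u + NC * (h - u))); last by field.
  rewrite !thN // (gN u) => e4 e3; apply: (mulfI fu); apply: (mulfI fu).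
  set G := pair_sum _ _ _ _ _ _ in e3 *; set v := f (NC * (h - u)) in e3 e4 *.
  set w1 := f (y + NC * u) in e3 e4 *; set w2 := f (y + u) in e3 e4 *; set w3 := f (u + NC * h) in e3 e4 *.
  set w4 := f (y + NC * h + u) in e3 e4 *; set w5 := f (y - NC * h + NC * u) in e3 e4 *.
  set w6 := f (_ + u) in e3 e4 *; set w7 := f (u + _) in e3 e4 *; set w8 := f (NC * h) in e3 e4 *.
  transitivity (f u * f u * w8 * v * G); first by ring.
  rewrite e3; apply/eqP; rewrite -subr_eq0 -[X in _ == X](mulr0 (g 0)) -e4; apply/eqP; ring.
rewrite !(mulr0, subr0, addr0) => e3; rewrite expr2 e3 -[NC ^+ 2]g2; ring.
Qed.

End Orthogonality.

(** * Convolutions of the coefficients of the R-matrix *)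

Section Coefficients.
Variable R : realType.
Local Notation C := R[i].
Variable tau : C.
Hypothesis tau_gt0 : 0 < complex.Im tau.
Local Notation f := (th tau).
Variable N : nat.
Hypothesis N_gt0 : (0 < N)%N.
Local Notation NC := (N%:R : C).
Local Notation I2 := ('I_N * 'I_N)%type.
Local Notation torsI := (@torsionI R tau N).
Local Notation tors := (@torsion R tau N).
Local Notation offtors := (@offtors R tau N).
Local Notation Gs := (@pair_sum R tau N).

Let NC0 : NC != 0. Proof. by rewrite pnatr_eq0 -lt0n. Qed.

(** The coefficient W with integer indices, in terms of f: the exponentials from the change
    of characteristics cancel up to the first factor. It is periodic modulo N
    in both indices ([Wz_per1], [Wz_per2]). *)
Definition Wz (x y : int) (xi h : C) : C :=
  epi (2 * (x%:~R / NC) * xi) * f (xi + h + tors x y) / (NC * f (h + tors x y)).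

Lemma theta_char_th (a b : 'I_N) x :
  theta (theta_char R a) (theta_char R b) x tau =
  epi ((a%:R / NC) ^+ 2 * tau + 2 * (a%:R / NC) * (x + 2^-1 + b%:R / NC)) * f (x + tors a b).
Proof.
rewrite /theta_char theta_shift // /torsion; congr (_ * f _).
by rewrite -addrA; congr (_ + _); field.
Qed.

Lemma R_definedP zeta : R_defined N zeta tau -> offtors (zeta / NC).
Proof.
move=> h al; have := h al.1 al.2; rewrite theta_char_th.
by apply: contraNneq; rewrite /torsionI => ->; rewrite mulr0.
Qed.

Lemma WE (a b : 'I_N) xi zeta : offtors (zeta / NC) -> W a b xi zeta tau = Wz a b xi (zeta / NC).
Proof.
move=> hh; have n0 := hh (a, b); rewrite /torsionI /= in n0.
rewrite /W !theta_char_th /Wz.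
set E1 := epi _; set E2 := epi _; set E3 := epi _.
have e : E1 = E3 * E2 by rewrite /E1 /E2 /E3 -epiD; congr epi; field.
have E20 : E2 != 0 by exact: epi_neq0.
clearbody E1 E2 E3; rewrite e; field; by rewrite n0 E20 NC0.
Qed.

Lemma Wz_phi x y xi h : Wz x y xi h = epi (2 * (x%:~R / NC) * xi) * phi tau xi (h + tors x y) / NC.
Proof.
rewrite /Wz /phi (_ : h + tors x y + xi = xi + h + tors x y); last by ring.
by rewrite invfM; ring.
Qed.

Lemma Wz_per1 x y xi h : Wz (x + N%:Z) y xi h = Wz x y xi h.
Proof.
rewrite !Wz_phi tors_addtau // (_ : h + (tors x y + tau) = h + tors x y + 0%:~R + 1%:~R * tau); last by ring.
rewrite phi_lattice // mulrA -epiD; congr (epi _ * _ / _).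
by rewrite rmorphD /=; field.
Qed.

Lemma Wz_per2 x y xi h : Wz x (y + N%:Z) xi h = Wz x y xi h.
Proof.
rewrite !Wz_phi tors_add1 // (_ : h + (tors x y + 1) = h + tors x y + 1%:~R + 0%:~R * tau); last by ring.
by rewrite phi_lattice // mulr0 mul0r oppr0 epi0 mul1r.
Qed.

Lemma sumW_pair_sum x y h k l :
  \sum_(al : I2) Wz al.1 al.2 x h * Wz (k - al.1%:Z) (l - al.2%:Z) y (- h) =
  epi (2 * (k%:~R / NC) * y) / NC ^+ 2 * Gs x y h (h - tors k l).
Proof.
rewrite /pair_sum mulr_sumr; apply: eq_bigr => al _; rewrite /Wz /torsionI -torsB //.
set w := tors al.1 al.2; set e := tors k l.
rewrite (_ : y + - h + (e - w) = y - (h - e) - w); last by ring.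
rewrite (_ : - h + (e - w) = - (h - e) - w); last by ring.
set E1 := epi _; set E2 := epi _; set E3 := epi _; set E4 := epi _.
have e0 : E1 * E2 = E3 * E4 by rewrite /E1 /E2 /E3 /E4 -!epiD; congr epi; rewrite rmorphB /=; field.
clearbody E1 E2 E3 E4; rewrite !invfM.
set u1 := f _; set u2 := (f _)^-1; set u3 := f _; set u4 := (f _)^-1.
transitivity ((E1 * E2) * (u1 * u2 * u3 * u4 / NC / NC)); first by ring.
by rewrite e0; ring.
Qed.

(** Coefficients of R(x) R'(y) when the phases of the matrix products cancel, as
    happens under the partial trace. *)
Lemma sumW_cross h (k l : nat) x y : offtors h -> x - y = - (NC ^+ 2 * h) -> (k < N)%N -> (l < N)%N ->
  \sum_(al : I2) Wz al.1 al.2 x h * Wz (k%:Z - al.1%:Z) (l%:Z - al.2%:Z) y (- h) =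
  if (k == 0%N) && (l == 0%N) then - (f x * f y) / f (NC * h) ^+ 2 else 0.
Proof.
move=> hh hxy kN lN; rewrite sumW_pair_sum; case: ifP => [/andP[/eqP -> /eqP ->]|kl].
  have [g [_ _ _ hg]] := pair_sum_closed_form tau_gt0 N_gt0; have [n1 _ _ _] := hg _ _ hh hh.
  rewrite mul0r mulr0 mul0r epi0 (_ : tors 0 0 = 0) ?subr0; last by rewrite /torsion mul0r addr0 mul0r.
  apply: (mulfI (expf_neq0 2 n1)); rewrite mulrCA pair_sum_crossing_diag //.
  by field; rewrite NC0 n1.
have -> : Gs x y h (h - tors k l) = 0; last by rewrite mulr0.
have hkl : f (tors k l) != 0; last exact: (pair_sum_crossing_off _ N_gt0 hh hxy hkl).
have := @torsI_neq0 R tau tau_gt0 N N_gt0 (Ordinal kN, Ordinal lN); apply.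
by apply/eqP => -[k0 l0]; rewrite k0 l0 in kl.
Qed.

(** Coefficients of R(y) R'(y). The phases come from the multiplication of the matrices; they are
    absorbed by moving the argument y by N times the torsion point of ga. *)
Lemma sumW_unit h (k l : nat) y : offtors h -> (k < N)%N -> (l < N)%N ->
  \sum_(al : I2) epi (2 * ((al.1 : nat)%:R * l%:R - k%:R * (al.2 : nat)%:R) / NC) *
    (Wz al.1 al.2 y h * Wz (k%:Z - al.1%:Z) (l%:Z - al.2%:Z) y (- h)) =
  if (k == 0%N) && (l == 0%N) then - (f (y + NC * h) * f (y - NC * h)) / f (NC * h) ^+ 2 else 0.
Proof.
move=> hh kN lN; case: ifP => [/andP[/eqP -> /eqP ->]|kl].
  have [g [_ _ _ hg]] := pair_sum_closed_form tau_gt0 N_gt0; have [n1 _ _ _] := hg _ _ hh hh.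
  under eq_bigr => al _ do rewrite mulr0 mul0r subr0 mulr0 mul0r epi0 mul1r.
  rewrite sumW_pair_sum mul0r mulr0 mul0r epi0 (_ : tors 0 0 = 0) ?subr0; last by rewrite /torsion mul0r addr0 mul0r.
  apply: (mulfI (expf_neq0 2 n1)); rewrite mulrCA pair_sum_unitary_diag //.
  by field; rewrite NC0 n1.
have hkl : f (tors k l) != 0.
  have := @torsI_neq0 R tau tau_gt0 N N_gt0 (Ordinal kN, Ordinal lN); apply.
  by apply/eqP => -[k0 l0]; rewrite k0 l0 in kl.
have e0 := pair_sum_unitary_off tau_gt0 N_gt0 y hh hkl.
have E0 : epi (l%:R + k%:R - k%:R ^+ 2 * tau - 2 * k%:R * (y + h) - 2 * (k%:R / NC) * y) * NC ^+ 2 != 0 :> C.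
  by apply: mulf_neq0; [exact: epi_neq0 | exact: expf_neq0].
apply: (mulfI E0); rewrite mulr0 -[RHS]e0 /pair_sum mulr_sumr; apply: eq_bigr => al _.
rewrite /Wz /torsionI -torsB //.
rewrite (_ : y + - h + (tors k l - tors al.1 al.2) = y - (h - tors k l) - tors al.1 al.2); last by ring.
rewrite (_ : - h + (tors k l - tors al.1 al.2) = - (h - tors k l) - tors al.1 al.2); last by ring.
rewrite (_ : y + NC * tors k l + h + tors al.1 al.2 = (y + h + tors al.1 al.2) + l%:Z%:~R + k%:Z%:~R * tau); last first.
  by rewrite /torsion; field.
rewrite th_add_lattice //.
set E1 := epi _; set E2 := epi _; set E3 := epi _; set E4 := epi _; set E5 := epi _; set E6 := epi _.
have e : E1 * E2 * E3 * E4 = E5 * E6.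
  rewrite /E1 /E2 /E3 /E4 /E5 /E6 -!epiD; congr epi; rewrite rmorphB /= /torsion; field; exact: NC0.
clearbody E1 E2 E3 E4 E5 E6; rewrite !invfM.
set u1 := f _; set u2 := (f _)^-1; set u3 := f _; set u4 := (f _)^-1.
transitivity ((E1 * E2 * E3 * E4) * (u1 * u2 * u3 * u4)); last by rewrite e; ring.
by field; exact: NC0.
Qed.

End Coefficients.

(** * The finite Heisenberg group *)

Lemma tensmx11 (V : pzRingType) (m n : nat) :
  tensmx (1%:M : 'M[V]_m) (1%:M : 'M[V]_n) = 1%:M.
Proof.
apply/matrixP => i j; case: (mxtens_indexP i) => a b; case: (mxtens_indexP j) => c d.
by rewrite tensmxE !mxE (can_eq (@mxtens_indexK m n)) xpair_eqE -natrM mulnb.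
Qed.

Section Heisenberg.
Variable R : realType.
Local Notation C := R[i].
Variable N : nat.
Hypothesis N_gt0 : (0 < N)%N.
Local Notation NC := (N%:R : C).
Local Notation I2 := ('I_N * 'I_N)%type.

Let NC0 : NC != 0. Proof. by rewrite pnatr_eq0 -lt0n. Qed.

(** h^x g^y up to a phase: g^y followed by the shift by x, for all integers x and y. *)
Definition J (x y : int) : 'M[C]_N :=
  \matrix_(i, j) (epi (2 * (i%:R * y%:~R) / NC) *+ (N%:Z %| j%:Z - i%:Z - x)%Z).

Lemma dvdN_ord (i j : 'I_N) : (N%:Z %| j%:Z - i%:Z)%Z = (i == j).
Proof.
apply/idP/eqP => [/dvdzP[k hk]|->]; last by rewrite subrr dvdz0.
apply: val_inj => /=; have := ltn_ord i; have := ltn_ord j => h1 h2.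
have k0 : k = 0 by nia.
by rewrite k0 in hk; lia.
Qed.

Lemma shift_ord (i : 'I_N) (x : int) : exists2 k : 'I_N, (N%:Z %| k%:Z - i%:Z - x)%Z &
  forall k' : 'I_N, (N%:Z %| k'%:Z - i%:Z - x)%Z = (k == k').
Proof.
have Nz : N%:Z != 0 by rewrite eqz_nat -lt0n.
have kN : (`|((i%:Z + x) %% N%:Z)%Z|%N < N)%N.
  by rewrite -ltz_nat gez0_abs ?modz_ge0 // ltz_pmod // ltz_nat.
have hk : (N%:Z %| (Ordinal kN)%:Z - i%:Z - x)%Z.
  rewrite /= gez0_abs ?modz_ge0 //; apply/dvdzP; exists (- ((i%:Z + x) %/ N%:Z)%Z).
  have := divz_eq (i%:Z + x) N%:Z; lia.
exists (Ordinal kN) => // k'; set k := Ordinal kN in hk *.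
rewrite -dvdN_ord (_ : k'%:Z - k%:Z = (k'%:Z - i%:Z - x) - (k%:Z - i%:Z - x)); last by ring.
by rewrite [RHS]rpredBr.
Qed.

Lemma JM x y x' y' : J x y *m J x' y' = epi (2 * (x%:~R * y'%:~R) / NC) *: J (x + x') (y + y').
Proof.
apply/matrixP => i j; rewrite !mxE; have [k hk hk'] := shift_ord i x.
rewrite (bigD1 k) //= big1 ?addr0 => [|k' /negbTE nk]; last first.
  by rewrite !mxE hk' eq_sym nk mulr0n mul0r.
rewrite !mxE hk mulr1n.
have -> : (N%:Z %| j%:Z - k%:Z - x')%Z = (N%:Z %| j%:Z - i%:Z - (x + x'))%Z.
  rewrite (_ : j%:Z - i%:Z - (x + x') = (j%:Z - k%:Z - x') + (k%:Z - i%:Z - x)); last by ring.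
  by rewrite [RHS]rpredDr.
case: (_ %| _ - (x + x'))%Z; rewrite ?mulr0n ?mulr0 // !mulr1n -!epiD.
move: hk => /dvdzP[m hm].
have {}hm : k%:R = i%:R + x%:~R + m%:~R * NC :> C.
  have : (k%:Z)%:~R = (i%:Z + x + m * N%:Z)%:~R :> C by congr (_%:~R); lia.
  by rewrite !rmorphD /= rmorphM.
rewrite hm -[RHS](epi_addn _ (m * y')); congr epi.
by rewrite rmorphD rmorphM /=; field.
Qed.

Lemma J00 : J 0 0 = 1%:M.
Proof.
apply/matrixP => i j; rewrite !mxE subr0 dvdN_ord mulr0 mulr0 mul0r epi0.
by case: (i == j).
Qed.

Lemma J_per1 x y : J (x + N%:Z) y = J x y.
Proof.
apply/matrixP => i j; rewrite !mxE; congr (_ *+ (nat_of_bool _)).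
by rewrite opprD addrA [LHS]rpredBr // dvdzz.
Qed.

Lemma J_per2 x y : J x (y + N%:Z) = J x y.
Proof.
apply/matrixP => i j; rewrite !mxE; congr (_ *+ _).
rewrite -[RHS](epi_addn _ i%:Z); congr epi; by rewrite rmorphD /=; field.
Qed.

Lemma J_inv x y : J x y *m (epi (2 * (x%:~R * y%:~R) / NC) *: J (- x) (- y)) = 1%:M.
Proof.
rewrite -scalemxAr JM scalerA -epiD !subrr J00 rmorphN /= (_ : _ + _ = 0) ?epi0 ?scale1r //; ring.
Qed.

Lemma invmx_uniq n (A B : 'M[C]_n) : A *m B = 1%:M -> invmx A = B.
Proof.
move=> h; have [u _] := mulmx1_unit h.
by rewrite -[LHS]mulmx1 -h mulmxA mulVmx // mul1mx.
Qed.

Lemma gmx_J : gmx R N = J 0 1.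
Proof.
apply/matrixP => i j; rewrite !mxE subr0 dvdN_ord; congr (epi _ *+ _); by rewrite mulr1.
Qed.

Lemma hmx_J : hmx R N = J 1 0.
Proof.
apply/matrixP => i j; rewrite !mxE !mulr0 mul0r epi0.
suff -> : (N%:Z %| j%:Z - i%:Z - 1)%Z = ((i.+1 %% N)%N == j) by [].
pose k := Ordinal (ltn_pmod i.+1 N_gt0).
have hk : (N%:Z %| k%:Z - i%:Z - 1)%Z.
  by apply/dvdzP; exists (- (i.+1 %/ N)%N%:Z) => /=; have := divn_eq i.+1 N; lia.
rewrite -[RHS]/(k == j) -dvdN_ord.
rewrite (_ : j%:Z - k%:Z = (j%:Z - i%:Z - 1) - (k%:Z - i%:Z - 1)); last by ring.
by rewrite [RHS]rpredBr.
Qed.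

Lemma mulmx_exp (A : nat -> 'M[C]_N) (B : 'M[C]_N) : A 0%N = 1%:M ->
  (forall n, A n.+1 = B *m A n) -> forall n, B ^+ n = A n.
Proof. by move=> A0 AS; elim=> [|n IH]; rewrite ?expr0 // exprS IH AS. Qed.

Lemma Imx_J (a b : 'I_N) : Imx R a b = J a b.
Proof.
have hg : gmx R N ^+ b = J 0 b.
  apply: (mulmx_exp (A := fun n => J 0 n%:Z)); first exact: J00.
  by move=> n; rewrite gmx_J JM mul0r mulr0 mul0r epi0 scale1r addr0.
have hh : hmx R N ^+ a = J a 0.
  apply: (mulmx_exp (A := fun n => J n%:Z 0)); first exact: J00.
  by move=> n; rewrite hmx_J JM mulr0 mulr0 mul0r epi0 scale1r addr0.
by rewrite /Imx hg hh JM mul0r mulr0 mul0r epi0 scale1r add0r addr0.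
Qed.

(** I (x) I^-1 for the Heisenberg element I of index (x, y); the scalar makes
    the second factor the inverse of the first. *)
Definition Jpair (x y : int) : 'M[C]_(N * N) :=
  epi (2 * (x%:~R * y%:~R) / NC) *: tensmx (J x y) (J (- x) (- y)).

Lemma Jpair_tens (a b : 'I_N) : tensmx (Imx R a b) (invmx (Imx R a b)) = Jpair a b.
Proof.
rewrite Imx_J (invmx_uniq (J_inv a b)) /Jpair.
by apply/matrixP => i j; rewrite !mxE; ring.
Qed.

Lemma JpairM x y x' y' : Jpair x y *m Jpair x' y' =
  epi (2 * (x%:~R * y'%:~R - x'%:~R * y%:~R) / NC) *: Jpair (x + x') (y + y').
Proof.
rewrite /Jpair -scalemxAl -scalemxAr tensmx_mul !JM !scalerA.
rewrite (_ : tensmx (_ *: _) (_ *: _) = (epi (2 * (x%:~R * y'%:~R) / NC) * epi (2 * ((- x)%:~R * (- y')%:~R) / NC)) *: tensmx (J (x + x') (y + y')) (J (- (x + x')) (- (y + y')))); last first.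
  by rewrite !opprD; apply/matrixP => i j; rewrite !mxE; ring.
rewrite scalerA -!epiD; congr (epi _ *: _); rewrite !rmorphN !rmorphD /=; ring.
Qed.

Lemma Jpair00 : Jpair 0 0 = 1%:M.
Proof. by rewrite /Jpair mul0r mulr0 mul0r epi0 scale1r oppr0 J00 tensmx11. Qed.

Lemma Jpair_per1 x y : Jpair (x + N%:Z) y = Jpair x y.
Proof.
rewrite /Jpair J_per1 -(J_per1 (- (x + N%:Z))) opprD addrNK.
rewrite -[X in _ = X *: _](epi_addn _ y); congr (epi _ *: _); rewrite rmorphD /=; field; exact: NC0.
Qed.

Lemma Jpair_per2 x y : Jpair x (y + N%:Z) = Jpair x y.
Proof.
rewrite /Jpair J_per2 -(J_per2 _ (- (y + N%:Z))) opprD addrNK.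
rewrite -[X in _ = X *: _](epi_addn _ x); congr (epi _ *: _); rewrite rmorphD /=; field; exact: NC0.
Qed.

(** Collects the coefficient of every generator in a product of two sums over Z_N^2. *)
Lemma big_convolution (V : zmodType) (F : int -> int -> int -> int -> V) :
  (forall a b c d, F a b (c + N%:Z) d = F a b c d) -> (forall a b c d, F a b c (d + N%:Z) = F a b c d) ->
  \sum_(al : I2) \sum_(be : I2) F al.1 al.2 be.1 be.2 =
  \sum_(ga : I2) \sum_(al : I2) F al.1 al.2 (ga.1%:Z - al.1%:Z) (ga.2%:Z - al.2%:Z).
Proof.
move=> h1 h2; rewrite [RHS]exchange_big /=; apply: eq_bigr => -[a b] _ /=.
rewrite -(pair_bigA _ (fun c d : 'I_N => F a b c d)) -(pair_bigA _ (fun c d : 'I_N => F a b (c%:Z - a%:Z) (d%:Z - b%:Z))) /=.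
under [RHS]eq_bigr => c _ do rewrite (@big_periodic_shift _ _ _ _ (fun d => F a b (c%:Z - a%:Z) d)) //.
by rewrite (@big_periodic_shift _ _ _ _ (fun c => \sum_(d < N) F a b c d%:Z)) // => c; apply: eq_bigr => d _.
Qed.

End Heisenberg.

(** * Conditions that hold off a locally finite set *)

Lemma int_window (k : int) (K : nat) : (`|k| <= K)%N ->
  (absz (k + K%:Z)%R < (K + K).+1)%N /\ (0 <= k + K%:Z).
Proof. lia. Qed.

Section Generic.
Variable R : realType.
Local Notation C := R[i].
Local Notation md := (@modulus R).

Definition generic (P : C -> Prop) : Prop :=
  exists2 S : set C, locally_finite S & forall x, ~ S x -> P x.

Lemma generic_imp (P Q : C -> Prop) : (forall x, P x -> Q x) -> generic P -> generic Q.
Proof. by move=> h [S hS hP]; exists S => // x /hP; apply: h. Qed.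

Lemma generic_and (P Q : C -> Prop) : generic P -> generic Q -> generic (fun x => P x /\ Q x).
Proof.
move=> [S hS hP] [T hT hQ]; exists (S `|` T) => [r|x].
  by rewrite setIUl finite_setU; split; [exact: hS | exact: hT].
by move=> /not_orP [h1 h2]; split; [exact: hP | exact: hQ].
Qed.

Lemma generic_true (P : C -> Prop) : (forall x, P x) -> generic P.
Proof. by move=> h; exists set0 => // r; rewrite set0I. Qed.

Lemma generic_shift (c : C) (P : C -> Prop) : generic P -> generic (fun x => P (x + c)).
Proof.
move=> [S hS hP]; exists [set x | S (x + c)] => [r|x hx]; last exact: hP.
apply: (@sub_finite_set _ _ ((fun y => y - c) @` (S `&` [set x | `|x| <= (r + md c)%:C]))).
  move=> x [/= h1 h2]; exists (x + c); last by rewrite addrK.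
  split => //=; move: h2; rewrite !modulusE !lecR => h2.
  by apply: le_trans (modulusD _ _) _; rewrite lerD2r.
exact: finite_image.
Qed.

Lemma generic_opp (P : C -> Prop) : generic P -> generic (fun x => P (- x)).
Proof.
move=> [S hS hP]; exists [set x | S (- x)] => [r|x hx]; last exact: hP.
apply: (@sub_finite_set _ _ ((fun y => - y) @` (S `&` [set x | `|x| <= r%:C]))).
  by move=> x [/= h1 h2]; exists (- x); rewrite ?opprK //; split => //=; rewrite normrN.
exact: finite_image.
Qed.

Lemma generic_all (n : nat) (P : nat -> C -> Prop) : (forall k, generic (P k)) ->
  generic (fun x => forall k, (k < n)%N -> P k x).
Proof.
move=> h; elim: n => [|n IH]; first exact: generic_true.
apply: generic_imp (generic_and IH (h n)) => x [h1 h2] k.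
by rewrite ltnS leq_eqVlt => /orP[/eqP -> //|]; exact: h1.
Qed.

(** In a ball c e^(2 i pi x) is bounded, so only finitely many pairs (n, m) can give 1; for
    each of them the solutions x differ by integers. *)
Lemma generic_powers (c a b : C) : c != 0 -> md a < 1 -> md b < 1 -> a != 0 -> b != 0 ->
  generic (fun x => forall n m, c * epi (2 * x) * a ^+ n * b ^+ m != 1).
Proof.
move=> c0 a1 b1 a0 b0.
exists [set x | exists n m, c * epi (2 * x) * a ^+ n * b ^+ m = 1]; last first.
  by move=> x hx n m; apply/eqP => e; apply: hx; exists n, m.
(* B bounds c e^(2 i pi x) in the ball of radius r *)
move=> r; pose B := md c * expR (2 * pi * r).
pose rho := Num.max (md a) (md b).
have r0 : 0 <= rho by rewrite le_max modulus_ge0.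
have r1 : rho < 1 by rewrite gt_max a1.
have [K hK] : exists K, B * rho ^+ K < 1.
  have : (fun n => B * rho ^+ n) @ \oo --> (0 : R) by apply: cvg_geometric; rewrite ger0_norm.
  move=> /cvgrPdist_lt /(_ _ ltr01) h; have [n hn] := @filter_ex nat \oo _ _ h; exists n.
  by move: hn; rewrite sub0r normrN => /(le_lt_trans (ler_norm _)).
pose E n m := [set x : C | c * epi (2 * x) * a ^+ n * b ^+ m = 1 /\ md x <= r].
have finE n m : finite_set (E n m).
  have [->|/set0P [x0 [e0 h0]]] := eqVneq (E n m) set0; first exact: finite_set0.
  have [K' hK'] : exists K' : nat, 2 * r <= K'%:R by exists (Num.truncn (2 * r)).+1; apply: ltW; exact: truncnS_gt.
  apply: (@sub_finite_set _ _ ((fun j : nat => x0 + (j%:Z - K'%:Z)%:~R) @` `I_(K' + K').+1)); last first.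
    by apply: finite_image; exact: finite_II.
  move=> x [e1 h1].
  have ee : epi (2 * (x - x0)) = 1.
    have nz : c * a ^+ n * b ^+ m != 0 by rewrite !mulf_neq0 ?expf_neq0.
    have : c * a ^+ n * b ^+ m * epi (2 * x) = c * a ^+ n * b ^+ m * epi (2 * x0).
      have e2 : c * epi (2 * x) * a ^+ n * b ^+ m = c * epi (2 * x0) * a ^+ n * b ^+ m by rewrite e1 e0.
      by transitivity (c * epi (2 * x) * a ^+ n * b ^+ m); [ring | rewrite e2; ring].
    by move=> /(mulfI nz) e; rewrite mulrBr epiB e divff // epi_neq0.
  have [k hk] := epi_eq1 ee.
  have {}hk : x - x0 = k%:~R by apply: (mulfI (_ : 2 != 0 :> C)); rewrite ?pnatr_eq0.
  have hb : `|k%:~R| <= 2 * r :> R.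
    rewrite -(modulus_real k%:~R) rmorph_int -hk; apply: le_trans (modulusD _ _) _.
    by rewrite modulusN mulr2n mulrDl mul1r lerD.
  have kK : (`|k| <= K')%N.
    by rewrite -(ler_nat R) natr_absz intr_norm; apply: le_trans hb hK'.
  have [kK1 kK2] := int_window kK.
  exists (absz (k + K'%:Z)%R) => //; rewrite gez0_abs //.
  by rewrite addrK -hk addrC subrK.
apply: (@sub_finite_set _ _ (\bigcup_(n in `I_K) \bigcup_(m in `I_K) E n m)); last first.
  by apply: bigcup_finite => [|n _]; [exact: finite_II | apply: bigcup_finite => [|m _]; [exact: finite_II | exact: finE]].
move=> x [[n [m e]] /=]; rewrite modulusE lecR => hx.
have he : md (epi (2 * x)) <= expR (2 * pi * r).
  rewrite modulus_epi ler_expR; have : - complex.Im (2 * x) <= 2 * r.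
    rewrite -(rmorph_nat (real_complex R) 2); case: x hx {e} => u v hx /=; rewrite mul0r addr0 -mulrN ler_pM2l //.
    by apply: le_trans (ler_norm _) _; rewrite normrN; apply: le_trans (Im_le_modulus (u +i* v)) hx.
  have pi0 := @pi_gt0 R; rewrite -mulrN => h.
  by apply: le_trans (_ : pi * (2 * r) <= _); [rewrite ler_pM2l | rewrite mulrCA mulrA].
have h1 : 1 <= B * (md a ^+ n * md b ^+ m).
  have -> : 1 = md c * md (epi (2 * x)) * (md a ^+ n * md b ^+ m).
    by rewrite -!modulusX mulrA -!modulusM e modulus1.
  by apply: ler_wpM2r; [rewrite mulr_ge0 ?exprn_ge0 | apply: ler_wpM2l].
have B0 : 0 <= B by rewrite mulr_ge0 ?expR_ge0.
have an : md a ^+ n <= rho ^+ n by rewrite lerXn2r // ?nnegrE // le_max lexx.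
have bm : md b ^+ m <= rho ^+ m by rewrite lerXn2r // ?nnegrE // le_max lexx orbT.
have le1 k : rho ^+ k <= 1 by apply: exprn_ile1 => //; exact: ltW.
have small k : 1 <= B * rho ^+ k -> (k < K)%N.
  move=> h; rewrite ltnNge; apply/negP => Kk; move: (lt_le_trans hK h); rewrite ltNge => /negP; apply.
  by rewrite ler_wpM2l // ler_wiXn2l // ltW.
exists n => /=.
  apply: small; apply: le_trans h1 _; rewrite ler_wpM2l // -[leRHS]mulr1 ler_pM ?exprn_ge0 //.
  exact: le_trans bm (le1 m).
exists m => //=; apply: small; apply: le_trans h1 _; rewrite ler_wpM2l // -[leRHS]mul1r ler_pM ?exprn_ge0 //.
exact: le_trans an (le1 n).
Qed.

Lemma generic_qpoch2 (c a b : C) : c != 0 -> md a < 1 -> md b < 1 -> a != 0 -> b != 0 ->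
  generic (fun x => qpoch2 (c * epi (2 * x)) a b != 0).
Proof. by move=> c0 a1 b1 a0 b0; apply: generic_imp (generic_powers c0 a1 b1 a0 b0) => x h; exact: qpoch2_neq0. Qed.

Lemma epi_opp2 (x : C) : epi (2 * (- x)) = (epi (2 * x))^-1.
Proof. by rewrite mulrN epiN. Qed.

Lemma generic_qpoch2V (c a b : C) : c != 0 -> md a < 1 -> md b < 1 -> a != 0 -> b != 0 ->
  generic (fun x => qpoch2 (c / epi (2 * x)) a b != 0).
Proof.
move=> c0 a1 b1 a0 b0; apply: generic_imp (generic_opp (generic_qpoch2 c0 a1 b1 a0 b0)) => x.
by rewrite epi_opp2.
Qed.

Lemma generic_Theta (c a : C) : c != 0 -> md a < 1 -> a != 0 ->
  generic (fun x => Theta a (c * epi (2 * x)) != 0).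
Proof.
move=> c0 a1 a0.
have g1 := generic_powers c0 a1 a1 a0 a0.
have g2 := generic_opp (generic_powers (mulf_neq0 a0 (invr_neq0 c0)) a1 a1 a0 a0).
apply: generic_imp (generic_and g1 g2) => x [h1 h2].
have t1 : qpoch (c * epi (2 * x)) a != 0.
  by apply: qpoch_neq0 => // n; have := h1 n 0%N; rewrite expr0 mulr1.
have t2 : qpoch (a / (c * epi (2 * x))) a != 0.
  have -> : a / (c * epi (2 * x)) = a / c * epi (2 * (- x)).
    by rewrite epi_opp2 invfM; exact: mulrA.
  by apply: qpoch_neq0 => // n; have := h2 n 0%N; rewrite expr0 mulr1.
exact: (mulf_neq0 (mulf_neq0 t1 t2) (qpoch_pp_neq0 a1)).
Qed.

Lemma generic_ThetaV (c a : C) : c != 0 -> md a < 1 -> a != 0 ->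
  generic (fun x => Theta a (c / epi (2 * x)) != 0).
Proof.
move=> c0 a1 a0; apply: generic_imp (generic_opp (generic_Theta c0 a1 a0)) => x.
by rewrite epi_opp2.
Qed.

Lemma generic_th (tau c : C) : 0 < complex.Im tau -> generic (fun x => th tau (x + c) != 0).
Proof.
move=> t0; have g := generic_Theta (epi_neq0 (2 * c)) (nome_lt1 t0) (epi_neq0 (2 * tau)).
apply: generic_imp g => x h.
have e : epi (2 * (x + c)) = epi (2 * c) * epi (2 * x) by rewrite -epiD; congr epi; rewrite mulrDr addrC.
rewrite -e in h; rewrite (th_Theta t0); apply: (mulf_neq0 _ h).
by rewrite oppr_eq0; exact: epi_neq0.
Qed.

End Generic.

(** * Functional equations of the scalar prefactor *)

Section Scalars.
Variable R : realType.
Local Notation C := R[i].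
Local Notation md := (@modulus R).
Variables (N : nat) (q p : C).
Hypothesis N_gt0 : (0 < N)%N.
Hypotheses (q0 : q != 0) (q1 : md q < 1) (p0 : p != 0) (p1 : md p < 1).
Local Notation Q := (q ^+ (2 * N)).
Local Notation B := (q ^+ (2 * N - 2)).
Local Notation P := (fun x => qpoch2 x p Q).
Local Notation kap v := (kappaV N v q p).

Let Q0 : Q != 0. Proof. exact: expf_neq0. Qed.
Let B0 : B != 0. Proof. exact: expf_neq0. Qed.
Let Q1 : md Q < 1. Proof. by rewrite modulusX exprn_ilt1 // muln_eq0 -lt0n N_gt0. Qed.
Let QB : Q = q ^+ 2 * B. Proof. by rewrite -exprD; congr (_ ^+ _); lia. Qed.

(** The quotient of Theta functions in tau_N(q^(1/2) / z), at v = z^2. *)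
Definition theta_quot (v : C) := Theta Q (q ^+ 2 / v) / Theta Q v.

Definition regular (v : C) : Prop :=
  [/\ P (Q / v) != 0, P (q ^+ 2 * v) != 0, P (p / v) != 0 & P (p * B * v) != 0] /\
  [/\ P (Q * v) != 0, P (q ^+ 2 / v) != 0, P (p * v) != 0 & P (p * B / v) != 0] /\
  [/\ Theta Q v != 0, Theta Q (q ^+ 2 * v) != 0 & Theta Q (q ^+ 2 / v) != 0].

Lemma generic_regular : generic (fun x => regular (epi (2 * x))).
Proof.
have q20 : q ^+ 2 != 0 by exact: expf_neq0.
have pB0 : p * B != 0 by exact: mulf_neq0.
have g1 := generic_and (generic_qpoch2V Q0 p1 Q1 p0 Q0) (generic_and (generic_qpoch2 q20 p1 Q1 p0 Q0)
   (generic_and (generic_qpoch2V p0 p1 Q1 p0 Q0) (generic_qpoch2 pB0 p1 Q1 p0 Q0))).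
have g2 := generic_and (generic_qpoch2 Q0 p1 Q1 p0 Q0) (generic_and (generic_qpoch2V q20 p1 Q1 p0 Q0)
   (generic_and (generic_qpoch2 p0 p1 Q1 p0 Q0) (generic_qpoch2V pB0 p1 Q1 p0 Q0))).
have g3 := generic_and (generic_Theta (oner_neq0 C) Q1 Q0) (generic_and (generic_Theta q20 Q1 Q0) (generic_ThetaV q20 Q1 Q0)).
apply: generic_imp (generic_and g1 (generic_and g2 g3)) => x [[a1 [a2 [a3 a4]]] [[b1 [b2 [b3 b4]]] [c1 [c2 c3]]]].
by split; [split | split; split] => //; rewrite mul1r in c1.
Qed.

Let qS (z0 z w : C) : z0 = z -> p * z = w -> P z0 = qpoch z Q * P w.
Proof. by move=> -> <-; exact: (qpoch2S p1 Q1). Qed.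

Let qSr (z0 z w : C) : z0 = z -> Q * z = w -> P z0 = qpoch z p * P w.
Proof. by move=> -> <-; exact: (qpoch2Sr _ p1 Q1). Qed.

Let ThE (a z w : C) : a / z = w -> Theta a z = qpoch z a * qpoch w a * qpoch a a.
Proof. by rewrite /Theta => ->. Qed.

(** Under v -> p v every double product in 1/kappa gains or loses a simple product of
    base q^(2N); these assemble into Theta functions. *)
Lemma kappa_shift_p v : v != 0 -> regular v -> regular (p * v) ->
  theta_quot (p * v) * kap (p * v) * Theta Q (q ^+ 2 * v) = kap v * Theta Q v^-1.
Proof.
move=> v0 [[a1 a2 a3 a4] [[b1 b2 b3 b4] [c1 c2 c3]]] [[a1' a2' a3' a4'] [[b1' b2' b3' b4'] [c1' c2' c3']]].
have pv0 : p * v != 0 by exact: mulf_neq0.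
have e1 : P (Q / (p * v)) = qpoch (Q / (p * v)) Q * P (Q / v) by apply: qS => [|]; [reflexivity | field; rewrite v0 p0].
have e2 : P (q ^+ 2 * v) = qpoch (q ^+ 2 * v) Q * P (q ^+ 2 * (p * v)) by apply: qS => [|]; [reflexivity | ring].
have e3 : P (p / (p * v)) = qpoch v^-1 Q * P (p / v) by apply: qS => [|]; [field; rewrite v0 p0 | reflexivity].
have e4 : P (p * B * v) = qpoch (p * B * v) Q * P (p * B * (p * v)) by apply: qS => [|]; [reflexivity | ring].
have e5 : P (Q * v) = qpoch (Q * v) Q * P (Q * (p * v)) by apply: qS => [|]; [reflexivity | ring].
have e6 : P (q ^+ 2 / (p * v)) = qpoch (q ^+ 2 / (p * v)) Q * P (q ^+ 2 / v) by apply: qS => [|]; [reflexivity | field; rewrite v0 p0].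
have e7 : P (p * v) = qpoch (p * v) Q * P (p * (p * v)) by apply: qS => [|]; reflexivity.
have e8 : P (p * B / (p * v)) = qpoch (B / v) Q * P (p * B / v) by apply: qS => [|]; [field; rewrite v0 p0 | ring].
have t1 : Theta Q (q ^+ 2 / (p * v)) = qpoch (q ^+ 2 / (p * v)) Q * qpoch (p * B * v) Q * qpoch Q Q.
  by apply: ThE; rewrite {1}QB; field; rewrite v0 p0 q0.
have t2 : Theta Q (p * v) = qpoch (p * v) Q * qpoch (Q / (p * v)) Q * qpoch Q Q by exact: ThE.
have t3 : Theta Q (q ^+ 2 * v) = qpoch (q ^+ 2 * v) Q * qpoch (B / v) Q * qpoch Q Q.
  by apply: ThE; rewrite {1}QB; field; rewrite v0 q0.
have t4 : Theta Q v^-1 = qpoch v^-1 Q * qpoch (Q * v) Q * qpoch Q Q by apply: ThE; rewrite invrK.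
rewrite /theta_quot t1 t2 t3 t4 /kappaV e1 e3 e6 e8 e2 e4 e5 e7.
rewrite t2 in c1'; rewrite e5 in b1; rewrite e6 in b2'; rewrite e7 in b3; rewrite e8 in b4'.
move: c1' b1 b2' b3 b4' b4 b2 b1' b3'; rewrite !mulf_eq0 !negb_or.
move=> /andP[/andP[n1 n2] n3] /andP[n4 n5] /andP[n6 n7] /andP[n8 n9] /andP[n10 n11] n12 n13 n14 n15.
field; by rewrite n1 n2 n3 n4 n5 n6 n7 n9 n10 n11.
Qed.

(** Under u -> q^(2N) u the simple products have base p instead, hence they assemble into
    theta functions of modulus tau. *)
Lemma kappa_shift_Q u : u != 0 -> regular u -> regular (Q * u) ->
  kap u * (Theta p u^-1 * Theta p (Q * u)) = kap (Q * u) * (Theta p (q ^+ 2 * u) * Theta p (q ^+ 2 / (Q * u))).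
Proof.
move=> v0 [[a1 a2 a3 a4] [[b1 b2 b3 b4] _]] [[a1' a2' a3' a4'] [[b1' b2' b3' b4'] _]].
have pv0 : Q * u != 0 by exact: mulf_neq0.
have e1 : P (Q / (Q * u)) = qpoch u^-1 p * P (Q / u) by apply: qSr => [|]; [field; rewrite v0 Q0 | reflexivity].
have e2 : P (q ^+ 2 * u) = qpoch (q ^+ 2 * u) p * P (q ^+ 2 * (Q * u)) by apply: qSr => [|]; [reflexivity | ring].
have e3 : P (p / (Q * u)) = qpoch (p / (Q * u)) p * P (p / u) by apply: qSr => [|]; [reflexivity | field; rewrite v0 Q0].
have e4 : P (p * B * u) = qpoch (p * B * u) p * P (p * B * (Q * u)) by apply: qSr => [|]; [reflexivity | ring].
have e5 : P (Q * u) = qpoch (Q * u) p * P (Q * (Q * u)) by apply: qSr => [|]; reflexivity.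
have e6 : P (q ^+ 2 / (Q * u)) = qpoch (q ^+ 2 / (Q * u)) p * P (q ^+ 2 / u) by apply: qSr => [|]; [reflexivity | field; rewrite v0 Q0].
have e7 : P (p * u) = qpoch (p * u) p * P (p * (Q * u)) by apply: qSr => [|]; [reflexivity | ring].
have e8 : P (p * B / (Q * u)) = qpoch (p / (q ^+ 2 * u)) p * P (p * B / u).
  by apply: qSr => [|]; rewrite QB; field; rewrite v0 q0 ?B0.
have t1 : Theta p u^-1 = qpoch u^-1 p * qpoch (p * u) p * qpoch p p by apply: ThE; rewrite invrK.
have t2 : Theta p (Q * u) = qpoch (Q * u) p * qpoch (p / (Q * u)) p * qpoch p p by exact: ThE.
have t3 : Theta p (q ^+ 2 * u) = qpoch (q ^+ 2 * u) p * qpoch (p / (q ^+ 2 * u)) p * qpoch p p by exact: ThE.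
have t4 : Theta p (q ^+ 2 / (Q * u)) = qpoch (q ^+ 2 / (Q * u)) p * qpoch (p * B * u) p * qpoch p p.
  by apply: ThE; rewrite QB; field; rewrite v0 q0 B0.
rewrite t1 t2 t3 t4 /kappaV e1 e3 e6 e8 e2 e4 e5 e7.
rewrite e5 in b1; rewrite e6 in b2'; rewrite e7 in b3; rewrite e8 in b4'.
move: b1 b2' b3 b4'; rewrite !mulf_eq0 !negb_or.
move=> /andP[n4 n5] /andP[n6 n7] /andP[n8 n9] /andP[n10 n11].
field; by rewrite n4 n5 n6 n7 n8 n9 n10 n11.
Qed.

Lemma theta_quot_shift u : u != 0 -> regular u -> regular (Q * u) -> theta_quot u = B * theta_quot (Q * u).
Proof.
move=> u0 [_ [_ [c1 c2 c3]]] [_ [_ [c1' c2' c3']]].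
have Qu0 : Q * u != 0 by exact: mulf_neq0.
have h1 : Theta Q (Q * u) = - (u^-1 * Theta Q u) by exact: (Theta_shift Q0 Q1 u0).
have z0 : q ^+ 2 / (Q * u) != 0 by rewrite mulf_neq0 ?expf_neq0 // invr_eq0.
have h2 := Theta_shift Q0 Q1 z0.
have ez : Q * (q ^+ 2 / (Q * u)) = q ^+ 2 / u by field; rewrite u0 Q0.
rewrite ez in h2; rewrite /theta_quot h2 h1.
have e : (q ^+ 2 / (Q * u))^-1 = B * u by rewrite QB; field; rewrite u0 q0 B0.
rewrite e; move: (Theta Q (q ^+ 2 / (Q * u))) (Theta Q u) c1 => T X X0.
by field; rewrite X0 u0.
Qed.

End Scalars.

(** * The coefficients with their prefactor *)

Section RCoefficients.
Variable R : realType.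
Local Notation C := R[i].
Local Notation md := (@modulus R).
Variables (tau zeta : C) (N : nat).
Hypothesis tau_gt0 : 0 < complex.Im tau.
Hypothesis N_gt0 : (0 < N)%N.
Hypothesis q1 : md (epi zeta) < 1.
Local Notation f := (th tau).
Local Notation NC := (N%:R : C).
Local Notation q := (epi zeta).
Local Notation p := (epi (2 * tau)).
Local Notation Q := (q ^+ (2 * N)).
Local Notation B := (q ^+ (2 * N - 2)).
Local Notation h := (zeta / NC).

Let NC0 : NC != 0. Proof. by rewrite pnatr_eq0 -lt0n. Qed.
Let q0 : q != 0. Proof. exact: epi_neq0. Qed.
Let p0 : p != 0. Proof. exact: epi_neq0. Qed.
Let p1 : md p < 1. Proof. exact: nome_lt1. Qed.
Let Q0 : Q != 0. Proof. exact: expf_neq0. Qed.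
Let Q1 : md Q < 1. Proof. by rewrite modulusX exprn_ilt1 // muln_eq0 -lt0n N_gt0. Qed.

(** All scalar factors of the R-matrix; the powers of z combine to a constant. *)
Definition Rscalar (x : C) : C :=
  epi ((NC^-1 - 1) * zeta) * f zeta * (theta_quot N q (epi (2 * x)) * kappaV N (epi (2 * x)) q p) / f (x + zeta).

Lemma RscalarE x : tauN N (zeta / 2 - x) zeta *
  (epi ((2 / NC - 2) * x) * kappaV N (epi (2 * x)) q p * (f zeta / f (x + zeta))) = Rscalar x.
Proof.
rewrite /tauN /Rscalar /theta_quot.
have e1 : q * epi (2 * (zeta / 2 - x)) = q ^+ 2 / epi (2 * x).
  by rewrite -epiMn -epiN -!epiD; congr epi; field.
have e2 : q / epi (2 * (zeta / 2 - x)) = epi (2 * x) by rewrite -epiN -epiD; congr epi; field.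
rewrite e1 e2.
have e3 : epi ((NC^-1 - 1) * zeta) = epi ((2 / NC - 2) * (zeta / 2 - x)) * epi ((2 / NC - 2) * x).
  by rewrite -epiD; congr epi; field.
rewrite e3; move: (epi _) (epi _) (Theta _ _) (Theta _ _) (kappaV _ _ _ _) (f _) (f _) => *; ring.
Qed.

Definition rcoef (a b : int) (x : C) : C := Rscalar x * Wz tau N a b x h.

(** tau_N(q^(1/2)/z) tau_N(q^(1/2) z): its inverse relates the R-matrix at - p^(1/2) z to the
    R-matrix at z. It does not depend on p. *)
Definition tau_factor (x : C) : C := let v := epi (2 * x) in
  epi ((2 / NC - 2) * zeta) * (Theta Q (q ^+ 2 / v) * Theta Q (q ^+ 2 * v) / (Theta Q v * Theta Q v^-1)).

Definition reg (x : C) : Prop := regular N q p (epi (2 * x)).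

Lemma generic_reg : generic reg.
Proof. exact: (@generic_regular R N q p N_gt0 q0 q1 p0 p1). Qed.

Lemma Wz_shift a b x : Wz tau N a b (x + tau + 1) h =
  epi (2 * (a%:~R - b%:~R) / NC) * epi (- tau - 2 * x - 2 * h) * Wz tau N a b x h.
Proof.
rewrite /Wz (_ : x + tau + 1 + h + torsion tau N a b = x + h + torsion tau N a b + 1%:~R + 1%:~R * tau); last by ring.
rewrite th_add_lattice //.
set E1 := epi _; set E2 := epi _; set E3 := epi _; set E4 := epi _; set E5 := epi _.
have e : E1 * E2 = E3 * E4 * E5.
  rewrite /E1 /E2 /E3 /E4 /E5 -!epiD /torsion -[RHS](epi_addn _ 1); congr epi; field; exact: NC0.
clearbody E1 E2 E3 E4 E5.
move: (f _) (f _) => w u.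
transitivity (E1 * E2 * u / (NC * w)); first by ring.
by rewrite e; ring.
Qed.

Lemma Theta_reg x : reg x -> [/\ Theta Q (epi (2 * x)) != 0, Theta Q (epi (2 * x))^-1 != 0,
  Theta Q (q ^+ 2 * epi (2 * x)) != 0 & Theta Q (q ^+ 2 / epi (2 * x)) != 0].
Proof.
move=> [_ [_ [c1 c2 c3]]]; split=> //.
have v0 := epi_neq0 (2 * x); rewrite (ThetaV Q1 v0) oppr_eq0; exact: mulf_neq0 (invr_neq0 v0) c1.
Qed.

Lemma tau_factor_neq0 x : reg x -> tau_factor x != 0.
Proof.
move=> /Theta_reg[h1 h2 h3 h4].
apply: (mulf_neq0 (epi_neq0 _)); apply: mulf_neq0; first exact: mulf_neq0 h4 h3.
by apply: invr_neq0; exact: mulf_neq0 h1 h2.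
Qed.

(** The prefactor contributes the Theta functions, and the theta functions of W
    and of the denominator contribute exponentials whose x-dependence cancels. *)
Lemma rcoef_shift a b x : reg x -> reg (x + tau + 1) ->
  rcoef a b (x + tau + 1) = (tau_factor x)^-1 * epi (2 * (a%:~R - b%:~R) / NC) * rcoef a b x.
Proof.
move=> h1 h2; rewrite /rcoef Wz_shift.
have ev : epi (2 * (x + tau + 1)) = p * epi (2 * x).
  by rewrite -[RHS]epiD -[RHS](epi_addn _ 1); congr epi; ring.
have h2' : regular N q p (p * epi (2 * x)) by rewrite -ev.
have k := kappa_shift_p N_gt0 q0 q1 p0 p1 (epi_neq0 _) h1 h2'.
have [n1 n2 n3 n4] := Theta_reg h1.
rewrite /Rscalar /tau_factor ev (_ : x + tau + 1 + zeta = x + zeta + 1%:~R + 1%:~R * tau); last by ring.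
rewrite th_add_lattice //.
set V := epi (2 * x) in k n1 n2 n3 n4 *.
set K1 := kappaV _ V _ _ in k *; set K2 := kappaV _ (p * V) _ _ in k *.
have {}k : theta_quot N q (p * V) * K2 = K1 * Theta Q V^-1 / Theta Q (q ^+ 2 * V) by rewrite -k mulfK.
rewrite {}k /theta_quot.
set E1 := epi ((NC^-1 - 1) * zeta); set E2 := epi (1%:~R + 1%:~R - 1%:~R ^+ 2 * tau - 2 * 1%:~R * (x + zeta)).
set E3 := epi (2 * (a%:~R - b%:~R) / NC); set E4 := epi (- tau - 2 * x - 2 * h); set E5 := epi ((2 / NC - 2) * zeta).
have e : E2 = E4 * E5.
  rewrite /E2 /E4 /E5 -!epiD -[RHS](epi_addn _ 1); congr epi; field; exact: NC0.
have [z4 z5] : E4 != 0 /\ E5 != 0 by split; exact: epi_neq0.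
rewrite {}e; clearbody E1 E2 E3 E4 E5 V K1 K2.
move: (Theta _ _) (Theta _ _) (Theta _ _) (Theta _ _) n1 n2 n3 n4 (Wz _ _ _ _ _ _) (f zeta) (f (x + zeta)) => a1 a2 a3 a4 n1 n2 n3 n4 w u1 u2.
rewrite !invfM; move: (u2^-1) => u3.
by field; rewrite n1 n2 n3 n4 z4 z5.
Qed.

(** A shift of x by 1 multiplies the coefficient of index (a, b) by e^(2 i pi a / N). *)
Lemma rcoef_addN a b x (k : int) : rcoef a b (x + NC * k%:~R) = rcoef a b x.
Proof.
rewrite /rcoef /Rscalar /Wz.
have ev : epi (2 * (x + NC * k%:~R)) = epi (2 * x).
  by rewrite -[RHS](epi_addn _ (N%:Z * k)); congr epi; rewrite rmorphM /=; ring.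
have fE y : f (y + NC * k%:~R) = epi (NC * k%:~R) * f y.
  have := th_add_lattice tau_gt0 y (N%:Z * k) 0; rewrite mul0r addr0 rmorphM /= => ->.
  by congr (epi _ * _); ring.
rewrite ev (_ : x + NC * k%:~R + zeta = x + zeta + NC * k%:~R); last by ring.
rewrite (_ : x + NC * k%:~R + h + torsion tau N a b = x + h + torsion tau N a b + NC * k%:~R); last by ring.
rewrite !fE.
have -> : epi (2 * (a%:~R / NC) * (x + NC * k%:~R)) = epi (2 * (a%:~R / NC) * x).
  by rewrite -[RHS](epi_addn _ (a * k)); congr epi; rewrite rmorphM /=; field.
have := epi_neq0 (NC * k%:~R); move: (epi (NC * k%:~R)) => E E0.
rewrite !invfM; move: (f (x + zeta))^-1 (NC^-1 / _) (epi ((NC^-1 - 1) * zeta)) => y w e'.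
by field; rewrite E0.
Qed.

Lemma tau_factor_addint x (k : int) : tau_factor (x + k%:~R) = tau_factor x.
Proof. by rewrite /tau_factor mulrDr epi_addn. Qed.

(** x -> x + N zeta is v -> q^(2N) v, the quasi-period of Theta; the multipliers of the
    four factors cancel. *)
Lemma tau_factor_addNzeta x : tau_factor (x + NC * zeta) = tau_factor x.
Proof.
rewrite /tau_factor; have -> : epi (2 * (x + NC * zeta)) = Q * epi (2 * x).
  by rewrite -epiMn -epiD natrM; congr epi; ring.
have := epi_neq0 (2 * x); move: (epi (2 * x)) => v v0.
congr (_ * _).
have e1 := Theta_shift Q0 Q1 v0.
have z2 : q ^+ 2 * v != 0 by rewrite mulf_neq0 ?expf_neq0.
have e2 := Theta_shift Q0 Q1 z2.
have z3 : (Q * v)^-1 != 0 by rewrite invr_neq0 ?mulf_neq0.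
have e3 := Theta_shift Q0 Q1 z3.
have z4 : q ^+ 2 / (Q * v) != 0 by rewrite mulf_neq0 ?expf_neq0.
have e4 := Theta_shift Q0 Q1 z4.
have u3 : Q * (Q * v)^-1 = v^-1 by field; rewrite v0 Q0.
have u4 : Q * (q ^+ 2 / (Q * v)) = q ^+ 2 / v by field; rewrite v0 Q0.
have u2 : q ^+ 2 * (Q * v) = Q * (q ^+ 2 * v) by ring.
rewrite u3 in e3; rewrite u4 in e4; rewrite u2 e1 e2 e3 e4.
move: (Theta Q v) (Theta Q (q ^+ 2 * v)) (Theta Q (Q * v)^-1) (Theta Q (q ^+ 2 / (Q * v))) => a1 a2 a3 a4.
move: Q Q0 q0 => X X0; move: q => Y Y0.
rewrite !invfM !invrN !invfM !invrK; move: a1^-1 a3^-1 => b1 b3.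
by field; rewrite v0 X0 Y0.
Qed.

Lemma rcoef_iter a b x n : (forall j, (j <= n)%N -> reg (x + j%:R * (tau + 1))) ->
  rcoef a b (x + n%:R * (tau + 1)) =
  (\prod_(0 <= j < n) tau_factor (x + j%:R * (tau + 1)))^-1 * epi (2 * (a%:~R - b%:~R) / NC) ^+ n * rcoef a b x.
Proof.
elim: n => [|n IH] hr; first by rewrite big_geq // invr1 expr0 !mul1r mul0r addr0.
have hn := hr n (leqnSn n); have hn1 := hr n.+1 (leqnn _).
have e : x + n.+1%:R * (tau + 1) = x + n%:R * (tau + 1) + tau + 1 by rewrite -[n.+1]addn1 natrD; ring.
rewrite e in hn1 *; rewrite rcoef_shift // IH => [|j hj]; last exact: (hr j (leqW hj)).
rewrite big_nat_recr //=.
move: (\prod_(0 <= j < n) _) (tau_factor _) (epi _) (rcoef a b x) => P u w r.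
by rewrite invfM exprS; ring.
Qed.

(** The theta functions of modulus tau produced by kappa are those needed to
    normalize the crossing relation for the coefficients. *)
Lemma Rscalar_crossing x : reg x -> reg (x - NC * zeta) -> f (x + zeta) != 0 -> f (x - NC * zeta + zeta) != 0 ->
  Rscalar (x - NC * zeta) * (f x * f (x - NC * zeta)) = Rscalar x * (f (x + zeta) * f (x - zeta)).
Proof.
move=> h1 h2 n1 n2.
have ev : epi (2 * x) = Q * epi (2 * (x - NC * zeta)).
  by rewrite -epiMn -epiD natrM; congr epi; ring.
have h1' : regular N q p (Q * epi (2 * (x - NC * zeta))) by rewrite -ev.
have k1 := kappa_shift_Q N_gt0 q0 q1 p0 p1 (epi_neq0 _) h2 h1'.
have k2 := theta_quot_shift N_gt0 q0 q1 p0 p1 (epi_neq0 _) h2 h1'.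
rewrite /Rscalar k2 ev.
have fp y : f y = - epi (tau / 4 + 2^-1) * epi (- y) * Theta p (epi (2 * y)).
  by rewrite th_Theta // epiD; ring.
have fm y : f y = epi (tau / 4 + 2^-1) * epi y * Theta p (epi (2 * y))^-1.
  have -> : f y = - f (- y) by rewrite thN // opprK.
  by rewrite fp opprK mulrN epiN !mulNr opprK.
have f1 : f x = _ := fp x; have f2 := fm (x - NC * zeta).
have f3 := fm (x - zeta); have f4 := fp (x - NC * zeta + zeta).
have e3 : (epi (2 * (x - zeta)))^-1 = q ^+ 2 / (Q * epi (2 * (x - NC * zeta))).
  by rewrite -ev -epiMn -!epiN -epiD; congr epi; ring.
have e4 : epi (2 * (x - NC * zeta + zeta)) = q ^+ 2 * epi (2 * (x - NC * zeta)).
  by rewrite -epiMn -epiD; congr epi; ring.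
rewrite e3 in f3; rewrite e4 in f4; rewrite ev in f1.
set u := epi (2 * (x - NC * zeta)) in k1 f1 f2 f3 f4 *.
have eB : B * (epi (- x) * epi (x - NC * zeta)) = epi (x - zeta) * epi (- (x - NC * zeta + zeta)).
  have hN : (2 <= 2 * N)%N by rewrite -{1}[2%N]muln1 leq_pmul2l.
  by rewrite -epiMn -!epiD (natrB _ hN) natrM; congr epi; ring.
have key : B * kappaV N u q p * (f x * f (x - NC * zeta)) =
    kappaV N (Q * u) q p * (f (x - zeta) * f (x - NC * zeta + zeta)).
  rewrite f1 f2 f3 f4.
  move: k1 eB; move: (kappaV N u q p) (kappaV N (Q * u) q p) (Theta p u^-1) (Theta p (Q * u)) (Theta p (q ^+ 2 * u)) (Theta p (q ^+ 2 / (Q * u))) => k5 k6 t1 t2 t3 t4.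
  move: (epi (tau / 4 + 2^-1)) (epi (- x)) (epi (x - NC * zeta)) (epi (x - zeta)) (epi (- (x - NC * zeta + zeta))) => E1 E2 E3 E4 E5 k1 eB.
  transitivity (- E1 ^+ 2 * (B * (E2 * E3)) * (k5 * (t1 * t2))); first by ring.
  rewrite k1 eB; ring.
move: key n1 n2; move: (kappaV N u q p) (kappaV N (Q * u) q p) => k5 k6.
move: (f (x + zeta)) (f (x - zeta)) (f (x - NC * zeta + zeta)) (f x) (f (x - NC * zeta)) (f zeta) => t1 t2 t3 t4 t5 t6.
move: (theta_quot N q (Q * u)) (epi ((NC^-1 - 1) * zeta)) => T E key n1 n2.
transitivity (E * t6 * T / t3 * (B * k5 * (t4 * t5))); first by ring.
by rewrite key; field; rewrite n1 n2.
Qed.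

End RCoefficients.

(** * Unitarity and crossing of the R-matrix *)

Lemma conj_mulmx (V : pzRingType) n (D D' X Y : 'M[V]_n) : D' *m D = 1%:M ->
  (D *m X *m D') *m (D *m Y *m D') = D *m (X *m Y) *m D'.
Proof. by move=> e; rewrite !mulmxA -(mulmxA _ D') e mulmx1. Qed.

Lemma mulmx_entry (V : pzRingType) m n r (X : 'M[V]_(m, n)) (Y : 'M[V]_(n, r)) i j :
  (X *m Y) i j = \sum_k X i k * Y k j.
Proof. by rewrite mxE. Qed.

Lemma scalemx_entry (V : pzRingType) m n a (X : 'M[V]_(m, n)) i j : (a *: X) i j = a * X i j.
Proof. by rewrite mxE. Qed.

Section RMatrixSum.
Variable R : realType.
Local Notation C := R[i].
Variable N : nat.
Hypothesis N_gt0 : (0 < N)%N.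
Local Notation NC := (N%:R : C).
Local Notation I2 := ('I_N * 'I_N)%type.
Local Notation gh := (ghalf R N).
Local Notation ghV := (invmx (ghalf R N)).
Local Notation J := (J R N).
Local Notation JJ := (Jpair R N).

Let NC0 : NC != 0. Proof. by rewrite pnatr_eq0 -lt0n. Qed.

Lemma ghalf_diag : gh = diag_mx (\row_(i < N) epi (i%:R / NC)).
Proof. by apply/matrixP => i j; rewrite !mxE. Qed.

Lemma ghalf_unit : gh \in unitmx.
Proof.
rewrite ghalf_diag unitmxE det_diag unitfE; apply/prodf_neq0 => i _; rewrite mxE; exact: epi_neq0.
Qed.

(** Conjugation by g^(1/2) makes h into g^(1/2) h g^(-1/2), and with it
    g^(1/2) h g^(1/2) into the conjugate of h g. *)
Lemma ghalf_sqr : gh *m gh = gmx R N.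
Proof.
rewrite ghalf_diag mulmx_diag; apply/matrixP => i j; rewrite !mxE.
by rewrite -epiD; congr (epi _ *+ _); field.
Qed.

Fact conjJ_key : unit. Proof. by []. Qed.
Definition conjJ := locked_with conjJ_key (fun x y : int => gh *m J x y *m ghV : 'M[C]_N).

Lemma conjJE x y : conjJ x y = gh *m J x y *m ghV. Proof. by rewrite /conjJ unlock. Qed.

Lemma conjJM x y x' y' : conjJ x y *m conjJ x' y' = epi (2 * (x%:~R * y'%:~R) / NC) *: conjJ (x + x') (y + y').
Proof.
have e : ghV *m gh = 1%:M by exact: (mulVmx ghalf_unit).
rewrite !conjJE.
rewrite (conj_mulmx (J x y) (J x' y') e).
rewrite (@JM R N N_gt0 x y x' y').
rewrite -scalemxAr.
by rewrite -scalemxAl.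
Qed.

Lemma conjJ00 : conjJ 0 0 = 1%:M.
Proof. by rewrite conjJE J00 // mulmx1 mulmxV // ghalf_unit. Qed.

Lemma Gmx_conjJ : Gmx R N = epi (2 / NC) *: conjJ 1 1.
Proof.
have e : epi (2 / NC) *: J 1 1 = hmx R N *m gmx R N.
  by rewrite hmx_J // gmx_J // JM // addr0 add0r mulr1 mulr1.
rewrite conjJE scalemxAl scalemxAr e -ghalf_sqr !mulmxA mulmxK ?ghalf_unit //.
Qed.

Lemma Gmx_conjJM x y : Gmx R N *m conjJ x y = epi (2 * (y%:~R - x%:~R) / NC) *: (conjJ x y *m Gmx R N).
Proof.
rewrite Gmx_conjJ -scalemxAl -scalemxAr !conjJM !scalerA -!epiD (addrC x) (addrC y); congr (epi _ *: _); ring.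
Qed.

Lemma Gmx_unit : Gmx R N \in unitmx.
Proof.
have h : Gmx R N *m conjJ (-1) (-1) = 1%:M.
  rewrite Gmx_conjJ -scalemxAl (conjJM 1 1 (-1) (-1)) scalerA -epiD !subrr conjJ00.
  have -> : 2 / NC + 2 * (1%:~R * (-1)%:~R) / NC = 0 by ring.
  by rewrite epi0 scale1r.
by have [] := mulmx1_unit h.
Qed.

Fact Rgen_key : unit. Proof. by []. Qed.
Definition Rgen := locked_with Rgen_key
  (fun x y : int => tensmx gh gh *m JJ x y *m tensmx ghV ghV : 'M[C]_(N * N)).

Lemma Rgen_Jpair x y : Rgen x y = tensmx gh gh *m JJ x y *m tensmx ghV ghV.
Proof. by rewrite /Rgen unlock. Qed.

Lemma RgenE x y : Rgen x y = epi (2 * (x%:~R * y%:~R) / NC) *: tensmx (conjJ x y) (conjJ (- x) (- y)).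
Proof. by rewrite Rgen_Jpair !conjJE /Jpair -scalemxAr -scalemxAl !tensmx_mul. Qed.

Lemma RgenM x y x' y' : Rgen x y *m Rgen x' y' =
  epi (2 * (x%:~R * y'%:~R - x'%:~R * y%:~R) / NC) *: Rgen (x + x') (y + y').
Proof.
have e : tensmx ghV ghV *m tensmx gh gh = 1%:M by rewrite tensmx_mul mulVmx ?ghalf_unit // tensmx11.
by rewrite !Rgen_Jpair (conj_mulmx _ _ e) (@JpairM R N N_gt0 x y x' y') -scalemxAr -scalemxAl.
Qed.

Lemma Rgen00 : Rgen 0 0 = 1%:M.
Proof. by rewrite !Rgen_Jpair Jpair00 // mulmx1 tensmx_mul mulmxV ?ghalf_unit // tensmx11. Qed.

Lemma Rgen_per1 x y : Rgen (x + N%:Z) y = Rgen x y. Proof. by rewrite !Rgen_Jpair Jpair_per1. Qed.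
Lemma Rgen_per2 x y : Rgen x (y + N%:Z) = Rgen x y. Proof. by rewrite !Rgen_Jpair Jpair_per2. Qed.

Lemma Rgen_Gmx x y : tensmx (Gmx R N) 1%:M *m Rgen x y =
  epi (2 * (y%:~R - x%:~R) / NC) *: (Rgen x y *m tensmx (Gmx R N) 1%:M).
Proof.
rewrite RgenE -scalemxAl -scalemxAr !tensmx_mul mulmx1 mul1mx Gmx_conjJM.
by apply/matrixP => i j; rewrite !mxE; ring.
Qed.

Local Notation mi i m := (mxtens_index (i, m)).

(** The entry (m, l) of the partial trace over the first factor of X (T (x) 1) Y is
    the sum over j, k of crossform X Y m l j k times the entry T j k
    ([tr1_sandwich]): all commutative content of crossing is in this bilinear form. *)
Definition crossform (X Y : 'M[C]_(N * N)) (m l j k : 'I_N) : C :=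
  \sum_i \sum_n X (mi i m) (mi j n) * Y (mi k n) (mi i l).

Lemma crossform_suml (I : finType) (a : I -> C) (X : I -> 'M[C]_(N * N)) Y m l j k :
  crossform (\sum_al a al *: X al) Y m l j k = \sum_al a al * crossform (X al) Y m l j k.
Proof.
rewrite /crossform; under [RHS]eq_bigr => al _ do rewrite mulr_sumr.
rewrite [RHS]exchange_big; apply: eq_bigr => i _.
under [RHS]eq_bigr => al _ do rewrite mulr_sumr.
rewrite [RHS]exchange_big; apply: eq_bigr => n _.
by rewrite summxE mulr_suml; apply: eq_bigr => al _; rewrite !mxE mulrA.
Qed.

Lemma crossform_sumr (I : finType) (a : I -> C) (Y : I -> 'M[C]_(N * N)) X m l j k :
  crossform X (\sum_al a al *: Y al) m l j k = \sum_al a al * crossform X (Y al) m l j k.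
Proof.
rewrite /crossform; under [RHS]eq_bigr => al _ do rewrite mulr_sumr.
rewrite [RHS]exchange_big; apply: eq_bigr => i _.
under [RHS]eq_bigr => al _ do rewrite mulr_sumr.
rewrite [RHS]exchange_big; apply: eq_bigr => n _.
by rewrite summxE mulr_sumr; apply: eq_bigr => al _; rewrite !mxE mulrCA.
Qed.

Lemma Rgen_entry x y i j k l : Rgen x y (mi i j) (mi k l) =
  epi (2 * (x%:~R * y%:~R) / NC) * (conjJ x y i k * conjJ (- x) (- y) j l).
Proof. by rewrite RgenE [LHS]mxE tensmxE. Qed.

(** Only the sum of the two indices matters, phases included: the trace over the
    first factor is cyclic, which reverses the order of the product there. *)
Lemma crossform_Rgen x y x' y' m l j k : crossform (Rgen x y) (Rgen x' y') m l j k =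
  epi (2 * ((x + x')%:~R * (y + y')%:~R) / NC) * (conjJ (x + x') (y + y') k j * conjJ (- (x + x')) (- (y + y')) m l).
Proof.
set u := epi (2 * (x%:~R * y%:~R) / NC); set u' := epi (2 * (x'%:~R * y'%:~R) / NC).
have -> : crossform (Rgen x y) (Rgen x' y') m l j k =
    u * u' * ((conjJ x' y' *m conjJ x y) k j * (conjJ (- x) (- y) *m conjJ (- x') (- y')) m l).
  rewrite (mulmx_entry (conjJ x' y') (conjJ x y) k j) (mulmx_entry (conjJ (- x) (- y)) (conjJ (- x') (- y')) m l) mulr_suml mulr_sumr; apply: eq_bigr => i _.
  rewrite mulr_sumr mulr_sumr; apply: eq_bigr => n _.
  have e1 := Rgen_entry x y i m j n; have e2 := Rgen_entry x' y' k n i l; rewrite -/u in e1; rewrite -/u' in e2.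
  transitivity ((u * (conjJ x y i j * conjJ (- x) (- y) m n)) * (u' * (conjJ x' y' k i * conjJ (- x') (- y') n l))).
    by congr (_ * _).
  by move: (conjJ x y i j) (conjJ x' y' k i) (conjJ _ _ m n) (conjJ _ _ n l) => *; ring.
rewrite (conjJM x' y' x y) (conjJM (- x) (- y) (- x') (- y')) scalemx_entry scalemx_entry -!opprD (addrC x') (addrC y').
set v := epi _; set v' := epi _; set w := epi _.
have e : u * u' * v * v' = w.
  by rewrite /u /u' /v /v' /w -!epiD; congr epi; rewrite !rmorphN !rmorphD /=; ring.
by clearbody u u' v v' w; rewrite -e; move: (conjJ _ _ k j) (conjJ _ _ m l) => *; ring.
Qed.

End RMatrixSum.

Section RMatrix.
Variable R : realType.
Local Notation C := R[i].
Local Notation md := (@modulus R).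
Variables (tau zeta : C) (N : nat).
Hypothesis tau_gt0 : 0 < complex.Im tau.
Hypothesis N_gt0 : (0 < N)%N.
Local Notation f := (th tau).
Local Notation NC := (N%:R : C).
Local Notation I2 := ('I_N * 'I_N)%type.
Local Notation h := (zeta / NC).
Local Notation Rgen := (Rgen R N).
Local Notation Rscalar := (Rscalar tau zeta N).
Local Notation rcoef := (rcoef tau zeta N).
Hypothesis hR : R_defined N zeta tau.

Let NC0 : NC != 0. Proof. by rewrite pnatr_eq0 -lt0n. Qed.
Let hh : offtors tau N h. Proof. exact: R_definedP. Qed.

Lemma Rhat_sum x : Rhat N x zeta tau = \sum_(al : I2) rcoef al.1 al.2 x *: Rgen al.1 al.2.
Proof.
rewrite /Rhat /Rmx /Rtilde -scalemxAr -scalemxAl scalerA -!th_theta RscalarE //.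
rewrite pair_bigA mulmx_sumr mulmx_suml scaler_sumr; apply: eq_bigr => -[a b] _ /=.
rewrite (@WE R tau tau_gt0 N N_gt0 a b x zeta hh) (@Jpair_tens R N N_gt0 a b).
by rewrite Rgen_Jpair -(scalemxAr _ (tensmx (ghalf R N) (ghalf R N))) -scalemxAl scalerA.
Qed.

(** The value of sumW_unit at ga = 0, by which the product of the two sums has to be divided. *)
Definition inversion_factor x := - (f (x + zeta) * f (x - zeta)) / f zeta ^+ 2.

(** Same generators with zeta / N replaced by its opposite, as if q were 1/q. *)
Definition Rinv x : 'M[C]_(N * N) := \sum_(al : I2) ((Rscalar x * inversion_factor x)^-1 * Wz tau N al.1 al.2 x (- h)) *: Rgen al.1 al.2.

Lemma sum_I2_00 (V : zmodType) (F : I2 -> V) (G : V) :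
  (forall al : I2, F al = if ((al.1 : nat) == 0%N) && ((al.2 : nat) == 0%N) then G else 0) -> \sum_al F al = G.
Proof.
move=> hF; pose z : I2 := (Ordinal N_gt0, Ordinal N_gt0).
rewrite (bigD1 z) //= hF /= big1 ?addr0 // => -[[a ha] [b hb]] n; rewrite hF /=.
case: ifP => // /andP[/eqP a0 /eqP b0]; case/eqP: n; congr pair; exact: val_inj.
Qed.

(** The product of two generators is a generator up to a phase, so the product of the
    two sums is sorted by generator and its coefficients are those of [sumW_unit]. *)
Lemma Rhat_inv x : Rscalar x != 0 -> inversion_factor x != 0 -> Rhat N x zeta tau *m Rinv x = 1%:M.
Proof.
move=> r0 ph0; rewrite Rhat_sum /Rinv mulmx_suml.
under eq_bigr => al _ do rewrite mulmx_sumr.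
pose F a b c d := (Rscalar x * Wz tau N a b x h) * ((Rscalar x * inversion_factor x)^-1 * Wz tau N c d x (- h)) *:
  (epi (2 * (a%:~R * d%:~R - c%:~R * b%:~R) / NC) *: Rgen (a + c) (b + d)).
transitivity (\sum_(al : I2) \sum_(be : I2) F al.1 al.2 be.1 be.2).
  by apply: eq_bigr => al _; apply: eq_bigr => be _; rewrite -scalemxAl -scalemxAr scalerA RgenM.
rewrite (@big_convolution N _ F); first last.
- move=> a b c d; rewrite /F (Wz_per2 tau_gt0 N_gt0) addrA (@Rgen_per2 R N N_gt0); congr (_ *: (_ *: _)).
  rewrite -[RHS](epi_addn _ a); congr epi; rewrite rmorphD /=; field; exact: NC0.
- move=> a b c d; rewrite /F (Wz_per1 tau_gt0 N_gt0) addrA (@Rgen_per1 R N N_gt0); congr (_ *: (_ *: _)).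
  rewrite -[RHS](epi_addn _ (- b)); congr epi; rewrite rmorphD rmorphN /=; field; exact: NC0.
apply: sum_I2_00 => -[k l] /=.
transitivity (((inversion_factor x)^-1 * (\sum_(al : I2) epi (2 * ((al.1 : nat)%:R * l%:R - k%:R * (al.2 : nat)%:R) / NC) *
    (Wz tau N al.1 al.2 x h * Wz tau N (k%:Z - al.1%:Z) (l%:Z - al.2%:Z) x (- h)))) *: Rgen k l).
  rewrite mulr_sumr scaler_suml; apply: eq_bigr => al _; rewrite /F.
  have -> : al.1%:Z + (k%:Z - al.1%:Z) = k by ring.
  have -> : al.2%:Z + (l%:Z - al.2%:Z) = l by ring.
  rewrite scalerA; congr (_ *: _).
  have -> : (al.1%:Z)%:~R * (l%:Z - al.2%:Z)%:~R - (k%:Z - al.1%:Z)%:~R * (al.2%:Z)%:~R =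
    (al.1 : nat)%:R * l%:R - k%:R * (al.2 : nat)%:R :> C by rewrite !rmorphB /=; ring.
  move: (epi _) (Wz _ _ _ _ _ _) (Wz _ _ _ _ _ _) => E w1 w2.
  by rewrite invfM; move: (inversion_factor x)^-1 => u; field.
rewrite sumW_unit // mulrCA divff // mulr1 -/(inversion_factor x).
case: ifP => [/andP[/eqP -> /eqP ->]|_]; last by rewrite mulr0 scale0r.
by rewrite mulVf // scale1r Rgen00.
Qed.

(** Only the coefficient of index (0, 0) survives, where the generators are
    the identity. *)
Lemma crossing x y : x - y = - (NC * zeta) -> Rscalar x * (f x * f y) = Rscalar y * (f (y + zeta) * f (y - zeta)) ->
  f zeta != 0 -> Rscalar y != 0 -> inversion_factor y != 0 ->
  forall m l j k, crossform (Rhat N x zeta tau) (Rinv y) m l j k = ((k == j) && (m == l))%:R.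
Proof.
move=> hxy hrho f0 r0 ph0 m l j k; rewrite Rhat_sum /Rinv crossform_suml.
under eq_bigr => al _ do rewrite crossform_sumr mulr_sumr.
pose F a b c d := (Rscalar x * Wz tau N a b x h) * (((Rscalar y * inversion_factor y)^-1 * Wz tau N c d y (- h)) *
  crossform (Rgen a b) (Rgen c d) m l j k).
transitivity (\sum_(al : I2) \sum_(be : I2) F al.1 al.2 be.1 be.2) => //.
rewrite (@big_convolution N _ F); first last.
- by move=> a b c d; rewrite /F Wz_per2 // Rgen_per2.
- by move=> a b c d; rewrite /F Wz_per1 // Rgen_per1.
apply: sum_I2_00 => -[a b] /=.
pose G : C := epi (2 * ((a : nat)%:R * (b : nat)%:R) / NC) * (conjJ R N a b k j * conjJ R N (- a%:Z) (- b%:Z) m l).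
transitivity (Rscalar x / (Rscalar y * inversion_factor y) * (\sum_(al : I2)
    Wz tau N al.1 al.2 x h * Wz tau N (a%:Z - al.1%:Z) (b%:Z - al.2%:Z) y (- h)) * G).
  rewrite mulr_sumr mulr_suml; apply: eq_bigr => al _; rewrite /F crossform_Rgen //.
  have -> : al.1%:Z + (a%:Z - al.1%:Z) = a by ring.
  have -> : al.2%:Z + (b%:Z - al.2%:Z) = b by ring.
  rewrite -/G; ring.
rewrite sumW_cross //; last by rewrite hxy expr2 -mulrA [NC * (zeta / _)]mulrC divfK.
case: ifP => [/andP[/eqP a0 /eqP b0]|_]; last by rewrite mulr0 mul0r.
have -> : G = ((k == j) && (m == l))%:R.
  by rewrite /G a0 b0 mul0r mulr0 mul0r epi0 mul1r oppr0 conjJ00 // !mxE -natrM mulnb.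
move: ph0 hrho; rewrite /inversion_factor (_ : NC * h = zeta); last by rewrite mulrC divfK.
rewrite !mulf_eq0 !negb_or oppr_eq0 mulf_eq0 negb_or => /andP[/andP[n1 n2] _].
move: (f (y + zeta)) (f (y - zeta)) (f x) (f y) (f zeta) (Rscalar x) (Rscalar y) n1 n2 f0 r0 => t1 t2 t3 t4 t5 r1 r2 n1 n2 f0 r0 hr.
transitivity ((r1 * (t3 * t4)) / (r2 * (t1 * t2)) * ((k == j) && (m == l))%:R).
  by field; rewrite n1 n2 f0 r0.
rewrite hr divff ?mul1r //; exact: mulf_neq0 r0 (mulf_neq0 n1 n2).
Qed.

End RMatrix.

(** * Quasi-periodicity and the surface *)

Section Surface.
Variable R : realType.
Local Notation C := R[i].
Local Notation md := (@modulus R).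
Variables (tau zeta : C) (N : nat).
Hypothesis tau_gt0 : 0 < complex.Im tau.
Hypothesis N_gt0 : (0 < N)%N.
Hypothesis q1 : md (epi zeta) < 1.
Hypothesis hR : R_defined N zeta tau.
Local Notation f := (th tau).
Local Notation NC := (N%:R : C).
Local Notation I2 := ('I_N * 'I_N)%type.
Local Notation q := (epi zeta).
Local Notation p := (epi (2 * tau)).
Local Notation Q := (q ^+ (2 * N)).
Local Notation U := (tau_factor zeta N).
Local Notation reg := (reg tau zeta N).
Local Notation rcoef := (rcoef tau zeta N).
Local Notation Rscalar := (Rscalar tau zeta N).
Local Notation RR x := (Rhat N x zeta tau).
Local Notation G1 := (tensmx (Gmx R N) (1%:M : 'M[C]_N)).
Local Notation Gi1 := (tensmx (invmx (Gmx R N)) (1%:M : 'M[C]_N)).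

Let NC0 : NC != 0. Proof. by rewrite pnatr_eq0 -lt0n. Qed.

(** Conjugation by the Heisenberg element of index (1, 1) multiplies the generator of
    index (a, b) by om^(b - a), the inverse of the phase in the shift of its
    coefficient. *)
Lemma Rhat_shift x : reg x -> reg (x + tau + 1) ->
  G1 *m RR (x + tau + 1) = ((U x)^-1 *: RR x) *m G1.
Proof.
move=> h1 h2; rewrite !(Rhat_sum tau_gt0 N_gt0 hR) mulmx_sumr scaler_sumr mulmx_suml.
apply: eq_bigr => al _; rewrite -(scalemxAr _ G1) (@Rgen_Gmx R N N_gt0) scalerA -!scalemxAl scalerA.
congr (_ *: _); rewrite (rcoef_shift tau_gt0 N_gt0 q1) //.
set E := epi (2 * (al.1%:~R - al.2%:~R) / NC); set E' := epi _.
have e : E * E' = 1 by rewrite /E /E' -epiD -[RHS]epi0; congr epi; ring.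
move: e; clearbody E E'; move: (U x)^-1 (rcoef _ _ _) => u r e.
by transitivity ((E * E') * (u * r)); [ring | rewrite e mul1r].
Qed.

Lemma Rhat_shift_inv x : reg x -> reg (x + tau + 1) ->
  RR (x + tau + 1) *m Gi1 = Gi1 *m ((U x)^-1 *: RR x).
Proof.
move=> h1 h2; have e := Rhat_shift h1 h2.
have g1 : Gi1 *m G1 = 1%:M by rewrite tensmx_mul mulVmx ?Gmx_unit // mulmx1 tensmx11.
have g2 : G1 *m Gi1 = 1%:M by rewrite tensmx_mul mulmxV ?Gmx_unit // mulmx1 tensmx11.
move: (RR _) (_ *: RR x) G1 Gi1 e g1 g2 => X Y D E e g1 g2.
by rewrite -[X]mul1mx -g1 -(mulmxA E) e -!mulmxA g2 mulmx1.
Qed.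

(** A shift by k (tau + 1) in x is multiplication by p^k in e^(2 i pi x). *)
Lemma epi_shift_powers x (k : int) (w := epi (2 * (x + k%:~R * (tau + 1)))) :
  (epi (- x) ^- 2 * p ^ k = w) /\ (epi (- x) ^+ 2 * p ^ (- k) = w^-1).
Proof.
have e2 : epi (- x) ^- 2 = epi (2 * x) by rewrite epiN exprVn invrK -epiMn.
have e : epi (2 * x) * p ^ k = w.
  by rewrite -epiMz -epiD -[RHS](epi_addn _ (- k)); congr epi; rewrite rmorphN /=; ring.
by rewrite e2; split=> //; rewrite -e invfM -e2 invrK invr_expz.
Qed.

Lemma U_power (n : nat) : epi ((2 / NC - 2) * zeta) ^- (N * n) = q ^+ (2 * n * (N - 1)).
Proof.
rewrite -exprVn -epiN -!epiMn; congr epi.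
by rewrite !natrM natrB //; field.
Qed.

Lemma Fexch_pos (M : int) x : 0 < M -> Fexch N M q p (epi (- x)) =
  \prod_(0 <= k < N * `|M|) (U (x - k%:R * (tau + 1)))^-1.
Proof.
move=> M0; rewrite /Fexch M0 -U_power.
transitivity (\prod_(0 <= k < N * `|M|) ((epi ((2 / NC - 2) * zeta))^-1 *
  ((Theta Q (epi (- x) ^- 2 * p ^- k) * Theta Q (epi (- x) ^+ 2 * p ^+ k)) /
   (Theta Q (epi (- x) ^- 2 * q ^+ 2 * p ^- k) * Theta Q (epi (- x) ^+ 2 * q ^+ 2 * p ^+ k))))).
  by rewrite [RHS]big_split /= prodr_const_nat subn0 exprVn.
apply: eq_bigr => k _; have [e1 e2] := epi_shift_powers x (- k%:Z).
rewrite opprK rmorphN /= mulNr in e1 e2.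
have {}e1 : epi (- x) ^- 2 * p ^- k = epi (2 * (x - k%:R * (tau + 1))) by rewrite -e1 -invr_expz.
have {}e2 : epi (- x) ^+ 2 * p ^+ k = (epi (2 * (x - k%:R * (tau + 1))))^-1 := e2.
rewrite /tau_factor (mulrAC _ (q ^+ 2)) (mulrAC (epi (- x) ^+ 2)) e1 e2.
move: (epi (2 * _)) (epi (_ * zeta)) => w E.
rewrite [w * _]mulrC [w^-1 * _]mulrC.
move: (Theta Q w) (Theta Q w^-1) (Theta Q (q ^+ 2 * w)) (Theta Q (q ^+ 2 / w)) => a b c d.
by rewrite !invfM !invrK; ring.
Qed.

Lemma Fexch_neg (M : int) x : M < 0 -> Fexch N M q p (epi (- x)) =
  \prod_(1 <= k < (N * `|M|).+1) U (x + k%:R * (tau + 1)).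
Proof.
move=> M0; rewrite /Fexch ltNge (ltW M0) /= -U_power invrK.
transitivity (\prod_(1 <= k < (N * `|M|).+1) (epi ((2 / NC - 2) * zeta) *
  ((Theta Q (epi (- x) ^- 2 * q ^+ 2 * p ^+ k) * Theta Q (epi (- x) ^+ 2 * q ^+ 2 * p ^- k)) /
   (Theta Q (epi (- x) ^- 2 * p ^+ k) * Theta Q (epi (- x) ^+ 2 * p ^- k))))).
  by rewrite [RHS]big_split /= prodr_const_nat subSS subn0.
apply: eq_bigr => k _; have [e1 e2] := epi_shift_powers x k%:Z.
have {}e2 : epi (- x) ^+ 2 * p ^- k = (epi (2 * (x + k%:R * (tau + 1))))^-1 by rewrite -e2 -invr_expz.
have {}e1 : epi (- x) ^- 2 * p ^+ k = epi (2 * (x + k%:R * (tau + 1))) := e1.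
rewrite /tau_factor (mulrAC _ (q ^+ 2)) (mulrAC (epi (- x) ^+ 2)) e1 e2.
move: (epi (2 * _)) (epi (_ * zeta)) => w E.
rewrite [w * _]mulrC [w^-1 * _]mulrC.
move: (Theta Q w) (Theta Q w^-1) (Theta Q (q ^+ 2 * w)) (Theta Q (q ^+ 2 / w)) => a b c d.
by rewrite !invfM; ring.
Qed.

(** The condition at exponent 2/N determines (c + N) zeta + N M tau up to a multiple of N, which
    is the period of the coefficients. *)
Lemma surface_shift M c : on_surface N M zeta tau c ->
  exists k : int, forall x, x + c * zeta = x - NC * zeta - (N%:Z * M)%:~R * (tau + 1) + NC * k%:~R.
Proof.
move=> [_ h2].
have e : epi (- 2 / NC * (c + NC) * zeta - M%:~R * (2 * tau)) = 1.
  by rewrite epiB -h2 epiMz divff // expfz_neq0 // epi_neq0.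
have [n hn] := epi_eq1 e; exists (M - n) => x.
have {}hn : c * zeta = - (NC * zeta) - NC * M%:~R * tau - NC * n%:~R.
  have -> : n%:~R = (- 2 / NC * (c + NC) * zeta - M%:~R * (2 * tau)) / 2 :> C.
    by rewrite hn mulrAC divff ?mul1r // pnatr_eq0.
  by field.
by rewrite hn rmorphB rmorphM /=; ring.
Qed.

(** The conjugations by g^(1/2) h g^(1/2) have order N, and N |M| of them occur. *)
Lemma phase_trivial (al : I2) n : epi (2 * (al.1%:~R - al.2%:~R) / NC : C) ^+ (N * n) = 1.
Proof.
rewrite -epiMn natrM -[RHS](epi_even R (n%:Z * (al.1%:Z - al.2%:Z))); congr epi.
by rewrite rmorphM rmorphB /=; field.
Qed.

Lemma Rhat_iter x n : (forall j, (j <= N * n)%N -> reg (x + j%:R * (tau + 1))) ->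
  RR (x + (N * n)%:R * (tau + 1)) = (\prod_(0 <= j < N * n) U (x + j%:R * (tau + 1)))^-1 *: RR x.
Proof.
move=> h; rewrite !(Rhat_sum tau_gt0 N_gt0 hR) scaler_sumr; apply: eq_bigr => al _.
by rewrite (rcoef_iter tau_gt0 N_gt0 q1 _ _ h) phase_trivial mulr1 scalerA.
Qed.

Lemma Rhat_addN x (k : int) : RR (x + NC * k%:~R) = RR x.
Proof.
rewrite !(Rhat_sum tau_gt0 N_gt0 hR); apply: eq_bigr => al _.
by rewrite (rcoef_addN zeta tau_gt0 N_gt0).
Qed.

(** Regularity along the N |M| steps of length tau + 1 that lead from x - N zeta to
    x + c zeta, modulo N. *)
Definition surface_path (M : int) (x : C) : Prop := forall j, (j < (N * `|M|).+1)%N ->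
  reg (x - NC * zeta + (if 0 < M then - (j%:R * (tau + 1)) else j%:R * (tau + 1))).

(** kk collects the values of U along the steps. With U(x) and U(y) it telescopes
    to F, whose product runs over the same points except for one end. *)
Lemma Rhat_surface M c x : M != 0 -> on_surface N M zeta tau c -> surface_path M x ->
  exists2 kk, kk != 0 & RR (x + c * zeta) = kk *: RR (x - NC * zeta) /\
    U x * kk * Fexch N M q p (epi (- x)) = U (x + c * zeta).
Proof.
move=> M0 /surface_shift [k hk] hp; rewrite (hk x) Rhat_addN.
have Uk z : U (z + NC * k%:~R) = U z.
  by rewrite -(tau_factor_addint zeta N z (N%:Z * k)) rmorphM.
have UN z : U (z - NC * zeta) = U z by rewrite -(tau_factor_addNzeta N_gt0 q1) subrK.
rewrite Uk; set x' := x - NC * zeta; set n := (N * `|M|)%N.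
have [Mp|Mn|] := ltrgt0P M; last by move/eqP; rewrite (negbTE M0).
- have eM : (N%:Z * M)%:~R = n%:R :> C by rewrite /n rmorphM -{1}(gtz0_abs Mp) natrM.
  rewrite eM; set y := x' - n%:R * (tau + 1); pose g j := U (y + j%:R * (tau + 1)).
  have ey : x' = y + n%:R * (tau + 1) by rewrite subrK.
  have hr j : (j <= n)%N -> reg (y + j%:R * (tau + 1)).
    move=> jn; have := hp (n - j)%N; rewrite Mp ltnS leq_subr => /(_ isT).
    by rewrite natrB // (_ : _ - (_ * _) = y + j%:R * (tau + 1)) // /y /x'; ring.
  have gn0 j : (j <= n)%N -> g j != 0 by move=> jn; exact: (tau_factor_neq0 N_gt0 q1 (hr j jn)).
  have P0 : \prod_(0 <= j < n) g j != 0.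
    by rewrite prodf_seq_neq0; apply/allP => j; rewrite mem_index_iota => /andP[_ jn]; exact: gn0 (ltnW jn).
  exists (\prod_(0 <= j < n) g j) => //; split.
    by rewrite ey (Rhat_iter hr) scalerA -/n divff // scale1r.
  rewrite (Fexch_pos x Mp) -/n.
  have eU : U x = g n by rewrite -UN -/x' ey.
  have eUy : U y = g 0%N by rewrite /g mul0r addr0.
  have -> : \prod_(0 <= j < n) (U (x - j%:R * (tau + 1)))^-1 = (\prod_(0 <= j < n) g j.+1)^-1.
    rewrite prodfV; congr (_^-1); rewrite [RHS]big_nat_rev /=; apply: eq_big_nat => j /andP[_ jn].
    rewrite -UN /g; congr U; rewrite add0n -subSn // subSS natrB; last exact: ltnW.
    by rewrite /y /x'; ring.
  have e : \prod_(0 <= j < n) g j * g n = g 0%N * \prod_(0 <= j < n) g j.+1.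
    by rewrite -big_nat_recr // big_nat_recl.
  have P1 : \prod_(0 <= j < n) g j.+1 != 0.
    by rewrite prodf_seq_neq0; apply/allP => j; rewrite mem_index_iota => /andP[_ jn]; exact: gn0.
  rewrite eU eUy; move: e P1; move: (\prod_(0 <= j < n) g j) (\prod_(0 <= j < n) g j.+1) (g n) (g 0%N) => a b d d0 e b0.
  by rewrite [d * a]mulrC e mulfK.
have eM : (N%:Z * M)%:~R = - n%:R :> C.
  have eM0 : M = - (`|M|%N)%:Z by rewrite (ltz0_abs Mn) opprK.
  by rewrite /n rmorphM {1}eM0 rmorphN /= natrM mulrN.
rewrite eM mulNr opprK; pose g j := U (x' + j%:R * (tau + 1)).
have hr j : (j <= n)%N -> reg (x' + j%:R * (tau + 1)).
  by move=> jn; have := hp j; rewrite ltNge (ltW Mn) /= ltnS; apply.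
have gn0 j : (j <= n)%N -> g j != 0 by move=> jn; exact: (tau_factor_neq0 N_gt0 q1 (hr j jn)).
have P0 : \prod_(0 <= j < n) g j != 0.
  by rewrite prodf_seq_neq0; apply/allP => j; rewrite mem_index_iota => /andP[_ jn]; exact: gn0 (ltnW jn).
exists (\prod_(0 <= j < n) g j)^-1; first exact: invr_neq0; split; first exact: (Rhat_iter hr).
rewrite (Fexch_neg x Mn) -/n.
have eU : U x = g 0%N by rewrite /g mul0r addr0 UN.
have -> : \prod_(1 <= j < n.+1) U (x + j%:R * (tau + 1)) = \prod_(0 <= j < n) g j.+1.
  rewrite big_add1 /=; apply: eq_bigr => j _; rewrite -UN /g; congr U; rewrite /x'; ring.
have e : g 0%N * \prod_(0 <= j < n) g j.+1 = \prod_(0 <= j < n) g j * g n.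
  by rewrite -big_nat_recr // big_nat_recl.
rewrite eU -[RHS]/(g n); move: e P0; move: (\prod_(0 <= j < n) g j) (\prod_(0 <= j < n) g j.+1) (g n) (g 0%N) => a b d d0 e a0.
by rewrite mulrAC e mulrC mulKf.
Qed.

End Surface.

(** * Partial traces with noncommuting entries *)

Section Operators.
Variables (R : realType) (N : nat) (A : algType R[i]).
Local Notation C := R[i].
Local Notation mi i m := (mxtens_index (i, m)).
Local Notation toA := (@toA R A _).

Lemma toAM m (X Y : 'M[C]_m) : toA (X *m Y) = toA X *m toA Y.
Proof. exact: map_mxM. Qed.

Lemma toA1 m : toA (1%:M : 'M[C]_m) = 1%:M.
Proof. exact: map_mx1. Qed.

Lemma toA_entry m (X : 'M[C]_m) i j : toA X i j = (X i j)%:A.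
Proof. by rewrite mxE. Qed.

Lemma sum_mi (V : nmodType) (F : 'I_(N * N) -> V) : \sum_k F k = \sum_i \sum_m F (mi i m).
Proof.
rewrite pair_bigA /= (reindex (@mxtens_index N N)) /=; first by apply: eq_bigr => -[i m] _.
by exists (@mxtens_unindex N N) => k _; rewrite ?mxtens_indexK ?mxtens_unindexK.
Qed.

Lemma tens1_entry (X : 'M[A]_N) i j k l : tens1 X (mi i j) (mi k l) = X i k *+ (j == l).
Proof. by rewrite /tens1 tensmxE [_ j l]mxE mulr_natr. Qed.

Lemma tens2_entry (X : 'M[A]_N) i j k l : tens2 X (mi i j) (mi k l) = X j l *+ (i == k).
Proof. by rewrite /tens2 tensmxE [_ i k]mxE mulr_natl. Qed.

Lemma mul_tens1_entry (X : 'M[A]_N) (Z : 'M[A]_(N * N)) i m t :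
  (tens1 X *m Z) (mi i m) t = \sum_j X i j * Z (mi j m) t.
Proof.
rewrite mulmx_entry sum_mi; apply: eq_bigr => j _; rewrite (bigD1 m) //= big1 ?addr0 => [|n nm].
  by rewrite tens1_entry eqxx.
by rewrite tens1_entry eq_sym (negbTE nm) mulr0n mul0r.
Qed.

Lemma mul_tens2_entry (X : 'M[A]_N) (Z : 'M[A]_(N * N)) i m t :
  (tens2 X *m Z) (mi i m) t = \sum_n X m n * Z (mi i n) t.
Proof.
rewrite mulmx_entry sum_mi exchange_big; apply: eq_bigr => n _; rewrite (bigD1 i) //= big1 ?addr0 => [|j ji].
  by rewrite tens2_entry eqxx.
by rewrite tens2_entry eq_sym (negbTE ji) mulr0n mul0r.
Qed.

Lemma mul_entry_tens2 (X : 'M[A]_N) (Z : 'M[A]_(N * N)) i m t :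
  (Z *m tens2 X) t (mi i m) = \sum_n Z t (mi i n) * X n m.
Proof.
rewrite mulmx_entry sum_mi exchange_big; apply: eq_bigr => n _; rewrite (bigD1 i) //= big1 ?addr0 => [|j ji].
  by rewrite tens2_entry eqxx.
by rewrite tens2_entry (negbTE ji) mulr0n mulr0.
Qed.

Lemma mi_matrixP (X Y : 'M[A]_(N * N)) :
  (forall i m j n, X (mi i m) (mi j n) = Y (mi i m) (mi j n)) -> X = Y.
Proof.
by move=> e; apply/matrixP => s t; case: (mxtens_indexP s) => i m; case: (mxtens_indexP t) => j n.
Qed.

Lemma tens1M (X Y : 'M[A]_N) : tens1 (X *m Y) = tens1 X *m tens1 Y.
Proof.
apply: mi_matrixP => i m j n; rewrite mul_tens1_entry tens1_entry mulmx_entry -sumrMnl.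
by apply: eq_bigr => k _; rewrite tens1_entry mulrnAr.
Qed.

Lemma tens1_1 : tens1 (1%:M : 'M[A]_N) = 1%:M.
Proof. exact: tensmx11. Qed.

Lemma tens1_toA (B : 'M[C]_N) : toA (tensmx B 1%:M) = tens1 (toA B).
Proof.
apply: mi_matrixP => i m j n; rewrite tens1_entry !toA_entry tensmxE [_ m n]mxE mulr_natr.
by rewrite scalerMnl.
Qed.

Lemma tens1_tens2_comm (B : 'M[C]_N) (X : 'M[A]_N) : tens1 (toA B) *m tens2 X = tens2 X *m tens1 (toA B).
Proof.
apply: mi_matrixP => i m j n; rewrite mul_tens1_entry mul_tens2_entry.
rewrite (bigD1 j) //= big1 ?addr0 => [|k kj]; last by rewrite tens2_entry (negbTE kj) mulr0n mulr0.
rewrite (bigD1 n) //= big1 ?addr0 => [|k kn]; last by rewrite tens1_entry (negbTE kn) mulr0n mulr0.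
by rewrite tens1_entry tens2_entry !eqxx !mulr1n toA_entry mulr_algl mulr_algr.
Qed.

(** Partial trace over the first tensor factor. *)
Definition tr1 (Z : 'M[A]_(N * N)) : 'M[A]_N := \matrix_(m, l) \sum_i Z (mi i m) (mi i l).

Lemma tr1_tens2l (X T : 'M[A]_N) m l : tr1 (tens2 X *m tens1 T) m l = X m l * \tr T.
Proof.
rewrite mxE mulr_sumr; apply: eq_bigr => i _; rewrite mul_tens2_entry.
rewrite (bigD1 l) //= big1 ?addr0 => [|k kl]; last by rewrite tens1_entry (negbTE kl) mulr0n mulr0.
by rewrite tens1_entry eqxx.
Qed.

Lemma tr1_tens2r (X : 'M[A]_N) (Z : 'M[A]_(N * N)) : tr1 (Z *m tens2 X) = tr1 Z *m X.
Proof.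
apply/matrixP => m l; rewrite mxE mulmx_entry.
under [RHS]eq_bigr => n _ do rewrite mxE mulr_suml.
by rewrite [RHS]exchange_big; apply: eq_bigr => i _; rewrite mul_entry_tens2.
Qed.

Lemma tr1_sandwich (X Y : 'M[C]_(N * N)) (T : 'M[A]_N) m l :
  tr1 (toA X *m tens1 T *m toA Y) m l = \sum_j \sum_k crossform X Y m l j k *: T j k.
Proof.
rewrite mxE.
transitivity (\sum_i \sum_j \sum_k \sum_n (X (mi i m) (mi j n) * Y (mi k n) (mi i l)) *: T j k).
  apply: eq_bigr => i _; rewrite -mulmxA mulmx_entry sum_mi; apply: eq_bigr => j _.
  rewrite exchange_big; apply: eq_bigr => n _; rewrite mul_tens1_entry mulr_sumr; apply: eq_bigr => k _.
  by rewrite !toA_entry mulr_algl mulr_algr scalerA.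
rewrite exchange_big; apply: eq_bigr => j _; rewrite exchange_big; apply: eq_bigr => k _.
rewrite /crossform scaler_suml; apply: eq_bigr => i _; by rewrite scaler_suml.
Qed.

(** A conjugation by a scalar matrix acting on the first factor commutes with
    L_2, so it can be moved from L to the R-matrices. *)
Lemma gauge_exchange (G Gi : 'M[C]_N) (Rs Rs' Rx S : 'M[C]_(N * N)) (Ls L2 : 'M[A]_N) :
  G *m Gi = 1%:M ->
  tensmx G 1%:M *m Rs = Rx *m tensmx G 1%:M -> Rs' *m tensmx Gi 1%:M = tensmx Gi 1%:M *m S ->
  toA Rs *m tens1 Ls *m tens2 L2 = tens2 L2 *m tens1 Ls *m toA Rs' ->
  toA Rx *m tens1 (toA G *m Ls *m toA Gi) *m tens2 L2 =
  tens2 L2 *m tens1 (toA G *m Ls *m toA Gi) *m toA S.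
Proof.
move=> g hR hR' e.
rewrite !tens1M.
have c1 := tens1_tens2_comm G L2; have c2 := tens1_tens2_comm Gi L2.
have r1 : toA Rx *m tens1 (toA G) = tens1 (toA G) *m toA Rs by rewrite -tens1_toA -!toAM hR.
have r2 : tens1 (toA Gi) *m toA S = toA Rs' *m tens1 (toA Gi) by rewrite -tens1_toA -!toAM hR'.
rewrite !mulmxA r1 -(mulmxA _ _ (tens2 L2)) c2 -(mulmxA _ _ (toA S)) r2 -c1 !mulmxA.
by rewrite -(mulmxA (tens1 (toA G)) (toA Rs)) -(mulmxA _ _ (tens2 L2)) e !mulmxA.
Qed.

(** The second relation gives X_2 S^-1 K_1 = K_1 Rx' X_2 with K the inverse of Lm; substituted in the
    first one, it gives X_2 (Lp K)_1 = Ry (Lp K)_1 Rx' X_2. The partial trace of the left hand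
    side is X tr (Lp K), and that of the right hand side is evaluated by crossing. *)
Lemma trace_exchange (Rx Rx' Ry S S' : 'M[C]_(N * N)) (Lp Lm K X : 'M[A]_N) w :
  toA Ry *m tens1 Lp *m tens2 X = tens2 X *m tens1 Lp *m toA S ->
  toA Rx *m tens1 Lm *m tens2 X = tens2 X *m tens1 Lm *m toA S ->
  is_invmx Lm K -> S *m S' = 1%:M -> Rx' *m Rx = 1%:M ->
  (forall m l j k, crossform Ry Rx' m l j k = w * ((k == j) && (m == l))%:R) ->
  forall m l, X m l * \tr (Lp *m K) = w *: (\tr (Lp *m K) * X m l).
Proof.
move=> h1 h2 [k1 k2] hS hR hc m l.
have kk1 : tens1 Lm *m tens1 K = 1%:M by rewrite -tens1M k1 tens1_1.
have kk2 : tens1 K *m tens1 Lm = 1%:M by rewrite -tens1M k2 tens1_1.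
have sS : toA S *m toA S' = 1%:M by rewrite -toAM hS toA1.
have rR : toA Rx' *m toA Rx = 1%:M by rewrite -toAM hR toA1.
have e1 : tens2 X *m toA S' *m tens1 K = tens1 K *m toA Rx' *m tens2 X.
  have : tens1 K *m toA Rx' *m (toA Rx *m tens1 Lm *m tens2 X) = tens2 X.
    by rewrite !mulmxA -(mulmxA _ (toA Rx')) rR mulmx1 kk2 mul1mx.
  rewrite h2 => e; rewrite -{1}e !mulmxA -(mulmxA _ (toA S)) sS mulmx1.
  by rewrite -(mulmxA _ (tens1 Lm)) kk1 mulmx1.
have e2 : tens2 X *m tens1 (Lp *m K) = toA Ry *m tens1 (Lp *m K) *m toA Rx' *m tens2 X.
  rewrite !tens1M.
  have -> : tens2 X *m (tens1 Lp *m tens1 K) = (tens2 X *m tens1 Lp *m toA S) *m toA S' *m tens1 K.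
    by rewrite -(mulmxA _ (toA S)) sS mulmx1 mulmxA.
  by rewrite -h1 -!mulmxA (mulmxA (tens2 X)) e1 !mulmxA.
rewrite -tr1_tens2l e2 tr1_tens2r mulmx_entry (bigD1 m) //= big1 => [|n nm].
  rewrite addr0 tr1_sandwich; have -> : \sum_j \sum_k crossform Ry Rx' m m j k *: (Lp *m K) j k = w *: \tr (Lp *m K).
    rewrite scaler_sumr; apply: eq_bigr => j _; rewrite (bigD1 j) //= big1 ?addr0 => [|k kj].
      by rewrite hc !eqxx mulr1.
    by rewrite hc (negbTE kj) mulr0 scale0r.
  by rewrite scalerAl.
rewrite tr1_sandwich big1 ?mul0r // => j _; rewrite big1 // => k _.
by rewrite hc [m == n]eq_sym (negbTE nm) andbF mulr0 scale0r.
Qed.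

Lemma toA_scale (a : C) m (X : 'M[C]_m) : toA (a *: X) = a%:A *: toA X.
Proof. by apply/matrixP => i j; rewrite !mxE -scalerAl mul1r scalerA. Qed.

Lemma mulmx_toA_scale (a : C) m n (Z : 'M[A]_(n, m)) (X : 'M[C]_m) : Z *m toA (a *: X) = a%:A *: (Z *m toA X).
Proof.
rewrite toA_scale; apply/matrixP => i j; rewrite scalemx_entry !mulmx_entry mulr_sumr.
by apply: eq_bigr => k _; rewrite scalemx_entry !mulr_algl scalerAr.
Qed.

End Operators.

(** * The exchange relation *)

Section Nonvanishing.
Variable R : realType.
Local Notation C := R[i].
Local Notation md := (@modulus R).
Variables (tau zeta : C) (N : nat).
Hypothesis tau_gt0 : 0 < complex.Im tau.
Hypothesis N_gt0 : (0 < N)%N.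
Hypothesis q1 : md (epi zeta) < 1.
Hypothesis hR : R_defined N zeta tau.
Local Notation f := (th tau).
Local Notation NC := (N%:R : C).

Lemma th_zeta_neq0 : f zeta != 0.
Proof.
have hh := R_definedP tau_gt0 N_gt0 hR.
have [g [_ _ _ hg]] := pair_sum_closed_form tau_gt0 N_gt0; have [n1 _ _ _] := hg _ _ hh hh.
by rewrite mulrC divfK ?pnatr_eq0 -?lt0n // in n1.
Qed.

Lemma Rscalar_neq0 x : reg tau zeta N x -> f (x + zeta) != 0 -> Rscalar tau zeta N x != 0.
Proof.
move=> [[a1 a2 a3 a4] [[b1 b2 b3 b4] [c1 c2 c3]]] f0; rewrite /Rscalar /theta_quot /kappaV.
apply: (mulf_neq0 _ (invr_neq0 f0)).
apply: mulf_neq0; first exact: (mulf_neq0 (epi_neq0 _) th_zeta_neq0).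
apply: mulf_neq0; first exact: (mulf_neq0 c3 (invr_neq0 c1)).
apply: mulf_neq0; first exact: (mulf_neq0 (mulf_neq0 (mulf_neq0 a1 a2) a3) a4).
exact: (invr_neq0 (mulf_neq0 (mulf_neq0 (mulf_neq0 b1 b2) b3) b4)).
Qed.

Lemma inversion_factor_neq0 x : f (x + zeta) != 0 -> f (x - zeta) != 0 -> inversion_factor tau zeta x != 0.
Proof.
move=> n1 n2; rewrite /inversion_factor; apply: mulf_neq0; first by rewrite oppr_eq0; exact: mulf_neq0.
by apply: invr_neq0; apply: expf_neq0; exact: th_zeta_neq0.
Qed.

(** Off the poles and zeros of the scalars in R(x) and R'(x). *)
Definition invertible_at x : Prop :=
  [/\ reg tau zeta N x, f (x + zeta) != 0 & f (x - zeta) != 0].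

Lemma generic_invertible : generic invertible_at.
Proof.
have g := generic_and (generic_reg tau_gt0 N_gt0 q1)
  (generic_and (generic_th zeta tau_gt0) (generic_th (- zeta) tau_gt0)).
by apply: generic_imp g => x [h1 [h2 h3]]; split.
Qed.

Lemma Rinv_right x : invertible_at x -> Rhat N x zeta tau *m Rinv tau zeta N x = 1%:M.
Proof. by move=> [h1 h2 h3]; apply: (Rhat_inv tau_gt0 N_gt0 hR); [exact: Rscalar_neq0 | exact: inversion_factor_neq0]. Qed.

Lemma Rinv_left x : invertible_at x -> Rinv tau zeta N x *m Rhat N x zeta tau = 1%:M.
Proof. by move=> h; apply: mulmx1C; exact: Rinv_right. Qed.

Lemma crossing_unitarity x : invertible_at x -> reg tau zeta N (x - NC * zeta) ->
  f (x - NC * zeta + zeta) != 0 ->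
  forall m l j k, crossform (Rhat N (x - NC * zeta) zeta tau) (Rinv tau zeta N x) m l j k =
    ((k == j) && (m == l))%:R.
Proof.
move=> [h1 h2 h3] h4 h5; apply: (crossing tau_gt0 N_gt0 hR).
- by rewrite addrAC subrr add0r.
- rewrite [f _ * f x]mulrC; exact: (Rscalar_crossing tau_gt0 N_gt0 q1).
- exact: th_zeta_neq0.
- exact: Rscalar_neq0.
- exact: inversion_factor_neq0.
Qed.

End Nonvanishing.

Lemma nome_Im_gt0 (R : realType) (tau : R[i]) : `|epi (2 * tau)| < 1 -> 0 < complex.Im tau.
Proof.
rewrite modulusE ltcR modulus_epi expR_lt1 -(rmorph_nat (real_complex R) 2).
case: tau => a b /=; rewrite mul0r addr0 oppr_lt0 pmulr_rgt0 ?pi_gt0 // pmulr_rgt0 //.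
Qed.

Lemma generic_off_poles (R : realType) (P : R[i] -> R[i] -> Prop) :
  generic (fun x => forall xi eta, xi - eta = x -> P xi eta) -> off_poles P.
Proof. by move=> [S hS h]; exists S => // xi eta hx; apply: h hx _ _ erefl. Qed.

Lemma off_poles_generic (R : realType) (P : R[i] -> R[i] -> Prop) :
  off_poles P -> generic (fun x => forall xi eta, xi - eta = x -> P xi eta).
Proof. by move=> [S hS h]; exists S => // x hx xi eta e; apply: h; rewrite e. Qed.

Lemma crossform_scale (R : realType) N (a b : R[i]) (X Y : 'M[R[i]]_(N * N)) m l j k :
  crossform (a *: X) (b *: Y) m l j k = a * b * crossform X Y m l j k.
Proof.
rewrite /crossform mulr_sumr; apply: eq_bigr => i _; rewrite mulr_sumr; apply: eq_bigr => n _.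
by rewrite !scalemx_entry mulrACA.
Qed.

Theorem theorem4 (R : realType) (N : nat) (M : int) (zeta tau c : R[i])
    (A : algType R[i]) (L : sl_realization N zeta tau c A) :
  (2 <= N)%N -> M != 0 ->
  `|epi zeta| < 1 -> `|epi (2 * tau)| < 1 -> `|epi (2 * (tau - c * zeta))| < 1 ->
  R_defined N zeta tau -> R_defined N zeta (tau - c * zeta) ->
  on_surface N M zeta tau c ->
  off_poles (fun xi eta : R[i] =>
    forall Lminv : 'M[A]_N, is_invmx (Lminus tau (genL L) xi) Lminv ->
    forall i j : 'I_N,
      tgen zeta c (genL L) xi Lminv * genL L eta i j
      = Fexch N M (epi zeta) (epi (2 * tau)) (epi (eta - xi))
        *: (genL L eta i j * tgen zeta c (genL L) xi Lminv)).
Proof.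
move=> N2 M0 q1 /nome_Im_gt0 t0 /nome_Im_gt0 t0' hR hR' hs.
have N_gt0 : (0 < N)%N by exact: ltnW.
rewrite modulusE ltcR in q1.
set taus := tau - c * zeta in t0' hR' *.
have hE := off_poles_generic (genL_exchange L).
apply: generic_off_poles.
have gp : generic (surface_path tau zeta N M).
  apply: generic_all => j.
  have g := generic_shift ((if 0 < M then - (j%:R * (tau + 1)) else j%:R * (tau + 1)) - N%:R * zeta) (generic_reg t0 N_gt0 q1).
  by apply: generic_imp g => x; rewrite addrA addrAC.
have g1 := generic_and (generic_shift (c * zeta) hE) (generic_shift (tau + 1) hE).
have g2 := generic_and (generic_invertible t0 N_gt0 q1) (generic_shift (tau + 1) (generic_reg t0 N_gt0 q1)).
have g3 := generic_and (generic_shift (c * zeta) (generic_invertible t0' N_gt0 q1))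
  (generic_shift (tau + 1) (generic_reg t0' N_gt0 q1)).
have g4 := generic_and (generic_shift (- (N%:R * zeta)) (generic_reg t0 N_gt0 q1))
  (generic_th (- (N%:R * zeta) + zeta) t0).
apply: generic_imp (generic_and gp (generic_and g1 (generic_and g2 (generic_and g3 g4)))).
move=> x [hp [[E1 E2] [[I1 r1] [[I2 r2] [r3 f3]]]]] xi eta hx K hK i j.
rewrite addrA in r1; rewrite addrA in f3.
(* - p^(1/2) and its starred analogue differ by q^c, the shift from x to y *)
have ey : x + (tau + 1) = x + c * zeta + taus + 1 by rewrite /taus; ring.
rewrite ey in r2.
have [kk kk0 [hkk hF]] := Rhat_surface t0 N_gt0 q1 hR M0 hs hp.
have ex : epi (eta - xi) = epi (- x) by rewrite -hx opprB.
have I1reg : reg tau zeta N x by case: I1.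
have I2reg : reg taus zeta N (x + c * zeta) by case: I2.
have Ux := tau_factor_neq0 N_gt0 q1 I1reg; have Uy := tau_factor_neq0 N_gt0 q1 I2reg.
set u := tau_factor zeta N x in hF Ux *; set v := tau_factor zeta N (x + c * zeta) in hF Uy *.
(* the factors 1/U are put into the R-matrices, so that S is common to both relations *)
pose Ry := v^-1 *: Rhat N (x + c * zeta) zeta tau.
pose Rx := u^-1 *: Rhat N x zeta tau.
pose Rx' := u *: Rinv tau zeta N x.
pose S := v^-1 *: Rhat N (x + c * zeta) zeta taus.
pose S' := v *: Rinv taus zeta N (x + c * zeta).
have h1 : toA A Ry *m tens1 (genL L (xi + c * zeta)) *m tens2 (genL L eta) =
    tens2 (genL L eta) *m tens1 (genL L (xi + c * zeta)) *m toA A S.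
  have e1 : xi + c * zeta - eta = x + c * zeta by rewrite -hx addrAC.
  have := E1 _ _ e1; rewrite e1 => e.
  by rewrite mulmx_toA_scale -e toA_scale -!scalemxAl.
have h2 : toA A Rx *m tens1 (Lminus tau (genL L) xi) *m tens2 (genL L eta) =
    tens2 (genL L eta) *m tens1 (Lminus tau (genL L) xi) *m toA A S.
  have e2 : xi + tau + 1 - eta = x + (tau + 1) by rewrite -hx; ring.
  have := E2 _ _ e2; rewrite e2 => e.
  apply: (gauge_exchange _ _ _ e).
  - exact: mulmxV (Gmx_unit R N_gt0).
  - by rewrite addrA; exact: Rhat_shift.
  - by rewrite ey; exact: Rhat_shift_inv.
have hS : S *m S' = 1%:M.
  by rewrite /S /S' -scalemxAl -scalemxAr scalerA mulVf // scale1r; exact: Rinv_right.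
have hX : Rx' *m Rx = 1%:M.
  by rewrite /Rx /Rx' -scalemxAl -scalemxAr scalerA mulfV // scale1r; exact: Rinv_left.
have hc m l j' k' : crossform Ry Rx' m l j' k' = (v^-1 * kk * u) * ((k' == j') && (m == l))%:R.
  by rewrite /Ry /Rx' hkk scalerA crossform_scale (crossing_unitarity t0 N_gt0 q1 hR I1 r3 f3).
have := trace_exchange h1 h2 hK hS hX hc i j.
have -> : \tr (genL L (xi + c * zeta) *m K) = tgen zeta c (genL L) xi K.
  by rewrite /tgen /Lplus; congr (\tr (genL L _ *m K)); field.
move=> ->; rewrite ex scalerA.
have -> : Fexch N M (epi zeta) (epi (2 * tau)) (epi (- x)) * (v^-1 * kk * u) = 1.
  transitivity (u * kk * Fexch N M (epi zeta) (epi (2 * tau)) (epi (- x)) / v); first by ring.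
  by rewrite hF divff.
by rewrite scale1r.
Qed.
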